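(* Let $n\ge 1$ and suppose that a group $G$ $n$-acts on a geometry $P'$, the action being $\omega$-homogeneous with respect to a group $\Sigma$ of automorphisms of the action. If $G$ admits hereditarily unique generics with respect to $\Sigma$, then either there is an $A$-invariant non-classical unbounded subgroup of $G$ (for some finite $A\subseteq P'$), or $n\in\{1,2,3\}$ and: - if $n=1$ then $G$ is abelian and acts regularly on $P'$; - if $n=2$ the action of $G$ on $P'$ is isomorphic to the affine action of $K^+\rtimes K^*$ on an algebraically closed field $K$; - if $n=3$ the action of $G$ on $P'$ is isomorphic to the action of $\mathrm{PGL}_2(K)$ on the projective line $\mathbb{P}^1(K)$ of an algebraically closed field $K$.
   Context: **Group actions on pregeometries.** $(P,\mathrm{cl})$ is a pregeometry with $\mathrm{cl}(\emptyset)=\emptyset$, infinite-dimensional with $\dim(P)=|P|$; it is a geometry if moreover $\mathrm{cl}(a)=\{a\}$ for all $a\in P$. Bounded means of size less than $|P|$. A group $G$ acts on $P$ respecting the pregeometry: $a\in\mathrm{cl}(X)$ iff $ga\in\mathrm{cl}(g(X))$. The action is an $n$-action (''$G$ $n$-acts on $P$'') if it - has rank $n$: whenever $\bar x,\bar y$ are $n$-tuples of $P$ with $\dim(\bar x\bar y)=2n$ there is $g\in G$ with $g\bar x=\bar y$, but for some $(n+1)$-tuples $\bar x,\bar y$ with $\dim(\bar x\bar y)=2n+2$ there is no $g\in G$ with $g\bar x=\bar y$; and - is $(n+1)$-determined: if $g,h\in G$ agree on an $(n+1)$-dimensional subset of $P$ then $g=h$. An automorphism $\sigma$ of the action is a pair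 consisting of an automorphism of the group $G$ and an automorphism of $(P,\mathrm{cl})$, both denoted $\sigma$, with $\sigma(gx)=\sigma(g)\sigma(x)$. For a group $\Sigma$ of such automorphisms, the action is $\omega$-homogeneous with respect to $\Sigma$ if whenever $X\subseteq P$ is finite and $x,y\in P\setminus\mathrm{cl}(X)$ there is $\sigma\in\Sigma$ fixing $X$ pointwise with $\sigma(x)=y$. $\Sigma_A$ is the group of $\sigma\in\Sigma$ fixing $A$ pointwise; a set is $A$-invariant if it is fixed setwise by all $\sigma\in\Sigma_A$. **Generics.** For $X\subseteq P$, $\mathrm{tp}(g/X)$ is the orbit of $g\in G$ under $\Sigma_X$. $g\in G$ is generic over $X$ if there is an independent $n$-tuple $\bar x$ of $P$ with $\dim(\bar x g(\bar x)/X)=2n$. $G$ has unique generics if for all finite $X\subseteq P$ and all $g,h\in G$ generic over $X$, $\mathrm{tp}(g/X)=\mathrm{tp}(h/X)$. For an independent $k$-set $A\subseteq P$, $k<n$: $G_A$ is the pointwise stabiliser of $A$, and $P_A$ is the pregeometry on $P\setminus\mathrm{cl}(A)$ with $\mathrm{cl}_A(X)=\mathrm{cl}(A\cup X)\setminus\mathrm{cl}(A)$; $G_A$ has an $(n-k)$-action on $P_A$, homogeneous with respect to $\Sigma_A$. $G$ admits hereditarily unique generics if $G$ has unique generics and for any independent $k$-set $A\subseteq P$ with $k<n$ there is a normal subgroup $G'$ of $G_A$ such that the action of $G'$ on $P_A$ is a homogeneous $(n-k)$-action (with respect to the automorphisms induced by $\Sigma_A$) which has unique generics. **Non-classical groups.**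 An infinite structure $M$ carries an $\omega$-homogeneous pregeometry if there is a closure operator $\mathrm{cl}:\mathcal{P}(M)\to\mathcal{P}(M)$, invariant under automorphisms of $M$, satisfying the axioms of a pregeometry, with $\dim(M)=\|M\|$, such that whenever $X\subseteq M$ is finite and $a,b\notin\mathrm{cl}(X)$ there is an automorphism of $M$ preserving $\mathrm{cl}$, fixing $X$ pointwise and sending $a$ to $b$. A group is non-classical if it is nonabelian and carries (as a structure, the group operation possibly together with additional structure) an $\omega$-homogeneous pregeometry. An action is regular if it is sharply transitive. *)

(* Defs.v *)
From HB Require Import structures.
From mathcomp Require Import all_boot all_order all_algebra generic_quotient.
From mathcomp Require Import boolp classical_sets functions cardinality.
Set Implicit Arguments.
Unset Strict Implicit.
Unset Printing Implicit Defensive.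
Import GRing.Theory.
Local Open Scope group_scope.
Local Open Scope quotient_scope.
Local Open Scope classical_set_scope.
Local Open Scope card_scope.

Section Pregeometry.
Variables (P : Type) (cl : set P -> set P).

Record is_pregeometry : Prop := IsPregeometry {
  cl_ext : forall X, X `<=` cl X;
  cl_mono : forall X Y, X `<=` Y -> cl X `<=` cl Y;
  cl_idem : forall X, cl (cl X) = cl X;
  cl_fin : forall X a, cl X a ->
    exists X0, [/\ finite_set X0, X0 `<=` X & cl X0 a];
  cl_exch : forall X a b, cl (X `|` [set b]) a -> ~ cl X a ->
    cl (X `|` [set a]) b }.

Definition is_geometry : Prop :=
  is_pregeometry /\ forall a, cl [set a] = [set a].

Definition indep_over (Y B : set P) : Prop :=
  forall b, B b -> ~ cl (Y `|` (B `\ b)) b.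

Definition independent (B : set P) : Prop := indep_over set0 B.

Definition basis_over (Y X B : set P) : Prop :=
  [/\ B `<=` X, indep_over Y B & X `<=` cl (Y `|` B)].

(* dim (X / Y) = k, for finite k *)
Definition dim_over (Y X : set P) (k : nat) : Prop :=
  exists2 B, basis_over Y X B & B #= `I_k.

Definition dim (X : set P) (k : nat) : Prop := dim_over set0 X k.

Definition infinite_dimensional : Prop :=
  exists2 B, basis_over set0 [set: P] B & infinite_set B.

Definition dim_eq_card : Prop :=
  exists2 B, basis_over set0 [set: P] B & B #= [set: P].

Definition indep_tuple (k : nat) (x : 'I_k -> P) : Prop :=
  injective x /\ independent (range x).

Definition preserves_cl (f : P -> P) : Prop :=
  forall X a, cl X a <-> cl (f @` X) (f a).

End Pregeometry.

(* The localisation cl_A on P_A = P \ cl A. *)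
Definition loc_carrier (P : Type) (cl : set P -> set P) (A : set P) : set P :=
  ~` cl A.

Definition loc_cl (P : Type) (cl : set P -> set P) (A : set P)
    (X : set (loc_carrier cl A)) : set (loc_carrier cl A) :=
  [set y | cl (A `|` [set val x | x in X]) (val y)].

Arguments loc_cl {P} cl A X.

Definition is_subgroup (G : groupType) (H : set G) : Prop :=
  H 1 /\ forall x y, H x -> H y -> H (x * y^-1).

Record subgroup (G : groupType) := Subgroup {
  sg_set :> set G;
  sg_closed : is_subgroup sg_set }.

Definition sg_type (G : groupType) (H : subgroup G) : Type := {x : G | x \in sg_set H}.

Section SubgroupType.
Variables (G : groupType) (H : subgroup G).
HB.instance Definition _ := SubChoice.on (sg_type H).

Lemma sg_group_closed : group_closed (fun x : G => x \in sg_set H).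
Proof.
case: (sg_closed H) => H1 HD; split; first by rewrite unfold_in inE.
by move=> x y; rewrite !unfold_in !inE; apply: HD.
Qed.

HB.instance Definition _ :=
  SubChoice_isSubGroup.Build G _ (sg_type H) sg_group_closed.
End SubgroupType.

Definition abelian_group (G : groupType) : Prop :=
  forall x y : G, x * y = y * x.

Section Actions.
Variables (G : groupType) (P : Type) (act : G -> P -> P) (cl : set P -> set P).

Definition is_action : Prop :=
  (forall x, act 1 x = x) /\
  (forall g h x, act (g * h) x = act g (act h x)).

Definition regular_action : Prop := forall x y, exists! g, act g x = y.

Definition has_rank (n : nat) : Prop :=
  (forall x y : 'I_n -> P, dim cl (range x `|` range y) (2 * n) ->
    exists g, forall i, act g (x i) = y i) /\
  (exists x y : 'I_n.+1 -> P,
    dim cl (range x `|` range y) (2 * n + 2) /\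
    ~ exists g, forall i, act g (x i) = y i).

Definition determined (k : nat) : Prop :=
  forall g h (X : set P), dim cl X k ->
    (forall x, X x -> act g x = act h x) -> g = h.

Definition n_action (n : nat) : Prop :=
  [/\ is_action, forall g, preserves_cl cl (act g),
      has_rank n & determined n.+1].

Definition pt_stab (A : set P) : set G :=
  [set g | forall a, A a -> act g a = a].

(* An automorphism of the action: a map on G paired with a map on P. *)
Definition auto : Type := ((G -> G) * (P -> P))%type.

Definition is_action_auto (s : auto) : Prop :=
  [/\ bijective s.1, {morph s.1 : g h / g * h},
      bijective s.2, preserves_cl cl s.2 &
      forall g x, s.2 (act g x) = act (s.1 g) (s.2 x)].

Definition is_auto_group (Sigma : set auto) : Prop :=
  [/\ forall s, Sigma s -> is_action_auto s,
      Sigma (id, id),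
      forall s t, Sigma s -> Sigma t -> Sigma (s.1 \o t.1, s.2 \o t.2) &
      forall s, Sigma s -> exists2 t, Sigma t &
        [/\ cancel s.1 t.1, cancel t.1 s.1, cancel s.2 t.2 & cancel t.2 s.2]].

Variable Sigma : set auto.

Definition fixing (A : set P) : set auto :=
  [set s | Sigma s /\ forall a, A a -> s.2 a = a].

Definition omega_homogeneous : Prop :=
  forall X x y, finite_set X -> ~ cl X x -> ~ cl X y ->
    exists2 s, fixing X s & s.2 x = y.

Definition is_invariant (A : set P) (Y : set G) : Prop :=
  forall s, fixing A s -> s.1 @` Y = Y.

Definition tp (g : G) (X : set P) : set G := [set s.1 g | s in fixing X].

Definition generic (n : nat) (X : set P) (g : G) : Prop :=
  exists2 x : 'I_n -> P, indep_tuple cl x &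
    dim_over cl X (range x `|` range (act g \o x)) (2 * n).

Definition unique_generics (n : nat) : Prop :=
  forall X g h, finite_set X -> generic n X g -> generic n X h ->
    tp g X = tp h X.

Definition bounded (Y : set G) : Prop :=
  (Y #<= [set: P]) /\ ~ ([set: P] #<= Y).

Definition normal_in (N H : set G) : Prop :=
  N `<=` H /\ forall g h, N g -> H h -> N (h * g * h^-1).

(* Restrictions to H acting on P_A.  The default value of insubd is
   never taken when H fixes A pointwise, resp. when s fixes A pointwise and
   maps H to itself: lemmas val_restr_act and val_restr_auto below. *)
Definition restr_act (H : subgroup G) (A : set P) :
    sg_type H -> loc_carrier cl A -> loc_carrier cl A :=
  fun g x => insubd x (act (val g) (val x)).

Definition restr_auto (H : subgroup G) (A : set P) (s : auto) :
    (sg_type H -> sg_type H) * (loc_carrier cl A -> loc_carrier cl A) :=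
  (fun g => insubd g (s.1 (val g)), fun x => insubd x (s.2 (val x))).

End Actions.
Arguments restr_act {G P} act cl H A g x.
Arguments restr_auto {G P} cl H A s.

Lemma preserves_cl_fix (P : Type) (cl : set P -> set P) (f : P -> P)
    (A : set P) : preserves_cl cl f -> (forall a, A a -> f a = a) ->
  forall x, cl A x <-> cl A (f x).
Proof.
move=> fcl fA x; rewrite (fcl A x).
suff -> : f @` A = A by [].
apply/seteqP; split => [_ [a Aa <-]|a Aa]; first by rewrite fA.
by exists a => //; apply: fA.
Qed.

Lemma val_restr_act (G : groupType) (P : Type) (act : G -> P -> P)
    (cl : set P -> set P) (H : subgroup G) (A : set P) :
    (forall g, preserves_cl cl (act g)) -> H `<=` pt_stab act A ->
  forall (g : sg_type H) (x : loc_carrier cl A),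
    val (restr_act act cl H A g x) = act (val g) (val x).
Proof.
move=> actcl HA g x; rewrite /restr_act insubdK // unfold_in inE => Ax.
have Hg : sg_set H (val g) by have := valP g; rewrite inE.
have: (val x \in loc_carrier cl A) := valP x; rewrite inE; apply.
exact: (proj2 (preserves_cl_fix (actcl (val g)) (HA _ Hg) (val x))).
Qed.

Lemma val_restr_auto (G : groupType) (P : Type) (cl : set P -> set P)
    (H : subgroup G) (A : set P) (s : auto G P) :
    preserves_cl cl s.2 -> (forall a, A a -> s.2 a = a) -> s.1 @` H = H ->
  (forall g : sg_type H, val ((restr_auto cl H A s).1 g) = s.1 (val g)) /\
  (forall x : loc_carrier cl A, val ((restr_auto cl H A s).2 x) = s.2 (val x)).
Proof.
move=> scl sA sH; split=> [g|x] /=; rewrite insubdK // unfold_in inE.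
  have Hg : sg_set H (val g) by have := valP g; rewrite inE.
  by have: (s.1 @` H) (s.1 (val g)) by [exists (val g)]; rewrite sH.
move=> Ax; have: (val x \in loc_carrier cl A) := valP x; rewrite inE; apply.
exact: (proj2 (preserves_cl_fix scl sA (val x))).
Qed.

Definition induced (G : groupType) (P : Type) (cl : set P -> set P)
    (Sigma : set (auto G P)) (H : subgroup G) (A : set P) :
    set (auto (sg_type H) (loc_carrier cl A)) :=
  [set restr_auto cl H A s | s in fixing Sigma A].
Arguments induced {G P} cl Sigma H A.

(* Invariance of G' under Sigma_A is what makes [induced] a group of
   automorphisms of the action of G' on P_A. *)
Definition hereditarily_unique_generics (G : groupType) (P : Type)
    (act : G -> P -> P) (cl : set P -> set P) (Sigma : set (auto G P))
    (n : nat) : Prop :=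
  unique_generics act cl Sigma n /\
  forall (k : nat) (A : set P), (k < n)%N -> independent cl A -> A #= `I_k ->
    exists G' : subgroup G,
      [/\ normal_in G' (pt_stab act A),
          is_invariant Sigma A G',
          n_action (restr_act act cl G' A) (loc_cl cl A) (n - k),
          omega_homogeneous (loc_cl cl A) (induced cl Sigma G' A) &
          unique_generics (restr_act act cl G' A) (loc_cl cl A)
            (induced cl Sigma G' A) (n - k)].

Record language := Language {
  rel_sym : Type;
  rel_arity : rel_sym -> nat;
  fun_sym : Type;
  fun_arity : fun_sym -> nat }.

Record structure_on (L : language) (M : Type) := StructureOn {
  rel_int : forall r : rel_sym L, ('I_(rel_arity r) -> M) -> Prop;
  fun_int : forall f : fun_sym L, ('I_(fun_arity f) -> M) -> M }.

Definition is_structure_auto (L : language) (M : Type) (S : structure_on L M)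
    (s : M -> M) : Prop :=
  [/\ bijective s,
      forall (r : rel_sym L) v,
        rel_int S (r := r) v <-> rel_int S (r := r) (s \o v) &
      forall (f : fun_sym L) v,
        s (fun_int S (f := f) v) = fun_int S (f := f) (s \o v)].

Definition carries_homogeneous_pregeometry (L : language) (M : Type)
    (S : structure_on L M) : Prop :=
  infinite_set [set: M] /\
  exists cl : set M -> set M,
    [/\ is_pregeometry cl,
        forall s, is_structure_auto S s -> forall X, s @` cl X = cl (s @` X),
        dim_eq_card cl &
        forall X a b, finite_set X -> ~ cl X a -> ~ cl X b ->
          exists s, [/\ is_structure_auto S s, preserves_cl cl s,
            forall x, X x -> s x = x & s a = b]].

(* S is the group G, possibly with additional structure. *)
Definition expands_group (G : groupType) (L : language)
    (S : structure_on L G) : Prop :=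
  exists2 m : fun_sym L, fun_arity m = 2 &
    forall (v : 'I_(fun_arity m) -> G) (i j : 'I_(fun_arity m)),
      val i = 0 -> val j = 1%N -> fun_int S v = v i * v j.

Definition nonclassical (G : groupType) : Prop :=
  ~ abelian_group G /\
  exists (L : language) (S : structure_on L G),
    expands_group S /\ carries_homogeneous_pregeometry S.

Definition isomorphic_actions (G H : groupType) (P Q : Type)
    (actG : G -> P -> P) (actH : H -> Q -> Q) : Prop :=
  exists (phi : G -> H) (f : P -> Q),
    [/\ bijective phi, {morph phi : g h / g * h}, bijective f &
        forall g x, f (actG g x) = actH (phi g) (f x)].

(* The group of units of a ring; MathComp's {unit R} is for finite rings. *)
Definition unit_group (R : unitRingType) : Type :=
  {x : R | x \is a GRing.unit}.

Section UnitGroup.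
Variable R : unitRingType.
HB.instance Definition _ := SubChoice.on (unit_group R).
Implicit Types x y z : unit_group R.

Definition unit_one : unit_group R := Sub 1%R (unitr1 R).

Lemma unit_mul_subproof x y : (val x * val y)%R \is a GRing.unit.
Proof. by rewrite unitrMl (valP x, valP y). Qed.

Definition unit_mul x y : unit_group R :=
  Sub (val x * val y)%R (unit_mul_subproof x y).

Lemma unit_inv_subproof x : ((val x)^-1)%R \is a GRing.unit.
Proof. by rewrite unitrV (valP x). Qed.

Definition unit_inv x : unit_group R :=
  Sub ((val x)^-1)%R (unit_inv_subproof x).

Lemma unit_mulA : associative unit_mul.
Proof. by move=> x y z; apply: val_inj; rewrite /= mulrA. Qed.

Lemma unit_mul1 : left_id unit_one unit_mul.
Proof. by move=> x; apply: val_inj; rewrite /= mul1r. Qed.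

Lemma unit_mulr1 : right_id unit_one unit_mul.
Proof. by move=> x; apply: val_inj; rewrite /= mulr1. Qed.

Lemma unit_mulV : left_inverse unit_one unit_inv unit_mul.
Proof. by move=> x; apply: val_inj; rewrite /= mulVr ?(valP x). Qed.

Lemma unit_mulrV : right_inverse unit_one unit_inv unit_mul.
Proof. by move=> x; apply: val_inj; rewrite /= divrr ?(valP x). Qed.

HB.instance Definition _ := isGroup.Build (unit_group R)
  unit_mulA unit_mul1 unit_mulr1 unit_mulV unit_mulrV.
End UnitGroup.

(* K^+ x| K^*: the pair (b, a) is the map x |-> a x + b. *)
Definition affine_group (K : fieldType) : Type := (K * unit_group K)%type.

Section Affine.
Variable K : fieldType.
HB.instance Definition _ := Choice.on (affine_group K).
Implicit Types x y z : affine_group K.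

Definition aff_one : affine_group K := (0%R, 1).
Definition aff_mul x y : affine_group K :=
  ((x.1 + val x.2 * y.1)%R, x.2 * y.2).
Definition aff_inv x : affine_group K :=
  ((- (val (x.2^-1)%g * x.1))%R, x.2^-1).

Lemma val_unitM (a b : unit_group K) : val (a * b) = (val a * val b)%R.
Proof. by []. Qed.

Lemma aff_mulA : associative aff_mul.
Proof.
by move=> x y z; rewrite /aff_mul /= mulgA mulrDr mulrA addrA.
Qed.

Lemma aff_mul1 : left_id aff_one aff_mul.
Proof. by case=> b a; rewrite /aff_mul /= mul1g mul1r add0r. Qed.

Lemma aff_mulr1 : right_id aff_one aff_mul.
Proof. by case=> b a; rewrite /aff_mul /= mulg1 mulr0 addr0. Qed.

Lemma aff_mulV : left_inverse aff_one aff_inv aff_mul.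
Proof. by case=> b a; rewrite /aff_mul /= mulVg addNr. Qed.

Lemma aff_mulrV : right_inverse aff_one aff_inv aff_mul.
Proof.
case=> b a; rewrite /aff_mul /= mulgV mulrN mulrA divrr ?(valP a) //.
by rewrite mul1r subrr.
Qed.

HB.instance Definition _ := isGroup.Build (affine_group K)
  aff_mulA aff_mul1 aff_mulr1 aff_mulV aff_mulrV.

Definition aff_act (g : affine_group K) (x : K) : K :=
  (val g.2 * x + g.1)%R.

Lemma aff_actP : is_action aff_act.
Proof.
split=> [x|g h x]; first by rewrite /aff_act mul1r addr0.
by rewrite /aff_act val_unitM mulrDr mulrA -addrA [X in (_ + X)%R]addrC.
Qed.
End Affine.

Section PGL2.
Variable K : fieldType.

Definition GL2 : Type := unit_group 'M[K]_2.
HB.instance Definition _ := Group.on GL2.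

Definition scalar_equiv (A B : GL2) : bool :=
  `[< exists2 c : K, c != 0%R & val A = (c *: val B)%R >].

Lemma scalar_equiv_refl : reflexive scalar_equiv.
Proof. by move=> A; apply/asboolP; exists 1%R; rewrite ?oner_neq0 ?scale1r. Qed.

Lemma scalar_equiv_sym : symmetric scalar_equiv.
Proof.
suff h A B : scalar_equiv A B -> scalar_equiv B A.
  by move=> A B; apply/idP/idP; apply: h.
move=> /asboolP[c c0 h]; apply/asboolP; exists c^-1%R; first by rewrite invr_eq0.
by rewrite h scalerA mulVf ?scale1r.
Qed.

Lemma scalar_equiv_trans : transitive scalar_equiv.
Proof.
move=> B A C /asboolP[c c0 hA] /asboolP[d d0 hB]; apply/asboolP.
by exists (c * d)%R; rewrite ?mulf_neq0 // hA hB scalerA.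
Qed.

Canonical scalar_equiv_rel :=
  EquivRel scalar_equiv scalar_equiv_refl scalar_equiv_sym scalar_equiv_trans.

Definition PGL2 : Type := {eq_quot scalar_equiv}.
HB.instance Definition _ := Choice.on PGL2.
HB.instance Definition _ := EqQuotient.on PGL2.

Definition PGL_one : PGL2 := \pi_PGL2 1.
Definition PGL_mul (p q : PGL2) : PGL2 := \pi_PGL2 (repr p * repr q).
Definition PGL_inv (p : PGL2) : PGL2 := \pi_PGL2 (repr p)^-1.

Lemma PGL_piP (A B : GL2) : (exists2 c : K, c != 0%R & val A = (c *: val B)%R) <->
  \pi_PGL2 A = \pi_PGL2 B.
Proof.
split=> [h|/eqmodP /asboolP //]; apply/eqmodP; exact/asboolP.
Qed.

Lemma PGL_mulE (A B : GL2) :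
  PGL_mul (\pi_PGL2 A) (\pi_PGL2 B) = \pi_PGL2 (A * B).
Proof.
have /PGL_piP[c c0 hA] : \pi_PGL2 (repr (\pi_PGL2 A)) = \pi_PGL2 A by rewrite reprK.
have /PGL_piP[d d0 hB] : \pi_PGL2 (repr (\pi_PGL2 B)) = \pi_PGL2 B by rewrite reprK.
apply/PGL_piP; exists (c * d)%R; first by rewrite mulf_neq0.
have -> : val (repr (\pi_PGL2 A) * repr (\pi_PGL2 B))
  = (val (repr (\pi_PGL2 A)) * val (repr (\pi_PGL2 B)))%R by [].
by rewrite hA hB -scalerAl -scalerAr scalerA.
Qed.

Lemma PGL_invE (A : GL2) : PGL_inv (\pi_PGL2 A) = \pi_PGL2 A^-1.
Proof.
have /PGL_piP[c c0 hA] : \pi_PGL2 (repr (\pi_PGL2 A)) = \pi_PGL2 A by rewrite reprK.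
apply/PGL_piP; exists c^-1%R; first by rewrite invr_eq0.
have -> : val (repr (\pi_PGL2 A))^-1 = ((val (repr (\pi_PGL2 A)))^-1)%R by [].
by rewrite hA invrZ ?unitfE // (valP A).
Qed.

Lemma PGL_mulA : associative PGL_mul.
Proof.
elim/quotW=> A; elim/quotW=> B; elim/quotW=> C.
rewrite (PGL_mulE B C) (PGL_mulE A B) (PGL_mulE A (B * C)).
by rewrite (PGL_mulE (A * B) C) mulgA.
Qed.

Lemma PGL_mul1 : left_id PGL_one PGL_mul.
Proof. by elim/quotW=> A; rewrite PGL_mulE mul1g. Qed.

Lemma PGL_mulr1 : right_id PGL_one PGL_mul.
Proof. by elim/quotW=> A; rewrite PGL_mulE mulg1. Qed.

Lemma PGL_mulV : left_inverse PGL_one PGL_inv PGL_mul.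
Proof. by elim/quotW=> A; rewrite PGL_invE PGL_mulE mulVg. Qed.

Lemma PGL_mulrV : right_inverse PGL_one PGL_inv PGL_mul.
Proof. by elim/quotW=> A; rewrite PGL_invE PGL_mulE mulgV. Qed.

HB.instance Definition _ := isGroup.Build PGL2
  PGL_mulA PGL_mul1 PGL_mulr1 PGL_mulV PGL_mulrV.

Definition nz_vec : Type := {v : 'cV[K]_2 | v != 0%R}.
HB.instance Definition _ := SubChoice.on nz_vec.

Definition proj_equiv (u v : nz_vec) : bool :=
  `[< exists2 c : K, c != 0%R & val u = (c *: val v)%R >].

Lemma proj_equiv_refl : reflexive proj_equiv.
Proof. by move=> A; apply/asboolP; exists 1%R; rewrite ?oner_neq0 ?scale1r. Qed.

Lemma proj_equiv_sym : symmetric proj_equiv.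
Proof.
suff h A B : proj_equiv A B -> proj_equiv B A.
  by move=> A B; apply/idP/idP; apply: h.
move=> /asboolP[c c0 h]; apply/asboolP; exists c^-1%R; first by rewrite invr_eq0.
by rewrite h scalerA mulVf ?scale1r.
Qed.

Lemma proj_equiv_trans : transitive proj_equiv.
Proof.
move=> B A C /asboolP[c c0 hA] /asboolP[d d0 hB]; apply/asboolP.
by exists (c * d)%R; rewrite ?mulf_neq0 // hA hB scalerA.
Qed.

Canonical proj_equiv_rel :=
  EquivRel proj_equiv proj_equiv_refl proj_equiv_sym proj_equiv_trans.

Definition proj_line : Type := {eq_quot proj_equiv}.
HB.instance Definition _ := Choice.on proj_line.
HB.instance Definition _ := EqQuotient.on proj_line.

Lemma GL_vec_subproof (A : GL2) (v : nz_vec) : (val A *m val v)%R != 0%R.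
Proof.
apply: contra (valP v : val v != 0%R) => /eqP Av0.
by rewrite -[val v](mulKmx (valP A)) Av0 mulmx0.
Qed.

Definition GL_vec (A : GL2) (v : nz_vec) : nz_vec :=
  Sub (val A *m val v)%R (GL_vec_subproof A v).

Definition PGL_act (p : PGL2) (l : proj_line) : proj_line :=
  \pi_proj_line (GL_vec (repr p) (repr l)).

Lemma PL_piP (u v : nz_vec) : (exists2 c : K, c != 0%R & val u = (c *: val v)%R) <->
  \pi_proj_line u = \pi_proj_line v.
Proof.
split=> [h|/eqmodP /asboolP //]; apply/eqmodP; exact/asboolP.
Qed.

Lemma PGL_actE (A : GL2) (v : nz_vec) :
  PGL_act (\pi_PGL2 A) (\pi_proj_line v) = \pi_proj_line (GL_vec A v).
Proof.
have /PGL_piP[c c0 hA] : \pi_PGL2 (repr (\pi_PGL2 A)) = \pi_PGL2 A by rewrite reprK.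
have /PL_piP[d d0 hv] : \pi_proj_line (repr (\pi_proj_line v)) = \pi_proj_line v
  by rewrite reprK.
apply/PL_piP; exists (c * d)%R; first by rewrite mulf_neq0.
by rewrite /= hA hv -scalemxAl -scalemxAr scalerA.
Qed.

Lemma PGL_actP : is_action PGL_act.
Proof.
split.
  elim/quotW=> v; rewrite (PGL_actE 1 v).
  by congr (\pi_proj_line _); apply: val_inj; rewrite /= mul1mx.
elim/quotW=> A; elim/quotW=> B; elim/quotW=> v.
have -> : \pi_PGL2 A * \pi_PGL2 B = \pi_PGL2 (A * B) by exact: PGL_mulE.
rewrite (PGL_actE B v) (PGL_actE A) (PGL_actE (A * B)).
by congr (\pi_proj_line _); apply: val_inj; rewrite /= mulmxA.
Qed.
End PGL2.

(* Main.v *)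
(** For an independent [A] of size [n - 1], the group [N] acting on [P] over [A] is
    homogeneous of rank 1; pulling [cl] back along [g |-> g x] gives a homogeneous
    pregeometry on [N], so [N] is non-classical unless it is abelian. When all these
    groups are abelian, they act regularly, and products of them meet each coset of the
    stabilizer of an independent [n]-tuple at most once; uniqueness of generics then
    makes this stabilizer trivial. Commutativity also forces [cl A = A] for fewer than
    [n] points, so [G] is sharply [n]-transitive. For [n = 2] a short computation
    ([(1 + u)(1 + b)] expanded in two ways) yields a regular normal abelian subgroup, hence a
    field; it is algebraically closed because generic polynomials split. For [n = 3]
    the element exchanging 0 and infinity and fixing 1 must be the inversion. For [n > 3]
    two transpositions of points both act on almost all of an abelian group as inversion, so
    their product has too many fixed points. *)

Require Import Defs.
From HB Require Import structures.
From mathcomp Require Import all_boot all_order all_algebra all_field generic_quotient.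
From mathcomp Require Import boolp classical_sets functions cardinality.
Set Implicit Arguments.
Unset Strict Implicit.
Unset Printing Implicit Defensive.
Import GRing.Theory.
Local Open Scope classical_set_scope.
Local Open Scope card_scope.

(** * Lists of points and independence *)

(** The obstacle is a gap of one: transitivity holds on independent [n]-tuples, but an element is
    only known to be determined by its values at [n + 1] independent points. What is available from
    the start is determination by [n] points up to closure, [rank_closure]: for an independent
    [n]-list [s], the point [g w] lies in the closure of [s], [g s] and [w]. This is where the
    failure of transitivity in rank [n + 1] enters. It reduces genericity of [g] to a single tuple
    and its image ([rank_generic]), and it lets the value of [g] at one point replace its value at
    another, which makes evaluation at one point a good source for a pregeometry on the group.
    Unique generics turn determination up to closure into sharpness. The hereditary hypothesis
    concerns only a normal subgroup of each stabilizer; that this subgroup is the full stabilizer is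
    itself a consequence of sharpness ([stab_abelian]). *)

Fixpoint lset (T : Type) (s : seq T) : set T :=
  if s is a :: s' then [set a] `|` lset s' else set0.

(** The ordered form of independence allows induction on lists and appending of generic points;
    exchange makes the order immaterial ([indseq_perm]). *)
Fixpoint indseq (P : Type) (cl : set P -> set P) (Y : set P) (s : seq P) : Prop :=
  if s is a :: s' then ~ cl Y a /\ indseq cl (Y `|` [set a]) s' else True.

Lemma lset_cat (T : Type) (s t : seq T) : lset (s ++ t) = lset s `|` lset t.
Proof. by elim: s => [|a s IH] /=; rewrite ?set0U // IH setUA. Qed.

Lemma lset_rcons (T : Type) (s : seq T) a : lset (rcons s a) = lset s `|` [set a].
Proof. by rewrite -cats1 lset_cat /= setU0. Qed.

Lemma lset_map (T U : Type) (f : T -> U) (s : seq T) :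
  lset (map f s) = f @` lset s.
Proof. by elim: s => [|a s IH] /=; rewrite ?image_set0 // IH image_setU image_set1. Qed.

Lemma finite_lset (T : Type) (s : seq T) : finite_set (lset s).
Proof.
elim: s => [|a s IH] /=; first exact: finite_set0.
by rewrite finite_setU; split => //; exact: finite_set1.
Qed.

Lemma finite_lsetP (T : Type) (X : set T) : finite_set X -> exists s, lset s = X.
Proof.
move=> fX; have /finite_seqP[s Xs] : finite_set (X : set {classic T}) := fX.
exists (s : seq T); rewrite Xs; elim: s {Xs} => [|a s IH] /=.
  by apply/seteqP; split => // x.
rewrite IH; apply/seteqP; split=> x /=; rewrite in_cons.
  by case=> [->|xs]; rewrite ?eqxx ?xs ?orbT.
by move=> /orP[/eqP ->|xs]; [left|right].
Qed.

Ltac inl := rewrite ?(lset_cat, lset_rcons, lset_map) /= /setU /set1 /mkset /=;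
  intuition (subst; auto).

Ltac sub := let u := fresh "u" in move=> u; inl.

Lemma lsetP (T : eqType) (s : seq T) x : lset s x <-> x \in s.
Proof.
elim: s => [|a s IH] //=; rewrite in_cons; split.
  by case=> [->|/IH ->]; rewrite ?eqxx ?orbT.
by move=> /orP[/eqP ->|/IH]; [left|right].
Qed.

Lemma card_le_of_inj (T U : Type) (A : set T) (B : set U) (f : T -> U) :
  (forall x, A x -> B (f x)) ->
  (forall x y, A x -> A y -> f x = f y -> x = y) -> A #<= B.
Proof.
move=> fAB finj.
have e : f @` A #= A by apply: inj_card_eq => x y; rewrite !inE; exact: finj.
rewrite -(card_le_eql e); apply: subset_card_le => _ [x Ax <-]; exact: fAB.
Qed.

Lemma inj_of_card_le (T U : Type) (A : set T) (B : set U) : (T -> U) ->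
  A #<= B -> exists f : T -> U,
  (forall x, A x -> B (f x)) /\ (forall x y, A x -> A y -> f x = f y -> x = y).
Proof.
move=> f0 /card_leP[g].
pose f x := if pselect (A x) is left Ax then val (g (SigSub (mem_set Ax))) else f0 x.
exists f; split=> [x Ax|x y Ax Ay]; rewrite /f.
  by case: pselect => // Ax'; have := valP (g (SigSub (mem_set Ax'))); rewrite inE.
case: pselect => // Ax'; case: pselect => // Ay' /val_inj /(@inj _ _ _ g).
by rewrite !inE => /(_ I I) [].
Qed.

Section Pregeometry.
Variables (P : Type) (cl : set P -> set P).
Hypothesis pg : is_pregeometry cl.
Implicit Types (X Y Z : set P) (s t : seq P).

Lemma cl_sub X Y : X `<=` cl Y -> cl X `<=` cl Y.
Proof. by move=> XY a /(cl_mono pg XY); rewrite (cl_idem pg). Qed.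

Lemma cl_sub_ext X Y : Y `<=` cl (X `|` Y).
Proof. by move=> y Yy; apply: (cl_ext pg); right. Qed.

Lemma clU_sub X Y Z : X `<=` cl Z -> Y `<=` cl Z -> cl (X `|` Y) `<=` cl Z.
Proof. by move=> XZ YZ; apply: cl_sub => a []; [exact: XZ|exact: YZ]. Qed.

Lemma cl_finl X a : cl X a -> exists2 s, lset s `<=` X & cl (lset s) a.
Proof.
move=> /(cl_fin pg) [X0 [fX0 X0X cla]].
by have [s sX0] := finite_lsetP fX0; exists s; rewrite sX0.
Qed.

Lemma indseq_cat Y s t :
  indseq cl Y (s ++ t) <-> indseq cl Y s /\ indseq cl (Y `|` lset s) t.
Proof.
elim: s Y => [|a s IH] Y /=; first by rewrite setU0; tauto.
by rewrite IH setUA; tauto.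
Qed.

Lemma indseq_mono Y Z s : Y `<=` cl Z -> indseq cl Z s -> indseq cl Y s.
Proof.
elim: s Y Z => [//|a s IH] Y Z YZ /= [Za Zs]; split.
  by move=> Ya; apply: Za; apply: cl_sub Ya.
apply: IH Zs => u /= [/YZ|->]; last by apply: (cl_ext pg); right.
by apply: (cl_mono pg) => x; left.
Qed.

Lemma indseq_sub Y Z s : Y `<=` Z -> indseq cl Z s -> indseq cl Y s.
Proof. by move=> YZ; apply: indseq_mono => x /YZ; exact: (cl_ext pg). Qed.

Lemma indseq_dep Y s : ~ indseq cl Y s -> exists s1 a s2,
  [/\ s = s1 ++ a :: s2, indseq cl Y s1 & cl (Y `|` lset s1) a].
Proof.
elim: s Y => [|a s IH] Y; first by case.
have [Ya _|Ya] := pselect (cl Y a); first by exists [::], a, s; rewrite setU0.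
rewrite /= => ns; have {}/IH : ~ indseq cl (Y `|` [set a]) s by tauto.
by move=> [s1 [b [s2 [-> i1 c]]]]; exists (a :: s1), b, s2; rewrite /= setUA.
Qed.

(** If adding [b] to the base spoils [s], let [a] be the first dependent entry: exchange puts [b] in
    the closure of [Y], [s1] and [a], so dropping [a] alone restores independence. *)
Lemma steinitz Y s t : indseq cl Y s -> lset s `<=` cl (Y `|` lset t) ->
  (size s <= size t)%N.
Proof.
elim: t Y s => [|b t IH] Y s.
  by case: s => [//|a s] /= [Ya _] h; case: Ya; rewrite -[Y]setU0; apply: h; left.
rewrite /= setUA => si st.
have [si'|/indseq_dep [s1 [a [s2 [es s1i ca]]]]] := pselect (indseq cl (Y `|` [set b]) s).
  by apply: leq_trans (IH _ _ si' st) _.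
have := si; rewrite es indseq_cat /= => -[_ [na s2i]].
have cb : cl (Y `|` lset s1 `|` [set a]) b.
  apply: (cl_exch pg) na; apply: (cl_mono pg) ca; sub.
suff i12 : indseq cl (Y `|` [set b]) (s1 ++ s2).
  have h := IH _ _ i12; rewrite !size_cat /= addnS ltnS -size_cat; apply: h.
  by apply: subset_trans st; rewrite es; sub.
rewrite indseq_cat; split => //; apply: indseq_mono s2i => u.
rewrite /setU /mkset => -[[Yu|->//]|s1u]; apply: (cl_ext pg); left; [left|right]; done.
Qed.

Lemma indseq_extract Y t : exists t', [/\ indseq cl Y t', lset t' `<=` lset t,
  lset t `<=` cl (Y `|` lset t'), (size t' <= size t)%N &
  ~ indseq cl Y t -> (size t' < size t)%N].
Proof.
elim: t Y => [|a t IH] Y; first by exists [::]; split => //; case.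
have [Ya|Ya] := pselect (cl Y a).
  have [t' [i1 s1 s2 l1 _]] := IH Y; exists t'; split => //=.
  - by move=> x /s1; right.
  - by move=> x [->|/s2 //]; apply: (cl_mono pg) Ya => y; left.
  - exact: leqW.
have [t' [i1 s1 s2 l1 l2]] := IH (Y `|` [set a]); exists (a :: t'); split => //=.
- by move=> x [->|/s1]; [left|right].
- rewrite setUA => x [->|/s2 //]; apply: (cl_ext pg); left; by right.
- move=> h; rewrite ltnS; apply: l2 => h'; exact: h.
Qed.

(** Were [t] dependent, a strictly shorter list would still span it, hence [s], against
    [steinitz]. *)
Lemma indseq_span Y s t : indseq cl Y s -> lset s `<=` cl (Y `|` lset t) ->
  (size t <= size s)%N -> indseq cl Y t.
Proof.
move=> si st le; apply: contrapT => nt.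
have [t' [i1 s1 s2 _ /(_ nt) lt]] := indseq_extract Y t.
have := @steinitz Y s t' si; rewrite leqNgt (leq_trans lt le) => h.
suff: false by []. apply: h => x /st; apply: clU_sub => //.
by move=> y Yy; apply: (cl_ext pg); left.
Qed.

Lemma indseq_perm Y s t : lset s `<=` lset t -> size s = size t ->
  indseq cl Y s -> indseq cl Y t.
Proof.
move=> st e si; apply: (indseq_span si); last by rewrite e.
by move=> x /st xt; apply: (cl_ext pg); right.
Qed.

Lemma indseq_swap Y s t : indseq cl Y (s ++ t) -> indseq cl Y (t ++ s).
Proof. by apply: indseq_perm; [sub|rewrite !size_cat addnC]. Qed.

Lemma indseq_rcons Y s a : indseq cl Y (rcons s a) <->
  indseq cl Y s /\ ~ cl (Y `|` lset s) a.
Proof. by rewrite -cats1 indseq_cat /=; tauto. Qed.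

Lemma indseq_notin Y s a : indseq cl (Y `|` [set a]) s -> ~ lset s a.
Proof.
elim: s Y => [_ _ []|b s IH Y] /= [h1 h2] [e|].
  by apply: h1; rewrite e; apply: (cl_ext pg); right.
by apply: (IH (Y `|` [set b])); apply: indseq_sub h2; sub.
Qed.

Lemma indseq_mem Y s : indseq cl Y s -> forall x, lset s x -> ~ cl Y x.
Proof.
elim: s Y => [//|a s IH] Y /= [na si] x [->//|sx] Yx.
by apply: (IH _ si x sx); apply: (cl_mono pg) Yx; sub.
Qed.

Lemma indseq_uniq Y s : indseq cl Y s -> uniq (s : seq {classic P}).
Proof.
elim: s Y => [//|a s IH] Y /= [h1 h2]; rewrite (IH _ h2) andbT.
by apply/negP => /lsetP; exact: indseq_notin h2.
Qed.

Lemma indep_over_indseq Y B s : indep_over cl Y B -> lset s `<=` B ->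
  uniq (s : seq {classic P}) -> indseq cl Y s.
Proof.
move=> iB sB us; suff h : forall t u, s = t ++ u -> indseq cl Y t.
  by apply: (h s [::]); rewrite cats0.
apply: last_ind => [//|t a IH] u es; rewrite indseq_rcons; split.
  by apply: (IH (a :: u)); rewrite es cat_rcons.
have Ba : B a by apply: sB; rewrite es cat_rcons lset_cat; right; left.
move=> ca; apply: (iB a Ba); apply: (cl_mono pg) ca => x [Yx|tx]; [by left|right].
split; first by apply: sB; rewrite es cat_rcons lset_cat; left.
move=> /= e; move: us; rewrite es cat_rcons cat_uniq /= => /and3P[_ + _].
by rewrite negb_or => /andP[+ _] => /negP; apply; apply/lsetP; rewrite -e.
Qed.

Lemma indseq_indep_over Y s : indseq cl Y s -> indep_over cl Y (lset s).
Proof.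
move=> si b.
have splitb : forall t, lset t b -> exists t1 t2, t = t1 ++ b :: t2.
  elim=> [//|a t IH] /= [->|/IH [t1 [t2 ->]]]; first by exists [::], t.
  by exists (a :: t1), t2.
move=> /splitb [t1 [t2 es]] cb.
have : indseq cl Y ((t1 ++ t2) ++ [:: b]).
  apply: indseq_perm si; first by rewrite es; sub.
  by rewrite es !size_cat /= addn1 addnS.
rewrite cats1 indseq_rcons => -[_]; apply; apply: (cl_mono pg) cb.
rewrite es => x [Yx|[+ nxb]]; first by left.
by rewrite !lset_cat /= => -[?|[//|?]]; right; [left|right].
Qed.

Lemma lset_card s : uniq (s : seq {classic P}) -> lset s #= `I_(size s).
Proof.
elim: s => [_|a s IH] /=; first by rewrite II0 card_eq00.
move=> /andP[/negP nas us]; have := IH us.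
move=> h; apply/eq_cardSP; exists a; first by left.
suff -> : ([set a] `|` lset s) `\ a = lset s by [].
apply/seteqP; split=> x; first by case=> -[].
move=> sx; split; first by right.
by move=> /= e; apply: nas; apply/lsetP; rewrite -e.
Qed.

Lemma card_lset (X : set P) k : X #= `I_k ->
  exists s, [/\ lset s = X, uniq (s : seq {classic P}) & size s = k].
Proof.
move=> XI; have fX : finite_set X by apply/finite_setP; exists k.
have [s sX] := finite_lsetP fX.
exists (undup (s : seq {classic P})).
have e : lset (undup (s : seq {classic P})) = X.
  rewrite -sX; apply/seteqP; split=> x.
    by move=> /lsetP; rewrite mem_undup => /lsetP.
  by move=> /lsetP h; apply/lsetP; rewrite mem_undup.
have u := undup_uniq (s : seq {classic P}); split=> //.
have := lset_card u; rewrite e => h; apply/card_eq_II.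
by rewrite card_eq_sym in h; exact: card_eq_trans h XI.
Qed.

Lemma indep_overP Y B k : indep_over cl Y B -> B #= `I_k ->
  exists s, [/\ lset s = B, indseq cl Y s & size s = k].
Proof.
move=> iB /card_lset [s [e u sz]]; exists s; split=> //.
by apply: (@indep_over_indseq Y B) => //; rewrite e.
Qed.

Lemma dim_over_seq Y X s : indseq cl Y s -> lset s `<=` X ->
  X `<=` cl (Y `|` lset s) -> dim_over cl Y X (size s).
Proof.
move=> si sX Xs; exists (lset s); last exact: lset_card (indseq_uniq si).
by split=> //; exact: indseq_indep_over.
Qed.

Lemma dim_over_lset Y s : indseq cl Y s -> dim_over cl Y (lset s) (size s).
Proof. by move=> si; apply: dim_over_seq => //; exact: cl_sub_ext. Qed.

Lemma dim_lset_indseq Y s : dim_over cl Y (lset s) (size s) -> indseq cl Y s.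
Proof.
move=> [B [BX iB XB] cB]; have [t [e ti sz]] := indep_overP iB cB.
apply: (@indseq_span Y t) => //; last by rewrite sz.
by rewrite e => x /BX sx; apply: (cl_ext pg); right.
Qed.

Lemma indep_over_of_indseq Y B :
  (forall s, lset s `<=` B -> uniq (s : seq {classic P}) -> indseq cl Y s) ->
  indep_over cl Y B.
Proof.
move=> h b Bb /cl_finl [s sYB cb].
have [t [ts tB ut]] : exists t, [/\ lset s `<=` Y `|` lset t,
    lset t `<=` B `\ b & uniq (t : seq {classic P})].
  elim: s sYB {cb} => [|a s IH] /= sYB; first by exists [::]; split=> // x [].
  have [|t [ts tB ut]] := IH; first by move=> x sx; apply: sYB; right.
  have [at_|nat_] := pselect (lset t a).
    by exists t; split=> // x [->|/ts //]; right.
  have [Ya|[Ba ab]] := sYB a (or_introl erefl).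
    by exists t; split=> // x [->|/ts //]; left.
  exists (a :: t); split=> [x|x|] /=.
  - by case=> [->|/ts[]]; [right; left|left|right; right].
  - by case=> [->|/tB].
  - by rewrite ut andbT; apply/negP => /(@lsetP {classic P}).
have : indseq cl Y (rcons t b).
  apply: h; first by rewrite lset_rcons => x [/tB[]|->].
  rewrite rcons_uniq ut andbT; apply/negP => /(@lsetP {classic P}) /tB [_].
  exact.
by move=> /indseq_rcons[_]; apply; apply: (cl_mono pg) cb.
Qed.

Lemma indseq_subset Y s t : indseq cl Y t -> lset s `<=` lset t ->
  uniq (s : seq {classic P}) -> indseq cl Y s.
Proof. by move=> /indseq_indep_over; exact: indep_over_indseq. Qed.

(** [W] lies in the closure of a finite part [F] of [B]. Keeping [B] outside [F] and extracting from
    [F] what is independent over the rest changes [B] only finitely, hence not its infinite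
    cardinality. *)
Lemma basis_over_lset B W : basis_over cl set0 [set: P] B ->
  exists B' F, [/\ B' `<=` B, B `<=` B' `|` lset F & basis_over cl (lset W) [set: P] B'].
Proof.
move=> [_ iB spB].
have [F FB WF] : exists2 F, lset F `<=` B & lset W `<=` cl (lset F).
  elim: W => [|a W [F FB WF]] /=; first by exists [::] => // x [].
  have [|s sB sa] := @cl_finl B a; first by have := spB a I; rewrite set0U.
  exists (s ++ F); first by rewrite lset_cat => x [/sB|/FB].
  move=> x [->|/WF]; first by apply: (cl_mono pg) sa; sub.
  by apply: (cl_mono pg); sub.
pose Y := lset W `|` (B `\` lset F).
have [F' [F'i F'F FF' _ _]] := indseq_extract Y F.
exists ((B `\` lset F) `|` lset F'), F; split.
- by move=> x [[]//|/F'F/FB].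
- by move=> x Bx; have [?|?] := pselect (lset F x); [right|left; left].
split=> //; last first.
  move=> x _; have := spB x I; rewrite set0U; apply: cl_sub => b Bb.
  have [Fb|nFb] := pselect (lset F b).
    by apply: (cl_mono pg) (FF' _ Fb) => z; rewrite /Y /setU /mkset; tauto.
  by apply: (cl_ext pg); right; left.
apply: indep_over_of_indseq => s sB us.
pose t := filter (fun x => `[< ~ lset F x >]) s.
have tP x : lset t x -> lset s x /\ ~ lset F x.
  by move=> /(@lsetP {classic P}); rewrite mem_filter => /andP[/asboolP ? /lsetP].
have ut : uniq (t : seq {classic P}) by exact: filter_uniq.
apply: (@indseq_subset _ _ (t ++ F')) => //; last first.
  move=> x sx; rewrite lset_cat; have [[_ nF]|] := sB _ sx; last by right.
  by left; apply/(@lsetP {classic P}); rewrite mem_filter; apply/andP; split;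
    [exact/asboolP|exact/lsetP].
have tB x : lset t x -> B x /\ ~ lset F x.
  by move=> /tP[/sB[[]|/F'F]].
have tF : indseq cl (lset F) t.
  have [F0 [F0i F0F FF0 _ _]] := indseq_extract set0 F.
  have : indseq cl set0 (F0 ++ t).
    apply: (indep_over_indseq iB).
      by rewrite lset_cat => x [/F0F/FB|/tB[]].
    rewrite cat_uniq ut (indseq_uniq F0i) andbT /=.
    apply/hasPn => x /(@lsetP {classic P}) /tB[_ nF]; apply/negP.
    by move=> /(@lsetP {classic P}) /F0F.
  by move=> /indseq_cat[_]; apply: indseq_mono.
apply/indseq_cat; split; first exact: indseq_mono tF.
apply: indseq_sub F'i => x [Wx|/tB ?]; by [left|right].
Qed.

Definition inf_dim := forall s : seq P, exists a, ~ cl (lset s) a.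

Lemma infinite_dimensional_inf_dim : infinite_dimensional cl -> inf_dim.
Proof.
move=> [B [_ iB _] infB] s.
have [h|/existsNP[a h]] := pselect (forall a, cl (lset s) a); last by exists a.
exfalso.
have [f finj] : exists f : nat -> P, injective f /\ forall n, B (f n).
  have [b _] := infinite_setN0 infB.
  have [|f [fB fi]] := @inj_of_card_le nat P setT B (fun=> b); first exact/infiniteP.
  by exists f; split=> [m n e|n]; [exact: fi|exact: fB].
pose t := map f (iota 0 (size s).+1).
have ti : indseq cl set0 t.
  apply: (indep_over_indseq iB).
    by rewrite /t lset_map => x [n _ <-]; exact: finj.2.
  by rewrite (@map_inj_uniq _ {classic P}) ?iota_uniq //; exact: finj.1.
have := @steinitz set0 t s ti; rewrite size_map size_iota ltnn => h'.
by suff: false by []; apply: h' => x _; rewrite set0U.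
Qed.

Lemma inf_dimP : inf_dim -> forall Y k, finite_set Y ->
  exists2 s, indseq cl Y s & size s = k.
Proof.
move=> inf Y k /finite_lsetP [y <-]; elim: k => [|k [s si sz]]; first by exists [::].
have [a na] := inf (y ++ s); exists (rcons s a); last by rewrite size_rcons sz.
by rewrite indseq_rcons -lset_cat.
Qed.

End Pregeometry.

Lemma preserves_cl_indseq (P : Type) (cl : set P -> set P) (f : P -> P) Y s :
  preserves_cl cl f -> indseq cl (f @` Y) (map f s) <-> indseq cl Y s.
Proof.
move=> fcl; elim: s Y => [//|a s IH] Y /=.
by rewrite -image_set1 -image_setU IH (fcl Y a).
Qed.

(** * Pregeometries pulled back along a map *)

Section Pullback.
Variables (P M : Type) (cl : set P -> set P) (Z : set P) (f : M -> P).
Hypothesis pg : is_pregeometry cl.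

(** Localization at [Z], then restriction along [f]. It is used with [f] the inclusion of a
    localized carrier, the evaluation of group elements at a point, and the parametrization of
    points by a field. *)
Definition pullback_cl (X : set M) : set M := [set g | cl (Z `|` f @` X) (f g)].

Lemma pullback_pregeometry : is_pregeometry pullback_cl.
Proof.
have mono X Y : X `<=` Y -> pullback_cl X `<=` pullback_cl Y.
  move=> XY g; apply: (cl_mono pg) => x [Zx|[y Xy <-]]; [by left|right].
  by exists y => //; exact: XY.
have ext X : X `<=` pullback_cl X.
  by move=> g Xg; apply: (cl_ext pg); right; exists g.
split=> //.
- move=> X; apply/seteqP; split; last exact: ext.
  move=> g; apply: (clU_sub pg); last by move=> x [y h <-].
  by move=> x Zx; apply: (cl_ext pg); left.
- move=> X g /(cl_finl pg) [s sX gs].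
  have [t tX st] : exists2 t : seq M, lset t `<=` X & lset s `<=` Z `|` f @` lset t.
    elim: s sX {gs} => [|a s IH] /= sX; first by exists [::].
    have [|t tX st] := IH; first by move=> x sx; apply: sX; right.
    have [Za|[y Xy ya]] := sX a (or_introl erefl).
      by exists t => // x [->|/st //]; left.
    exists (y :: t) => x /=; first by case=> [->|/tX].
    case=> [->|/st [Zx|[z tz <-]]]; [|by left|]; right.
      by exists y => //; left.
    by exists z => //; right.
  by exists (lset t); split => //; [exact: finite_lset|apply: (cl_mono pg) gs].
- move=> X a b; rewrite /pullback_cl /= !image_setU !image_set1 !setUA.
  exact: (cl_exch pg).
Qed.

Lemma pullback_indseq X s :
  indseq pullback_cl X s <-> indseq cl (Z `|` f @` X) (map f s).
Proof.
elim: s X => [//|a s IH] X /=.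
by rewrite IH image_setU image_set1 setUA.
Qed.

End Pullback.

(** * Infinite cardinals are idempotent *)

Section ChainUnion.
Variables (T : Type) (good : set T -> Prop) (G0 : set T).
Hypothesis good0 : good G0.
Hypothesis good_chain : forall U : set T,
  (forall a b, U a -> U b -> exists X, [/\ good X, X `<=` U, X a & X b]) -> good U.

(* Zorn's lemma for a property decided by pairs of elements of the set. *)
Lemma maximal_above : exists X, [/\ good X, G0 `<=` X &
  forall Y, X `<=` Y -> good Y -> Y `<=` X].
Proof.
(* Adding [G0] to every member takes care of the empty chain, whose union then yields [G0]. *)
have [|A [gA maxA]] := @Zorn_bigcup T (fun F => good (F `|` G0)).
  move=> F FP Ftot; apply: good_chain => a b.
  have big X : F X -> X `|` G0 `<=` \bigcup_(X in F) X `|` G0.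
    by move=> FX x [Xx|]; [left; exists X|right].
  move=> [[X FX Xa]|Ga] [[Y FY Yb]|Gb].
  - have [XY|YX] := Ftot _ _ FX FY.
      exists (Y `|` G0); split; [exact: FP|exact: big| |by left].
      by left; exact: XY.
    exists (X `|` G0); split; [exact: FP|exact: big|by left|].
    by left; exact: YX.
  - by exists (X `|` G0); split; [exact: FP|exact: big|left|right].
  - by exists (Y `|` G0); split; [exact: FP|exact: big|right|left].
  - by exists G0; split=> // x Gx; right.
exists (A `|` G0); split=> [|x Gx|Y AY gY]; [exact: gA|by right|].
apply: contrapT => nYA; apply: (maxA (Y `|` A)).
  split; first by move=> x Ax; right.
  by move=> h; apply: nYA => y Yy; left; apply: h; left.
suff -> : Y `|` A `|` G0 = Y by [].
apply/seteqP; split=> x; last by move=> Yx; left; left.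
by case=> [[//|Ax]|Gx]; apply: AY; [left|right].
Qed.
End ChainUnion.

Lemma card_le_total (T U : Type) (A : set T) (B : set U) : A #<= B \/ B #<= A.
Proof.
have [A0|/existsNP[a0 /contrapT Aa0]] := pselect (forall x, ~ A x).
  left; have -> : A = set0 by apply/seteqP; split=> // x /A0.
  exact: card_ge0.
have [B0|/existsNP[b0 /contrapT Bb0]] := pselect (forall x, ~ B x).
  right; have -> : B = set0 by apply/seteqP; split=> // x /B0.
  exact: card_ge0.
(* Graphs of partial injections; a maximal one is total or onto, since otherwise a pair could be
   added. *)
pose good (X : set (T * U)) := [/\ forall p, X p -> A p.1 /\ B p.2,
  forall p q, X p -> X q -> p.1 = q.1 -> p = q &
  forall p q, X p -> X q -> p.2 = q.2 -> p = q].
have [|U0 h|X [[XAB Xf Xi] _ Xmax]] := @maximal_above _ good set0.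
- by split.
- split=> [p Up|p q Up Uq|p q Up Uq].
  + by have [X [[XAB _ _] _ Xp _]] := h _ _ Up Up; exact: XAB.
  + by have [X [[_ Xf _] _ Xp Xq]] := h _ _ Up Uq; exact: Xf.
  + by have [X [[_ _ Xi] _ Xp Xq]] := h _ _ Up Uq; exact: Xi.
have [dA|/existsNP[a /not_implyP[Aa na]]] :=
  pselect (forall a, A a -> exists b, X (a, b)).
  left; have /choice[f fP] : forall a, exists b, A a -> X (a, b).
    by move=> a; have [/dA[b]|] := pselect (A a); [exists b|exists b0].
  apply: (@card_le_of_inj _ _ _ _ f) => [x /fP /XAB []//|x y Ax Ay e].
  by have [] := Xi _ _ (fP _ Ax) (fP _ Ay) e.
have [dB|/existsNP[b /not_implyP[Bb nb]]] :=
  pselect (forall b, B b -> exists a, X (a, b)).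
  right; have /choice[f fP] : forall b, exists a, B b -> X (a, b).
    by move=> b; have [/dB[a']|] := pselect (B b); [exists a'|exists a0].
  apply: (@card_le_of_inj _ _ _ _ f) => [x /fP /XAB []//|x y Ax Ay e].
  by have [] := Xf _ _ (fP _ Ax) (fP _ Ay) e.
have h := Xmax (X `|` [set (a, b)]) (fun p Xp => or_introl Xp).
exfalso; apply: (na); exists b; apply: h; last by right.
split=> [p [/XAB//|->//]|p q [Xp|->] [Xq|->] //=|p q [Xp|->] [Xq|->] //=].
- exact: Xf.
- by move=> e; exfalso; apply: na; exists p.2; rewrite -e -surjective_pairing.
- by move=> e; exfalso; apply: na; exists q.2; rewrite e -surjective_pairing.
- exact: Xi.
- by move=> e; exfalso; apply: nb; exists p.1; rewrite -e -surjective_pairing.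
- by move=> e; exfalso; apply: nb; exists q.1; rewrite e -surjective_pairing.
Qed.

(** Take a maximal injective pairing on a subset [D], above one on a copy of the natural numbers. If
    the complement of [D] embeds in [D], so does [P], and the pairing on [D] serves [P]. Otherwise
    the complement contains a copy of [D], to which the new pairs of an extension can be sent,
    against maximality. *)
Lemma card_prod_infinite (P : Type) : infinite_set [set: P] ->
  [set: P * P] #<= [set: P].
Proof.
move=> infP; have [p0 _] := infinite_setN0 infP.
have [|i [_ iinj]] := @inj_of_card_le nat P setT setT (fun=> p0).
  exact/infiniteP.
have {}iinj m n : i m = i n -> m = n by exact: iinj.
have [|c [_ cinj]] := @inj_of_card_le (nat * nat) nat setT setT (fun=> 0).
  by rewrite (card_le_eql card_nat2) card_lexx.
have {}cinj m n : c m = c n -> m = n by exact: cinj.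
(* The domain of a pairing given by triples is read off its diagonal. *)
pose Dm (X : set (P * P * P)) p := exists r, X (p, p, r).
pose good (X : set (P * P * P)) := [/\
  forall a r, X (a, r) -> [/\ Dm X a.1, Dm X a.2 & Dm X r],
  forall p q, Dm X p -> Dm X q -> exists r, X (p, q, r),
  forall a r r', X (a, r) -> X (a, r') -> r = r' &
  forall a a' r, X (a, r) -> X (a', r) -> a = a'].
pose G0 := range (fun mn : nat * nat => (i mn.1, i mn.2, i (c mn))).
have DG0 m : Dm G0 (i m) by exists (i (c (m, m))); exists (m, m).
have DG0P p : Dm G0 p -> exists m, i m = p.
  by move=> [r [[m n] _ [<- _ _]]]; exists m.
have [||X [[X1 X2 X3 X4] G0X Xmax]] := @maximal_above _ good G0.
- split.
  + by move=> a r [[m n] _ [<- <-]]; split; exact: DG0.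
  + move=> p q /DG0P[m <-] /DG0P[n <-]; exists (i (c (m, n))).
    by exists (m, n).
  + by move=> a r r' [[m n] _ [<- <-]] [[m' n'] _ [/iinj -> /iinj -> <-]].
  + by move=> a a' r [mn _ [<- <-]] [mn' _ [<- /iinj/cinj ->]].
- move=> U h.
  have DmU X : X `<=` U -> forall p, Dm X p -> Dm U p.
    by move=> XU p [r /XU]; exists r.
  split.
  + move=> a r Ua; have [X [[X1 _ _ _] /DmU XU Xa _]] := h _ _ Ua Ua.
    by have [? ? ?] := X1 _ _ Xa; split; exact: XU.
  + move=> p q [r Up] [r' Uq]; have [X [[_ X2 _ _] XU Xp Xq]] := h _ _ Up Uq.
    by have [||s /XU] := X2 p q; [exists r|exists r'|exists s].
  + move=> a r r' Ua Ua'; have [X [[_ _ X3 _] _ Xa Xa']] := h _ _ Ua Ua'.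
    exact: X3 Xa Xa'.
  + move=> a a' r Ua Ua'; have [X [[_ _ _ X4] _ Xa Xa']] := h _ _ Ua Ua'.
    exact: X4 Xa Xa'.
pose D : set P := Dm X.
have DI m : D (i m) by have [r /G0X] := DG0 m; exists r.
have [f fD finj] : exists2 f : P * P -> P,
    forall p q, D p -> D q -> D (f (p, q)) /\ X (p, q, f (p, q)) &
    forall p q p' q', D p -> D q -> D p' -> D q' ->
      f (p, q) = f (p', q') -> p = p' /\ q = q'.
  have /choice[f fP] : forall a : P * P, exists r, D a.1 -> D a.2 -> X (a, r).
    move=> [p q]; have [Dp|] := pselect (D p); last by exists p.
    by have [Dq|] := pselect (D q); [have [r] := X2 _ _ Dp Dq; exists r|exists p].
  exists f => [p q Dp Dq|p q p' q' Dp Dq Dp' Dq' e].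
    by split; [have [] := X1 _ _ (fP (p, q) Dp Dq)|exact: (fP (p, q))].
  have := fP (p, q) Dp Dq; rewrite /= e => /X4 /(_ (fP (p', q') Dp' Dq')).
  by case.
have [ED|DE] := card_le_total (~` D) D.
  have [g [gD ginj]] := inj_of_card_le id ED.
  pose h p := if pselect (D p) then f (p, i 0) else f (g p, i 1%N).
  have hD p : D (h p).
    by rewrite /h; case: pselect => Dp; apply: (fD _ _ _ _).1 => //; exact: gD.
  have hinj p q : h p = h q -> p = q.
    rewrite /h; case: pselect => Dp; case: pselect => Dq /finj [] //;
      try (exact: gD); try by move=> _ /iinj.
    by move=> /ginj ->.
  apply: (@card_le_of_inj _ _ _ _ (fun a => f (h a.1, h a.2))) => //.
by move=> [p q] [p' q'] _ _ /finj [] //= /hinj -> /hinj ->.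
have [g [gE ginj]] := inj_of_card_le id DE.
have {}ginj p q : D p -> D q -> g p = g q -> p = q by exact: ginj.
pose D' : set P := g @` D.
have D'D p : D' p -> D p -> False by move=> [q Dq <-]; exact: gE.
have [pi piD piinj] : exists2 pi : P -> P,
    forall p, D p \/ D' p -> D (pi p) &
    (forall p q, D p -> D q -> pi p = pi q -> p = q) /\
    (forall p q, D' p -> D' q -> pi p = pi q -> p = q).
  have /choice[k kP] : forall p, exists q, D' p -> D q /\ g q = p.
    by move=> p; have [[q Dq e]|] := pselect (D' p); [exists q|exists p].
  exists (fun p => if pselect (D p) then p else k p) => [p|].
    by case: pselect => // nDp [//|/kP[]].
  split=> p q Dp Dq.
    by case: pselect => // h1; case: pselect => // h2.
  case: pselect => h1; first by case: (D'D _ Dp h1).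
  case: pselect => h2 /= e; first by case: (D'D _ Dq h2).
  by have [_ <-] := kP _ Dp; have [_ <-] := kP _ Dq; rewrite e.
(* As [pi] folds [D] and its copy onto [D], the tag records the sides of the two coordinates. Both
   in [D] is excluded for new pairs, so three values suffice. *)
pose tag (p q : P) : P := if pselect (D p) then i 0 else
  if pselect (D q) then i 1%N else i 2.
have tagD p q : D (tag p q) by rewrite /tag; do 2?case: pselect => ?; exact: DI.
pose F (p q : P) := g (f (f (pi p, pi q), tag p q)).
pose D2 p := D p \/ D' p.
have FD p q : D2 p -> D2 q -> D' (F p q).
  move=> Dp Dq; exists (f (f (pi p, pi q), tag p q)) => //.
  apply: (fD _ _ _ _).1 => //; apply: (fD _ _ _ _).1; exact: piD.
have FI p q p' q' : D2 p -> D2 q -> D2 p' -> D2 q' ->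
    ~ (D p /\ D q) -> ~ (D p' /\ D q') -> F p q = F p' q' -> (p, q) = (p', q').
  move=> Dp Dq Dp' Dq' n1 n2.
  have Df u v : D2 u -> D2 v -> D (f (pi u, pi v)).
    by move=> Du Dv; apply: (fD _ _ _ _).1; exact: piD.
  move=> /ginj e; have {e} : f (f (pi p, pi q), tag p q) = f (f (pi p', pi q'), tag p' q').
    by apply: e; apply: (fD _ _ _ _).1 => //; exact: Df.
  move=> /finj [] //; try exact: Df.
  move=> /finj [] //; try exact: piD.
  move=> e1 e1' e2.
  have i01 : i 0 <> i 1%N by move/iinj.
  have i02 : i 0 <> i 2 by move/iinj.
  have i12 : i 1%N <> i 2 by move/iinj.
  have piE u v : pi u = pi v -> (D u /\ D v) \/ (D' u /\ D' v) -> u = v.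
    by move=> e [[? ?]|[? ?]]; [apply: piinj.1|apply: piinj.2].
  have DD' u : D2 u -> ~ D u -> D' u by case.
  have [ep eq] : (D p <-> D p') /\ (D q <-> D q').
    move: e2; rewrite /tag; case: (pselect (D p)); case: (pselect (D q));
      case: (pselect (D p')); case: (pselect (D q')) => /= ? ? ? ? e2;
      by [split; split|case: i01|case: i02|case: i12|tauto].
  have both u v : (D u <-> D v) -> D2 u -> D2 v -> D u /\ D v \/ D' u /\ D' v.
    move=> uv Du Dv; have [h|h] := pselect (D u).
      by left; split=> //; exact/uv.
    by right; split; apply: DD' => // /uv.
  by rewrite (piE _ _ e1 (both _ _ ep Dp Dp')) (piE _ _ e1' (both _ _ eq Dq Dq')).
pose Y := X `|` [set a | exists p q, [/\ D2 p, D2 q, ~ (D p /\ D q) &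
  a = (p, q, F p q)]].
have DY p : Dm Y p <-> D2 p.
  split; first by move=> [r [Xr|[p' [q [? ? _ [-> _ _]]]]]]; [left; exists r|].
  move=> D2p; have [[r Xr]|nDp] := pselect (D p); first by exists r; left.
  by exists (F p p); right; exists p, p; split=> //; case.
have YX := Xmax Y (fun _ h => or_introl h).
have goodY : good Y.
  split.
  - move=> a r [/X1 [? ? ?]|[p [q [? ? ? [-> ->]]]]]; split; apply/DY => //; try by left.
    by right; exact: FD.
  - move=> p q /DY D2p /DY D2q; have [[Dp Dq]|n] := pselect (D p /\ D q).
      by have [r Xr] := X2 _ _ Dp Dq; exists r; left.
    by exists (F p q); right; exists p, q.
  - move=> a r r' [Xa|[p [q [? ? n [ea ->]]]]] [Xa'|[p' [q' [? ? n' [ea' ->]]]]].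
    + exact: X3 Xa Xa'.
    + by have [] := X1 _ _ Xa; rewrite ea' /=; tauto.
    + by have [] := X1 _ _ Xa'; rewrite ea /=; tauto.
    + by move: ea'; rewrite ea => -[-> ->].
  - move=> a a' r [Xa|[p [q [? ? n [ea er]]]]] [Xa'|[p' [q' [? ? n' [ea' er']]]]].
    + exact: X4 Xa Xa'.
    + have [_ _ Dr] := X1 _ _ Xa; exfalso; apply: (D'D _ _ Dr).
      by rewrite er'; exact: FD.
    + have [_ _ Dr] := X1 _ _ Xa'; exfalso; apply: (D'D _ _ Dr).
      by rewrite er; exact: FD.
    + by rewrite ea ea'; apply: FI => //; rewrite -er -er'.
exfalso; have {}YX := YX goodY.
have gi : D' (g (i 0)) by exists (i 0).
have : Dm Y (g (i 0)) by apply/DY; right.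
by move=> [r /YX Xr]; apply: (D'D _ gi); exists r.
Qed.

(** The points of [F] are placed at the start of a sequence in [B'], whose terms are shifted by
    [size F]. *)
Lemma card_le_cofinite (T : Type) (B B' : set T) (F : seq T) :
  infinite_set B' -> B `<=` B' `|` lset F -> B #<= B'.
Proof.
move=> infB' BF; have [b0 _] := infinite_setN0 infB'.
have [|i [iB iinj]] := @inj_of_card_le nat T setT B' (fun=> b0).
  exact/infiniteP.
have {}iinj m n : i m = i n -> m = n by exact: iinj.
have {}iB m : B' (i m) by exact: iB.
pose idx (x : T) := index (x : {classic T}) (F : seq {classic T}).
have idx_inj x y : lset F x -> idx x = idx y -> x = y.
  move=> /(@lsetP {classic T}) Fx e.
  have Fy : (y : {classic T}) \in (F : seq {classic T}).
    by rewrite -index_mem -/(idx y) -e index_mem.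
  by rewrite -(@nth_index {classic T} b0 _ _ Fx) -/(idx x) e (@nth_index {classic T} b0 _ _ Fy).
have idx_lt x : lset F x -> (idx x < size F)%N.
  by move=> /(@lsetP {classic T}); rewrite -index_mem.
have /choice[j jP] : forall x, exists m, (exists m, i m = x) -> i m = x.
  move=> x; have [[m e]|nm] := pselect (exists m, i m = x).
    by exists m => _.
  by exists 0 => /nm.
have ji m : j (i m) = m by apply: iinj; apply: jP; exists m.
pose h x := if pselect (lset F x) then i (idx x) else
  if pselect (exists m, i m = x) then i (size F + j x)%N else x.
apply: (@card_le_of_inj _ _ _ _ h).
  move=> x /BF Bx; rewrite /h; case: pselect => Fx; first exact: iB.
  case: (pselect (exists m, i m = x)) => ix; [exact: iB|by case: Bx].
move=> x y _ _; rewrite /h.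
case: (pselect (lset F x)) => Fx; case: (pselect (lset F y)) => Fy.
- by move=> /iinj; exact: idx_inj.
- case: (pselect (exists m, i m = y)) => ey.
    by move=> /iinj e; have := idx_lt _ Fx; rewrite e ltnNge leq_addr.
  by move=> /= e; case: ey; exists (idx x).
- case: (pselect (exists m, i m = x)) => ex.
    by move=> /iinj e; have := idx_lt _ Fy; rewrite -e ltnNge leq_addr.
  by move=> /= e; case: ex; exists (idx y).
case: (pselect (exists m, i m = x)) => ex; case: (pselect (exists m, i m = y)) => ey //=.
- by move=> /iinj /addnI e; rewrite -(jP _ ex) -(jP _ ey) e.
- by move=> e; case: ey; exists (size F + j x)%N.
- by move=> e; case: ex; exists (size F + j y)%N.
Qed.

(** * Homogeneity and rank *)

Lemma range_nth (T : Type) (x0 : T) (s : seq T) k : size s = k ->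
  range (fun i : 'I_k => nth x0 s i) = lset s.
Proof.
move=> <-; apply/seteqP; split=> [x [i _ <-]|x].
  have := @mem_nth {classic T} x0 s i (ltn_ord i).
  by move/lsetP.
move=> /(@lsetP {classic T}) sx; have lt := sx; rewrite -index_mem in lt.
by exists (Ordinal lt) => //=; apply: (@nth_index {classic T}).
Qed.

Lemma lset_enum (T : Type) k (x : 'I_k -> T) : lset (map x (enum 'I_k)) = range x.
Proof.
rewrite lset_map; apply/seteqP; split=> [_ [i _ <-]|_ [i _ <-]]; first by exists i.
by exists i => //; apply/lsetP; rewrite mem_enum.
Qed.

Lemma cat_inj (T : Type) (p q r r' : seq T) : size p = size q ->
  p ++ r = q ++ r' -> p = q /\ r = r'.
Proof.
elim: p q => [|a p IH] [|b q] //= [e] [<- h].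
by have [<- <-] := IH _ e h.
Qed.

Lemma map_eq_in_lset (T U : Type) (f h : T -> U) s :
  map f s = map h s <-> (forall x, lset s x -> f x = h x).
Proof.
elim: s => [//|a s IH] /=; split.
  by move=> [e /IH es] x [->|/es].
move=> e; congr (_ :: _); first by apply: e; left.
by apply/IH => x sx; apply: e; right.
Qed.

Lemma map_id_lset (T : Type) (f : T -> T) s :
  map f s = s <-> (forall x, lset s x -> f x = x).
Proof. by have := map_eq_in_lset f id s; rewrite map_id. Qed.

Lemma image_fix (T : Type) (f : T -> T) (Y : set T) :
  (forall y, Y y -> f y = y) -> f @` Y = Y.
Proof.
move=> fY; apply/seteqP; split=> [_ [y Yy <-]|y Yy]; first by rewrite fY.
by exists y => //; exact: fY.
Qed.

(** Stated for a set of maps because it is applied both to automorphisms of the action and to the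
    maps they induce on a field. *)
Lemma homogeneous_list (P : Type) (cl : set P -> set P) (S : set (P -> P)) :
  is_pregeometry cl -> S id -> (forall f, S f -> preserves_cl cl f) ->
  (forall f h, S f -> S h -> S (f \o h)) ->
  (forall X x y, finite_set X -> ~ cl X x -> ~ cl X y ->
    exists2 f, S f & (forall a, X a -> f a = a) /\ f x = y) ->
  forall (Y : set P) (s t : seq P), finite_set Y ->
  indseq cl Y s -> indseq cl Y t -> size s = size t ->
  exists2 f, S f & (forall a, Y a -> f a = a) /\ map f s = t.
Proof.
move=> pg S1 Scl Scomp hom Y s t.
elim: t s Y => [|b t IH] [|a s] Y //= fY; first by exists id.
move=> [Ya si] [Yb ti] [e]; have [f Sf [fY1 fab]] := hom _ _ _ fY Ya Yb.
have fYE : f @` (Y `|` [set a]) = Y `|` [set b].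
  by rewrite image_setU image_set1 fab image_fix.
have fin : finite_set (Y `|` [set b]).
  by rewrite finite_setU; split=> //; exact: finite_set1.
have si' : indseq cl (Y `|` [set b]) (map f s).
  by rewrite -fYE; apply/preserves_cl_indseq; [exact: Scl|].
have [|h Sh [hY hst]] := IH _ _ fin si' ti; first by rewrite size_map.
exists (h \o f); [exact: Scomp|split=> [y Yy|] /=].
  by rewrite fY1 // hY //; left.
by rewrite map_comp hst fab hY //; right.
Qed.

Local Open Scope ring_scope.

(** * Sharply 2-transitive groups with abelian point stabilizers *)

Lemma field_of_operations (Q : Type) (zero one : Q) (opp inv : Q -> Q)
    (add mul : Q -> Q -> Q) :
  associative add -> commutative add -> left_id zero add ->
  left_inverse zero opp add -> associative mul -> commutative mul ->
  left_id one mul -> left_distributive mul add -> one <> zero ->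
  (forall x, x <> zero -> mul (inv x) x = one) -> inv zero = zero ->
  exists (K : fieldType) (f : Q -> K), [/\ bijective f, f zero = 0, f one = 1,
    {morph f : x y / add x y >-> x + y} & {morph f : x y / mul x y >-> x * y}].
Proof.
move=> addA addC add0 addN mulA mulC mul1 mulD one0 mulV inv0.
pose Z : zmodType := HB.pack {classic Q}
  (GRing.isZmodule.Build {classic Q} addA addC add0 addN).
have one_neq0 : (one : Z) != 0 by apply/eqP.
pose R : comNzRingType := HB.pack (Z : Type) Z
  (GRing.Zmodule_isComNzRing.Build Z mulA mulC mul1 mulD one_neq0).
pose invR : R -> R := inv.
have mulVf (x : R) : x != 0 -> invR x * x = 1 by move/eqP; exact: mulV.
have invR0 : invR 0 = 0 := inv0.
pose K : fieldType := HB.pack (R : Type) R (GRing.ComNzRing_isField.Build R mulVf invR0).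
by exists K, id; split=> //; exists id.
Qed.

Section SharplyTwoTransitive.
Local Open Scope group_scope.
Variables (G : groupType) (Q : Type) (act : G -> Q -> Q).
Hypothesis actP : is_action act.
Hypothesis trans2 : forall a b c d, a <> b -> c <> d ->
  exists g, act g a = c /\ act g b = d.
Hypothesis sharp2 : forall g a b, a <> b -> act g a = a -> act g b = b -> g = 1.
Hypothesis stab_ab : forall a g h, act g a = a -> act h a = a -> g * h = h * g.
Hypothesis infQ : forall s : seq Q, exists x, ~ lset s x.
Implicit Types (g h x y z : G) (p q : Q).

Let act1 a : act 1 a = a. Proof. by case: actP. Qed.
Let actM g h a : act (g * h) a = act g (act h a). Proof. by case: actP. Qed.
Let actK g a : act g^-1 (act g a) = a. Proof. by rewrite -actM mulVg act1. Qed.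
Let actKV g a : act g (act g^-1 a) = a. Proof. by rewrite -actM mulgV act1. Qed.

Let act_eq g a b : act g a = b -> act g^-1 b = a.
Proof. by move=> <-; rewrite actK. Qed.

Let sharp2_eq g h a b : a <> b -> act g a = act h a -> act g b = act h b -> g = h.
Proof.
move=> ab ea eb; apply: (mulgI h^-1); rewrite mulVg.
by apply: (sharp2 ab); rewrite actM ?ea ?eb actK.
Qed.

Let cj g x := g * x * g^-1.
Let cjM g x y : cj g (x * y) = cj g x * cj g y.
Proof. by rewrite /cj !mulgA mulgVK. Qed.
Let cjV g x : cj g x^-1 = (cj g x)^-1.
Proof. by rewrite /cj !invgM invgK mulgA. Qed.
Let cjJ g h x : cj g (cj h x) = cj (g * h) x.
Proof. by rewrite /cj invgM !mulgA. Qed.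
Let cj_comm g x : g * x = x * g -> cj g x = x.
Proof. by rewrite /cj => ->; rewrite mulgK. Qed.
Let cj_inj g : injective (cj g).
Proof. by move=> x y /mulIg /mulgI. Qed.

Variables (o e : Q).
Hypothesis oe : o <> e.

Let S g := act g o = o.
Let S1 : S 1. Proof. exact: act1. Qed.
Let SM g h : S g -> S h -> S (g * h). Proof. by rewrite /S actM => Sg ->. Qed.
Let SV g : S g -> S g^-1. Proof. exact: act_eq. Qed.
Let SC g h : S g -> S h -> g * h = h * g. Proof. exact: stab_ab. Qed.
Let Sex p : p <> o -> exists2 g, S g & act g e = p.
Proof.
by move=> po; have [|g [? ?]] := @trans2 o e o p oe; [exact: nesym|exists g].
Qed.
Let Suniq g h : S g -> S h -> act g e = act h e -> g = h.
Proof. by move=> Sg Sh; apply: (sharp2_eq oe); rewrite Sg Sh. Qed.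

Variable tau : G.
Hypothesis tau_o : act tau o = e.

(** In the affine group, with [o] as 0 and [e] as 1, [tau] is [x |-> c x + 1] for an unknown [c] and
    [T b] is [x |-> c x + b e]. Hence quotients of these conjugates are the translations to look
    for. *)
Let T b := cj b tau.

Let To b : S b -> act (T b) o = act b e.
Proof. by move=> Sb; rewrite /T /cj !actM (act_eq Sb) tau_o. Qed.

(** [cj w tau] and [tau * T b] agree at [o], so they differ by an element of its stabilizer; the
    condition on [b] is what provides [w]. *)
Let sum_point b : S b -> act tau (act b e) <> o ->
  exists w d, [/\ S w, S d & cj w tau = tau * T b * d].
Proof.
move=> Sb nb; have [w Sw we] := Sex nb.
exists w, ((tau * T b)^-1 * cj w tau); split=> //; last by rewrite mulVKg.
have -> : cj w tau = T w by [].
by rewrite /S actM To // we; apply: act_eq; rewrite actM To.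
Qed.

(* Computing [(1 + u)(1 + b)] in two ways, with [tau] in the role of the
   translation by 1: if [w tau w^-1 = tau (b tau b^-1) d], then
   [w w' tau (w w')^-1] is symmetric in [b] and [u]. *)
Let symmetric_pair : exists d, forall b u, S b -> S u ->
  act tau (act b e) <> o -> act tau (act u e) <> o ->
  T u * d u * T b = T b * d b * T u.
Proof.
have /choice[d dP] : forall b, exists d, S b -> act tau (act b e) <> o ->
    S d /\ exists2 w, S w & cj w tau = tau * T b * d.
  move=> b; have [Sb|] := pselect (S b); last by exists 1.
  have [nb|] := pselect (act tau (act b e) <> o); last by exists 1.
  by have [w [d [Sw Sd h]]] := sum_point Sb nb; exists d => _ _; split=> //; exists w.
exists d => b u Sb Su nb nu.
have [Sdb [wb Swb eb]] := dP _ Sb nb; have [Sdu [wu Swu eu]] := dP _ Su nu.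
have half x y wx wy : S x -> S y -> S (d x) -> S (d y) -> S wx -> S wy ->
    cj wx tau = tau * T x * d x -> cj wy tau = tau * T y * d y ->
    cj wy (cj wx tau) = tau * (T y * d y * T x) * (T (x * y) * d y * d x).
  move=> Sx Sy Sdx Sdy Swx Swy ex ey.
  rewrite ex (cjM wy (tau * T x)) (cjM wy tau) (cj_comm (SC Swy Sdx)) ey.
  have -> : cj wy (T x) = T x * T (x * y) * d y.
    by rewrite /T cjJ SC // -cjJ ey (cjM x (tau * T y)) (cjM x tau) cjJ (cj_comm (SC Sx Sdy)).
  by rewrite !mulgA.
have h1 := half b u wb wu Sb Su Sdb Sdu Swb Swu eb eu.
have h2 := half u b wu wb Su Sb Sdu Sdb Swu Swb eu eb.
have : cj wu (cj wb tau) = cj wb (cj wu tau) by rewrite !cjJ SC.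
rewrite h1 h2 (SC Sb Su) -[T (u * b) * d u * _]mulgA -[T (u * b) * d b * _]mulgA.
by rewrite (SC Sdb Sdu) => /mulIg /mulgI.
Qed.

(** Solving the symmetric relations of the pairs [v, b] and [v, u] for [T b * d b] and [T u * d u],
    and inserting the results in that of [b, u], cancels the corrections [d]. The factor [c] moves
    all three points off the exceptions of [symmetric_pair], and is removed by conjugation. *)
Let triple b v u : S b -> S v -> S u ->
  T b * (T v)^-1 * T u = T u * (T v)^-1 * T b.
Proof.
move=> Sb Sv Su; have [d dP] := symmetric_pair.
have [p np] := infQ [:: o; act b^-1 (act tau^-1 o); act v^-1 (act tau^-1 o);
  act u^-1 (act tau^-1 o)].
have [|c Sc ce] := @Sex p; first by move=> e'; apply: np; rewrite e'; left.
have ok x : S x -> act x^-1 (act tau^-1 o) <> p -> act tau (act (c * x) e) <> o.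
  by move=> Sx npx e'; apply: npx; rewrite SC // actM ce in e'; rewrite -e' !actK.
have okb : act tau (act (c * b) e) <> o.
  by apply: ok => // e'; apply: np; rewrite -e'; inl.
have okv : act tau (act (c * v) e) <> o.
  by apply: ok => // e'; apply: np; rewrite -e'; inl.
have oku : act tau (act (c * u) e) <> o.
  by apply: ok => // e'; apply: np; rewrite -e'; inl.
have Scb := SM Sc Sb; have Scv := SM Sc Sv; have Scu := SM Sc Su.
apply: (@cj_inj c); rewrite 2!(cjM c (T _ * _)) 2!(cjM c (T _)) cjV /T !cjJ -!/(T _).
have ebv := dP _ _ Scv Scb okv okb; have euv := dP _ _ Scv Scu okv oku.
have eub := dP _ _ Scb Scu okb oku.
have Xb : T (c * b) * d (c * b) = T (c * v) * d (c * v) * T (c * b) * (T (c * v))^-1.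
  by rewrite -ebv mulgK.
have Xu : T (c * u) * d (c * u) = T (c * v) * d (c * v) * T (c * u) * (T (c * v))^-1.
  by rewrite -euv mulgK.
have cancel D x y z : D * x * z * y = D * y * z * x -> x * z * y = y * z * x.
  by rewrite -!mulgA => /mulgI.
by move: eub; rewrite Xb Xu => /cancel.
Qed.

(** The future translation group. As a centralizer it is a group at once, and it contains the
    quotients since they commute with each other ([AD]). *)
Let A z := forall b v, S b -> S v -> z * (T b * (T v)^-1) = T b * (T v)^-1 * z.

Let AD b v : S b -> S v -> A (T b * (T v)^-1).
Proof.
move=> Sb Sv u w Su Sw.
have rearrange x y z t : x * y^-1 * z = z * y^-1 * x -> y * x^-1 * t = t * x^-1 * y ->
    x * y^-1 * (z * t^-1) = z * t^-1 * (x * y^-1).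
  move=> h1 /(congr1 (fun x => x^-1)); rewrite !invgM !invgK => h2.
  by rewrite mulgA h1 -!mulgA (mulgA y^-1) (mulgA t^-1) -!mulgA h2.
by apply: rearrange; exact: triple.
Qed.

Let AM z t : A z -> A t -> A (z * t).
Proof. by move=> Az At b v Sb Sv; rewrite -mulgA At // mulgA Az // -mulgA. Qed.

Let AV z : A z -> A z^-1.
Proof.
move=> Az b v Sb Sv; apply: (mulgI z); rewrite mulVKg mulgA Az //.
by rewrite mulgK.
Qed.

Let A_cj g z : S g -> A z -> A (cj g z).
Proof.
move=> Sg Az b v Sb Sv.
have Tg x : T x = cj g (T (g^-1 * x)) by rewrite /T cjJ mulVKg.
rewrite (Tg b) (Tg v) -cjV -!cjM Az //; apply: SM => //; exact: SV.
Qed.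

Let D_trans p q : p <> o -> q <> o ->
  exists b v, [/\ S b, S v & act (T b * (T v)^-1) p = q].
Proof.
move=> po qo; have [b Sb be] := Sex qo; have [v Sv ve] := Sex po.
exists b, v; split=> //; rewrite actM -ve -(To Sv) actK To //.
Qed.

(** The conjugates for [w] and [1] send [w e'] and [e'] to [o]; their quotient moves [o] as soon as
    [w] moves [e']. *)
Let D_o : exists b v, [/\ S b, S v & act (T b * (T v)^-1) o <> o].
Proof.
pose e' := act tau^-1 o.
have e'o : e' <> o.
  by move=> h; apply: oe; rewrite -tau_o -[in RHS]h /e' actKV.
have [p np] := infQ [:: o; e'].
have [w Sw we] : exists2 w, S w & act w e' = p.
  have [||w [? ?]] := @trans2 o e' o p; [exact: nesym| |by exists w].
  by move=> h; apply: np; rewrite -h; left.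
exists w, 1; split=> //.
rewrite actM => /act_eq.
have TV b : S b -> act (T b)^-1 o = act b e'.
  by move=> Sb; rewrite -cjV /cj !actM (act_eq Sb).
by rewrite !TV // act1 we => h; apply: np; rewrite h; right; left.
Qed.

(** A quotient carries the fixed point to another point, again fixed because [z] commutes with
    quotients; two fixed points force the identity. *)
Let A_reg z p : A z -> act z p = p -> z = 1.
Proof.
have gen q : A z -> q <> o -> act z q = q -> z = 1.
  move=> Az qo zq; have [r nr] := infQ [:: o; q].
  have [|b [v [Sb Sv br]]] := @D_trans q r qo; first by move=> h; apply: nr; left.
  apply: (@sharp2 _ q r) => //; first by move=> h; apply: nr; right; left.
  by rewrite -br -actM Az // actM zq.
move=> Az zp; have [po|] := pselect (p = o); last by move=> po; exact: (gen p).
have [b [v [Sb Sv bv]]] := D_o; apply: (gen (act (T b * (T v)^-1) o)) => //.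
by rewrite -actM Az // actM -{1}po zp po.
Qed.

Let A_eq z t p : A z -> A t -> act z p = act t p -> z = t.
Proof.
move=> Az At h; apply: (mulgI t^-1); rewrite mulVg.
by apply: (@A_reg _ p); [apply: AM => //; exact: AV|rewrite actM h actK].
Qed.

Let A_trans p : exists2 z, A z & act z o = p.
Proof.
have [->|po] := pselect (p = o).
  by exists 1; [move=> b v _ _; rewrite mulg1 mul1g|exact: act1].
have [b [v [Sb Sv bv]]] := D_o; have [c [u [Sc Su cu]]] := D_trans bv po.
exists (T c * (T u)^-1 * (T b * (T v)^-1)); last by rewrite actM.
by apply: AM; exact: AD.
Qed.

(** An element of [A] not taking [e] to [o] agrees at [e] with a quotient, so it is that quotient
    and commutes with [A]. Two elements taking [e] to [o] coincide. *)
Let A_ab z t : A z -> A t -> z * t = t * z.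
Proof.
have half x y : A x -> A y -> act x e <> o -> x * y = y * x.
  move=> Ax Ay xe; have [b [v [Sb Sv h]]] := D_trans (nesym oe) xe.
  by rewrite -(@A_eq _ x e (AD Sb Sv) Ax h) Ay.
move=> Az At; have [ze|ze] := pselect (act z e = o); last exact: half.
have [te|te] := pselect (act t e = o); last by rewrite [RHS]half.
by rewrite (@A_eq z t e) // ze te.
Qed.

(** Addition comes from the regular group [A] by evaluation at [o], multiplication from the
    stabilizer of [o] by evaluation at [e]; distributivity says that the stabilizer normalizes
    [A]. *)
Lemma affine_field : exists (K : fieldType) (f : Q -> K),
  [/\ bijective f, f o = 0%R, f e = 1%R,
    forall g, exists a b : K, a != 0%R /\ forall p, f (act g p) = (a * f p + b)%R &
    forall a b : K, a != 0%R -> exists g, forall p, f (act g p) = (a * f p + b)%R].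
Proof.
have /choice[tr trP] : forall p, exists z, A z /\ act z o = p.
  by move=> p; have [z] := A_trans p; exists z.
have /choice[mu muP] : forall p, exists z, p <> o -> S z /\ act z e = p.
  move=> p; have [->|po] := pselect (p = o); first by exists 1.
  by have [z] := Sex po; exists z.
have trA p : A (tr p) := (trP p).1.
have tro p : act (tr p) o = p := (trP p).2.
have tr_eq z : A z -> z = tr (act z o) by move=> Az; apply: (@A_eq _ _ o).
have tro1 : tr o = 1 by apply: (@A_reg _ o).
have trM p q : tr (act (tr p) q) = tr p * tr q.
  by rewrite [RHS]tr_eq ?actM ?tro //; exact: AM.
have muS p : p <> o -> S (mu p) by move=> /muP[].
have mue p : p <> o -> act (mu p) e = p by move=> /muP[].
have So g p : S g -> p <> o -> act g p <> o.
  by move=> Sg po h; apply: po; rewrite -(actK g p) h SV.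
have mu_eq g : S g -> g = mu (act g e).
  move=> Sg; have h : act g e <> o by apply: So => //; exact: nesym.
  by apply: Suniq => //; [exact: muS|rewrite mue].
have mu1 : mu e = 1 by rewrite [RHS]mu_eq // act1.
pose add p q := act (tr p) q.
pose mul p q := if pselect (p = o) then o else act (mu p) q.
pose opp p := act (tr p)^-1 o.
(* The value at [o] follows the convention that the inverse of zero is zero. *)
pose inv p := if pselect (p = o) then o else act (mu p)^-1 e.
have mulE p q : p <> o -> mul p q = act (mu p) q.
  by rewrite /mul; case: pselect.
have mul0 q : mul o q = o by rewrite /mul; case: pselect.
have mulr0 q : mul q o = o.
  by have [->|qo] := pselect (q = o); rewrite ?mul0 // mulE // muS.
have muM p q : p <> o -> q <> o -> mu (mul p q) = mu p * mu q.
  move=> po qo; rewrite [RHS]mu_eq; last by apply: SM; exact: muS.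
  by rewrite actM mue // mulE.
have addA : associative add by move=> p q r; rewrite /add trM actM.
have addC : commutative add.
  by move=> p q; rewrite /add -[in LHS](tro q) -[in RHS](tro p) -!actM A_ab.
have add0 : left_id o add by move=> p; rewrite /add tro1 act1.
have addN : left_inverse o opp add.
  by move=> p; rewrite addC /add /opp actKV.
have mulN0 p q : p <> o -> q <> o -> mul p q <> o.
  by move=> po qo; rewrite mulE //; apply: So => //; exact: muS.
have mulC : commutative mul.
  move=> p q; have [->|po] := pselect (p = o); first by rewrite mul0 mulr0.
  have [->|qo] := pselect (q = o); first by rewrite mul0 mulr0.
  by rewrite !mulE // -[in LHS](mue q) // -[in RHS](mue p) // -!actM SC //; exact: muS.
have mulA : associative mul.
  move=> p q r; have [->|po] := pselect (p = o); first by rewrite !mul0.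
  have [->|qo] := pselect (q = o); first by rewrite mul0 !mulr0 mul0.
  have pq := mulN0 _ _ po qo.
  by rewrite (mulE _ r pq) muM // actM -!mulE.
have mul1 : left_id e mul by move=> p; rewrite mulE ?mu1 ?act1 //; exact: nesym.
have mulDr p q r : mul p (add q r) = add (mul p q) (mul p r).
  have [->|po] := pselect (p = o); first by rewrite !mul0 add0.
  rewrite !mulE // /add.
  have <- : cj (mu p) (tr q) = tr (act (mu p) q).
    rewrite [LHS]tr_eq; last by apply: A_cj => //; exact: muS.
    by rewrite /cj !actM (act_eq (muS _ po)) tro.
  by rewrite /cj !actM actK.
have mulDl : left_distributive mul add by move=> p q r; rewrite mulC mulDr !(mulC r).
have mulV p : p <> o -> mul (inv p) p = e.
  by move=> po; rewrite mulC mulE // /inv; case: pselect => // ?; rewrite actKV.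
have inv0 : inv o = o by rewrite /inv; case: pselect.
have [K [f [fbij f0 f1 fD fM]]] :=
  field_of_operations addA addC add0 addN mulA mulC mul1 mulDl (nesym oe) mulV inv0.
have finj := bij_inj fbij.
have fN0 p : (f p != 0%R) <-> p <> o.
  rewrite -f0; split=> [/eqP h e'|h]; first by rewrite e' in h.
  by apply/eqP => /finj.
exists K, f; split=> // [g|a b a0].
  pose b := act g o; pose h := (tr b)^-1 * g.
  have Sh : S h by rewrite /S actM; apply: act_eq.
  have ho : act h e <> o by apply: So => //; exact: nesym.
  exists (f (act h e)), (f b); split; first exact/fN0.
  move=> p; rewrite -fM -fD addC /add mulE // -mu_eq // -actM mulVKg //.
have [f' fK f'K] := fbij.
have nf' : f' a <> o by apply/fN0; rewrite f'K.
exists (tr (f' b) * mu (f' a)) => p.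
by rewrite actM -mulE // -/(add _ _) addC fD fM !f'K.
Qed.

End SharplyTwoTransitive.

Theorem sharply_2_transitive_field (G : groupType) (Q : Type) (act : G -> Q -> Q) :
  is_action act ->
  (forall a b c d, a <> b -> c <> d -> exists g, act g a = c /\ act g b = d) ->
  (forall g a b, a <> b -> act g a = a -> act g b = b -> g = 1%g) ->
  (forall a g h, act g a = a -> act h a = a -> (g * h = h * g)%g) ->
  (forall s : seq Q, exists x, ~ lset s x) ->
  forall o e, o <> e -> exists (K : fieldType) (f : Q -> K),
  [/\ bijective f, f o = 0, f e = 1,
    forall g, exists a b : K, a != 0 /\ forall p, f (act g p) = a * f p + b &
    forall a b : K, a != 0 -> exists g, forall p, f (act g p) = a * f p + b].
Proof.
move=> actP tr2 sh2 ab inf o e oe.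
have [tau [toe _]] := tr2 o e e o oe (nesym oe).
exact: (@affine_field _ _ _ actP tr2 sh2 ab inf o e oe tau toe).
Qed.

(** * Fields with a homogeneous pregeometry *)

(** Without the leading 1, the coefficients of a monic polynomial can be independent, and together
    with its size they still determine it. *)
Definition lower (R : nzRingType) (q : {poly R}) : seq R := take (size q).-1 q.

Lemma size_lower (R : nzRingType) (q : {poly R}) : size (lower q) = (size q).-1.
Proof. by rewrite size_takel // leq_pred. Qed.

Lemma map_lower (R : nzRingType) (f : {rmorphism R -> R}) (p q : {poly R}) :
  p \is monic -> q \is monic -> map f (lower p) = lower q -> size p = size q ->
  map_poly f p = q.
Proof.
move=> mp mq e sz; apply/polyP => i; rewrite coef_map.
have [lti|] := ltnP i (size q).-1.
  rewrite -(nth_take 0 lti q) -/(lower q) -e (nth_map 0); last by rewrite size_lower sz.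
  by rewrite nth_take ?sz.
rewrite leq_eqVlt => /orP[/eqP <-|lti].
  by rewrite -{1}sz -lead_coefE (monicP mp) -lead_coefE (monicP mq); exact: rmorph1.
have sq : (size q <= i)%N by rewrite -(prednK (_ : 0 < size q)%N) // size_poly_gt0 monic_neq0.
by rewrite !nth_default ?sz //; exact: rmorph0.
Qed.

Lemma classic_uniq (T : eqType) (s : seq T) : uniq (s : seq {classic T}) -> uniq s.
Proof.
elim: s => [//|a s IH] /= /andP[nas /IH ->]; rewrite andbT.
by apply: contra nas => /lsetP /(@lsetP {classic T}).
Qed.

Lemma irreducible_dvdp_root (K : fieldType) (L : fieldExtType K) (f g : {poly K})
    (z : L) : irreducible_poly f -> root (map_poly (in_alg L) f) z ->
  root (map_poly (in_alg L) g) z -> f %| g.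
Proof.
move=> irf fz gz; apply: contrapT => /negP; rewrite -irreducible_poly_coprime //.
rewrite -(coprimep_map (in_alg L)) => /coprimep_root /(_ fz).
by rewrite (eqP (gz : _ == 0)) eqxx.
Qed.

Section Closed.
Variables (K : fieldType) (cl : set K -> set K) (S : set (K -> K)).
Hypothesis pg : is_pregeometry cl.
Hypothesis inf : inf_dim cl.
Hypothesis S1 : S id.
Hypothesis Scl : forall f, S f -> preserves_cl cl f.
Hypothesis Scomp : forall f h, S f -> S h -> S (f \o h).
Hypothesis Smorph : forall f, S f -> exists F : {rmorphism K -> K}, f = F.
Hypothesis hom : forall X x y, finite_set X -> ~ cl X x -> ~ cl X y ->
  exists2 f, S f & (forall a, X a -> f a = a) /\ f x = y.

Lemma many_conjugates (s : seq K) x k : ~ cl (lset s) x ->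
  exists ws : seq K, [/\ uniq ws, size ws = k & forall w, w \in ws ->
    exists2 F : {rmorphism K -> K}, (forall a, a \in s -> F a = a) & F x = w].
Proof.
move=> nx; have [ws wsi sws] := inf_dimP inf k (finite_lset s).
exists ws; split=> //.
  exact: classic_uniq (indseq_uniq pg wsi).
move=> w /lsetP wws; have nw := indseq_mem pg wsi wws.
have [f Sf [fs fx]] := hom (finite_lset s) nx nw.
have [F eF] := Smorph Sf; exists F; last by rewrite -eF.
by move=> a /lsetP; rewrite -eF; exact: fs.
Qed.

Lemma map_poly_fix (F : {rmorphism K -> K}) (q : {poly K}) :
  (forall a, a \in (q : seq K) -> F a = a) -> map_poly F q = q.
Proof.
move=> Fq; apply/polyP => i; rewrite coef_map.
have [lti|?] := ltnP i (size q); first by apply: Fq; exact: mem_nth.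
by rewrite nth_default //; exact: rmorph0.
Qed.

Lemma map_lower_fix (F : {rmorphism K -> K}) (q : {poly K}) : q \is monic ->
  (forall a, a \in lower q -> F a = a) -> map_poly F q = q.
Proof.
move=> mq Fq; apply: map_lower => //.
by rewrite -[RHS]map_id; apply/eq_in_map.
Qed.

(** A root outside this closure would have arbitrarily many conjugates over the coefficients, all of
    them roots. *)
Lemma root_cl_lower (q : {poly K}) x : q \is monic -> root q x -> cl (lset (lower q)) x.
Proof.
move=> mq qx; apply: contrapT => nx.
have [ws [uws sws wsP]] := many_conjugates (size q) nx.
suff : (size ws < size q)%N by rewrite sws ltnn.
apply: max_poly_roots => //; first exact: monic_neq0.
apply/allP => w /wsP[F Fq <-].
by rewrite -(map_lower_fix mq Fq) fmorph_root.
Qed.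

(* The minimal polynomial over [K] of a generic element of [K(z)] has independent
   coefficients, so it is conjugate to a product of linear factors. *)
Lemma irreducible_size (f : {poly K}) : irreducible_poly f -> (size f <= 2)%N.
Proof.
move=> irf; rewrite leqNgt; apply/negP => sf.
have [L dL [z fz _]] := irredp_FAdjoin irf.
set iota := in_alg L in fz.
pose d := (size f).-1; rewrite -/d in dL.
have dE : size f = d.+1 by rewrite prednK // ltnW // ltnW.
(* Zero is in the base so that the generic coefficients are nonzero, which the end of the proof
   contradicts. *)
have [c ci sc] := inf_dimP inf d (finite_lset (0 :: (f : seq K))).
have small (g : {poly K}) : (size g <= d)%N -> root (map_poly iota g) z -> g = 0.
  move=> sg /(irreducible_dvdp_root irf fz) fg; apply/eqP; apply: contraT => g0.
  by have := dvdp_leq g0 fg; rewrite dE leqNgt ltnS sg.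
pose cp := Poly c; pose b := (map_poly iota cp).[z].
have scp : (size cp <= d)%N by rewrite -sc size_Poly.
have [q eq] : exists q, minPoly 1 b = map_poly iota q.
  exact/polyOver1P/minPolyOver.
have mq : q \is monic by rewrite -(map_monic iota) -eq monic_minPoly.
have sq : ((size q).-1 <= d)%N.
  rewrite -(size_map_poly iota) -eq size_minPoly /= -dL.
  apply: leq_trans (dimvS (subvf <<1; b>>%VS)).
  by rewrite dim_Fadjoin dimv1 muln1.
have qb : root (map_poly iota q) b by rewrite -eq root_minPoly.
have rootE (g : {poly K}) : root (map_poly iota q) (map_poly iota g).[z] =
    root (map_poly iota (q \Po g)) z.
  by rewrite /root map_comp_poly horner_comp.
have fqc : f %| q \Po cp by apply: irreducible_dvdp_root irf fz _; rewrite -rootE.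
(* If [x] moved freely over [f] and [q], the values at [z] of the conjugates of [cp] would be more
   roots of [q] than its degree allows; they are distinct by [small]. *)
have cq x : lset c x -> cl (lset ((f : seq K) ++ lower q)) x.
  move=> cx; apply: contrapT => nx.
  have [ws [uws sws wsP]] := many_conjugates (size q) nx.
  have /choice[F FP] : forall w, exists F : {rmorphism K -> K}, w \in ws ->
      (forall a, a \in (f : seq K) ++ lower q -> F a = a) /\ F x = w.
    move=> w; have [/wsP[F ? ?]|] := boolP (w \in ws); first by exists F.
    by exists idfun.
  pose bw w := (map_poly iota (map_poly (F w) cp)).[z].
  suff : (size (map bw ws) < size q)%N by rewrite size_map sws ltnn.
  rewrite -(size_map_poly iota q); apply: max_poly_roots.
  - by rewrite map_poly_eq0 monic_neq0.
  - apply/allP => _ /mapP[w /FP[Fs _] ->].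
    have Ff : map_poly (F w) f = f.
      by apply: map_poly_fix => a fa; apply: Fs; rewrite mem_cat fa.
    have Fq : map_poly (F w) q = q.
      by apply: map_lower_fix => // a qa; apply: Fs; rewrite mem_cat qa orbT.
    rewrite rootE -Fq -map_comp_poly.
    have /dvdpP[h ->] : f %| map_poly (F w) (q \Po cp) by rewrite -Ff dvdp_map.
    by rewrite rmorphM rootM fz orbT.
  - rewrite map_inj_in_uniq // => w w' /FP[Fs Fx] /FP[Fs' Fx'] e.
    have : map_poly (F w) cp - map_poly (F w') cp = 0.
      apply: small.
        apply: leq_trans (size_polyD _ _) _.
        by rewrite size_polyN !size_map_poly geq_max scp.
      by rewrite /root rmorphB hornerD hornerN -/(bw w) -/(bw w') e subrr.
    move=> /eqP; rewrite subr_eq0 => /eqP/polyP /(_ (index x c)).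
    rewrite !coef_map coef_Poly nth_index; last exact/lsetP.
    by move=> h; rewrite -Fx -Fx'; exact: h.
have cif : indseq cl (lset (f : seq K)) c by apply: (indseq_sub pg _ ci); sub.
(* At most [d] coefficients of [q] span, over [f], the [d] independent entries of [c]; so they are
   independent and [q] has degree [d]. *)
have lq : indseq cl (lset (f : seq K)) (lower q).
  apply: (indseq_span pg cif); last by rewrite size_lower sc.
  by move=> x /cq; rewrite lset_cat.
have szq : size q = d.+1.
  have q0 : (0 < size q)%N by rewrite size_poly_gt0 monic_neq0.
  rewrite -(prednK q0); congr _.+1; apply/eqP; rewrite eqn_leq sq /= -sc -size_lower.
  by apply: (steinitz pg cif) => x /cq; rewrite lset_cat.
have [r ri sr] := inf_dimP inf d (finite_lset (f : seq K)).
pose qr := \prod_(a <- r) ('X - a%:P).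
have mqr : qr \is monic by exact: monic_prod_XsubC.
have sqr : size qr = d.+1 by rewrite size_prod_XsubC sr.
have lqr : indseq cl (lset (f : seq K)) (lower qr).
  apply: (indseq_span pg ri); last by rewrite size_lower sqr sr.
  move=> x /lsetP rx; have := root_cl_lower mqr (x := x).
  by rewrite root_prod_XsubC rx => /(_ isT); apply: (cl_mono pg); sub.
have [|g Sg [_ gE]] := homogeneous_list pg S1 Scl Scomp hom (finite_lset (f : seq K)) lqr lq.
  by rewrite !size_lower sqr szq.
have [F eF] := Smorph Sg; rewrite eF in gE.
have qE : q = map_poly F qr by rewrite (map_lower mqr mq gE) // sqr szq.
move: qb; rewrite qE /qr !map_prod_XsubC.
rewrite -(big_map (fun a => iota (F a)) xpredT (fun b => 'X - b%:P)) root_prod_XsubC.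
move=> /mapP[a ra bE].
pose k := F a.
(* Since [q] splits, [b] lies in [K], so [cp], of degree less than [d], must be constant. *)
have : cp - k%:P = 0.
  apply: small.
    apply: leq_trans (size_polyD _ _) _.
    rewrite size_polyN geq_max scp (leq_trans (size_polyC_leq1 _)) //.
    by rewrite -ltnS -dE ltnW.
  by rewrite /root rmorphB /= map_polyC hornerD hornerN hornerC -/b bE /= subrr.
move=> /eqP; rewrite subr_eq0 => /eqP cpk.
have d1 : (1 < size c)%N by rewrite sc -ltnS -dE.
have : c`_1 = 0 by rewrite -coef_Poly -/cp cpk coefC.
have c1 : lset c c`_1 by apply/lsetP; exact: mem_nth.
move=> c10; apply: (indseq_mem pg ci c1); apply: (cl_ext pg).
by rewrite c10; left.
Qed.

Theorem homogeneous_field_closed (p : {poly K}) : (1 < size p)%N -> exists x, root p x.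
Proof.
have [m lem] := ubnP (size p); elim: m p lem => [//|m IH] p lem sp.
have [irp|] := pselect (irreducible_poly p).
  have /poly2_root[x px] : size p = 2 by apply/eqP; rewrite eqn_leq sp irreducible_size.
  by exists x.
move=> /not_andP[//|/existsNP[d /not_implyP[sd /not_implyP[dp ndp]]]].
have p0 : p != 0 by rewrite -size_poly_gt0 ltnW.
have d0 : d != 0 by apply: contraTneq dp => ->; rewrite dvd0p.
have [||x dx] := IH d.
- rewrite -ltnS; apply: leq_trans lem; rewrite ltnS ltn_neqAle dvdp_leq // andbT.
  by apply/negP => e; apply: ndp; rewrite -dvdp_size_eqp.
- by rewrite ltn_neqAle eq_sym sd size_poly_gt0.
- by exists x; exact: root_dvdp dx.
Qed.
End Closed.

(** * The projective line in coordinates *)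

Local Open Scope quotient_scope.

Section ProjectiveLine.
Variable K : fieldType.

Let i0 : 'I_2 := ord0.
Let i1 : 'I_2 := ord_max.

Let ordP (i : 'I_2) : i = i0 \/ i = i1.
Proof. by case: i => [[|[|//]] h]; [left|right]; exact: val_inj. Qed.

Let cV_eq (u v : 'cV[K]_2) : u i0 0 = v i0 0 -> u i1 0 = v i1 0 -> u = v.
Proof.
by move=> h0 h1; apply/matrixP => i j; rewrite ord1; case: (ordP i) => ->.
Qed.

Let mul_cV (A : 'M[K]_2) (v : 'cV[K]_2) i :
  (A *m v) i 0 = A i i0 * v i0 0 + A i i1 * v i1 0.
Proof.
rewrite mxE big_ord_recr big_ord_recr big_ord0 /= add0r.
by congr (A _ _ * v _ _ + _); exact: val_inj.
Qed.

Let det2 (A : 'M[K]_2) : \det A = A i0 i0 * A i1 i1 - A i0 i1 * A i1 i0.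
Proof.
rewrite (expand_det_row _ i0) big_ord_recl big_ord1 /cofactor !det_mx11 !mxE.
rewrite /= expr0 mul1r expr1 mulN1r mulrN.
by congr (A _ _ * A _ _ - A _ _ * A _ _); exact: val_inj.
Qed.

Definition col2 (x y : K) : 'cV[K]_2 := \col_i (if i == i0 then x else y).

Lemma col2_neq0 x y : (x != 0) || (y != 0) -> col2 x y != 0.
Proof.
move=> h; apply: contraL h => /eqP/matrixP h.
by have := h i0 0; have := h i1 0; rewrite !mxE /= => -> ->; rewrite eqxx.
Qed.

Lemma at_infinity_subproof : col2 1 0 != 0.
Proof. by apply: col2_neq0; rewrite oner_neq0. Qed.

Lemma finite_point_subproof x : col2 x 1 != 0.
Proof. by apply: col2_neq0; rewrite oner_neq0 orbT. Qed.

Definition pl_infty : proj_line K :=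
  \pi_(proj_line K) (Sub (col2 1 0) at_infinity_subproof : nz_vec K).

Definition pl_fin x : proj_line K :=
  \pi_(proj_line K) (Sub (col2 x 1) (finite_point_subproof x) : nz_vec K).

Lemma pl_inftyE (v : nz_vec K) :
  \pi_(proj_line K) v = pl_infty <-> (val v : 'cV_2) i1 0 = 0.
Proof.
rewrite -PL_piP; split=> [[c c0 ->]|v1]; first by rewrite !mxE mulr0.
exists ((val v : 'cV_2) i0 0).
  apply: contraTneq (valP v : val v != 0) => v0; rewrite negbK; apply/eqP.
  by apply: cV_eq; rewrite ?v0 ?v1 mxE.
by apply: cV_eq; rewrite !mxE /= ?v1 ?mulr0 ?mulr1.
Qed.

Lemma pl_finE (v : nz_vec K) x : \pi_(proj_line K) v = pl_fin x <->
  (val v : 'cV_2) i1 0 != 0 /\ (val v : 'cV_2) i0 0 = x * (val v : 'cV_2) i1 0.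
Proof.
rewrite -PL_piP; split=> [[c c0 ->]|[v1 v0]].
  by rewrite !mxE /= mulr1 c0 mulrC.
exists ((val v : 'cV_2) i1 0) => //.
by apply: cV_eq; rewrite !mxE /= ?v0 ?mulr1 // mulrC.
Qed.

Lemma pl_cases l : l = pl_infty \/ exists x, l = pl_fin x.
Proof.
elim/quotW: l => v; have [v1|v1] := eqVneq ((val v : 'cV_2) i1 0) 0.
  by left; apply/pl_inftyE.
right; exists ((val v : 'cV_2) i0 0 / (val v : 'cV_2) i1 0); apply/pl_finE.
by rewrite divfK.
Qed.

Lemma pl_fin_neq x : pl_fin x <> pl_infty.
Proof. by move=> /pl_inftyE; rewrite /= !mxE /= => /eqP; rewrite oner_eq0. Qed.

Lemma pl_fin_inj : injective pl_fin.
Proof. by move=> x y /pl_finE[_]; rewrite /= !mxE /= mulr1. Qed.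

Definition mx2 (a b c d : K) : 'M[K]_2 :=
  \matrix_(i, j) (if i == i0 then if j == i0 then a else b
                  else if j == i0 then c else d).

Lemma mx2_unit a b c d : a * d - b * c != 0 -> mx2 a b c d \is a GRing.unit.
Proof.
move=> h; change (mx2 a b c d \in unitmx); rewrite unitmxE unitfE.
by rewrite det2 !mxE.
Qed.

Lemma pl_GL_vec (A : GL2 K) (v : nz_vec K) i :
  (val (GL_vec A v) : 'cV_2) i 0 =
  (val A : 'M_2) i i0 * (val v : 'cV_2) i0 0 + (val A : 'M_2) i i1 * (val v : 'cV_2) i1 0.
Proof. exact: mul_cV. Qed.

Lemma affine_projective a b : a != 0 -> exists p : PGL2 K,
  PGL_act p pl_infty = pl_infty /\ forall x, PGL_act p (pl_fin x) = pl_fin (a * x + b).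
Proof.
move=> a0; have u : mx2 a b 0 1 \is a GRing.unit.
  by apply: mx2_unit; rewrite mulr0 subr0 mulr1.
exists (\pi_(PGL2 K) (Sub (mx2 a b 0 1) u : GL2 K)); split=> [|x].
  by rewrite PGL_actE; apply/pl_inftyE; rewrite pl_GL_vec /= !mxE /= mul0r mulr0 addr0.
rewrite PGL_actE; apply/pl_finE; rewrite !pl_GL_vec /= !mxE /=.
by rewrite mul0r add0r !mulr1 oner_neq0.
Qed.

Lemma swap_projective : exists p : PGL2 K,
  [/\ PGL_act p pl_infty = pl_fin 0, PGL_act p (pl_fin 0) = pl_infty &
      forall x, x != 0 -> PGL_act p (pl_fin x) = pl_fin x^-1].
Proof.
have u : mx2 0 1 1 0 \is a GRing.unit.
  by apply: mx2_unit; rewrite mul0r mulr1 sub0r oppr_eq0 oner_neq0.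
exists (\pi_(PGL2 K) (Sub (mx2 0 1 1 0) u : GL2 K)); split=> [||x x0].
- rewrite PGL_actE; apply/pl_finE; rewrite !pl_GL_vec /= !mxE /=.
  by rewrite !mul0r !mulr0 !mulr1 !addr0 oner_neq0.
- by rewrite PGL_actE; apply/pl_inftyE; rewrite pl_GL_vec /= !mxE /= !mulr0 mul0r addr0.
- rewrite PGL_actE; apply/pl_finE; rewrite !pl_GL_vec /= !mxE /=.
  by rewrite !mul0r !mul1r add0r addr0 mulVf.
Qed.

Lemma projective_fixing_infty (p : PGL2 K) : PGL_act p pl_infty = pl_infty ->
  exists a b, a != 0 /\ forall x, PGL_act p (pl_fin x) = pl_fin (a * x + b).
Proof.
elim/quotW: p => A; rewrite PGL_actE => /pl_inftyE.
rewrite pl_GL_vec /= !mxE /= mulr1 mulr0 addr0 => c0.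
have := valP A; change (val A \is a GRing.unit) with (val A \in unitmx).
rewrite unitmxE unitfE det2 -/i0 c0 mulr0 subr0 mulf_eq0 negb_or => /andP[a0 d0].
exists ((val A : 'M_2) i0 i0 / (val A : 'M_2) i1 i1),
  ((val A : 'M_2) i0 i1 / (val A : 'M_2) i1 i1).
split=> [|x]; first by rewrite mulf_neq0 ?invr_eq0.
rewrite PGL_actE; apply/pl_finE; rewrite !pl_GL_vec /= !mxE /= c0 mul0r add0r !mulr1.
by split=> //; rewrite mulrDl divfK // mulrAC divfK.
Qed.

Lemma PGL_act_faithful (p : PGL2 K) : (forall l, PGL_act p l = l) -> p = 1%g.
Proof.
elim/quotW: p => A h.
have := h pl_infty; rewrite PGL_actE => /pl_inftyE.
rewrite pl_GL_vec /= !mxE /= mulr1 mulr0 addr0 => c0.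
have := h (pl_fin 0); rewrite PGL_actE => /pl_finE.
rewrite !pl_GL_vec /= !mxE /= c0 !mulr0 !mul0r !mulr1 !add0r => -[d0 b0].
have := h (pl_fin 1); rewrite PGL_actE => /pl_finE.
rewrite !pl_GL_vec /= !mxE /= c0 b0 mul0r !mulr1 mul1r add0r addr0 => -[_ ad].
apply/PGL_piP; exists ((val A : 'M_2) i1 i1) => //.
apply/matrixP => i j; rewrite !mxE.
by case: (ordP i) => ->; case: (ordP j) => ->; rewrite ?c0 ?b0 ?ad /= ?mulr0 ?mulr1.
Qed.

End ProjectiveLine.

(* Charts and isomorphisms of actions *)
Local Close Scope quotient_scope.
Local Close Scope ring_scope.
Local Open Scope group_scope.

(** The stabilizer of [w] is sharply 2-transitive on the other points, with abelian point
    stabilizers; the field found there is turned into a parametrization of the complement of [w]. *)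
Lemma stabilizer_chart (G : groupType) (P : Type) (act : G -> P -> P) (w o e : P) :
  is_action act ->
  (forall a b c d, a <> w -> b <> w -> c <> w -> d <> w -> a <> b -> c <> d ->
    exists g, [/\ act g w = w, act g a = c & act g b = d]) ->
  (forall g a b, a <> w -> b <> w -> a <> b ->
    act g w = w -> act g a = a -> act g b = b -> g = 1) ->
  (forall a g h, a <> w -> act g w = w -> act h w = w -> act g a = a ->
    act h a = a -> g * h = h * g) ->
  (forall s : seq P, exists x, ~ lset s x) ->
  o <> w -> e <> w -> o <> e ->
  exists (K : fieldType) (pt : K -> P), [/\ injective pt,
    forall x, x <> w <-> exists k, pt k = x, pt 0%R = o /\ pt 1%R = e,
    forall g, act g w = w -> exists a b : K, a != 0%R /\
      forall k, act g (pt k) = pt (a * k + b)%R &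
    forall a b : K, a != 0%R -> exists2 g, act g w = w &
      forall k, act g (pt k) = pt (a * k + b)%R].
Proof.
move=> [act1 actM] tr sh ab inf ow ew oe.
have actK g x : act g^-1 (act g x) = x by rewrite -actM mulVg act1.
have Wsub : is_subgroup [set g | act g w = w].
  split=> [|x y /= xw yw] /=; first exact: act1.
  by rewrite actM -{1}yw actK.
pose W := Subgroup Wsub.
pose Q := {x : {classic P} | x != (w : {classic P})}.
have Ww (g : sg_type W) : act (val g) w = w by have := valP g; rewrite inE.
have Qw (x : Q) : (val x : P) <> w by have /eqP := valP x.
have actw (g : sg_type W) (x : Q) : (act (val g) (val x) : {classic P}) != w.
  by apply/eqP => e'; apply: (@Qw x); rewrite -(actK (val g) (val x)) e' -{1}(Ww g) actK.
pose actQ (g : sg_type W) (x : Q) : Q := Sub (act (val g) (val x) : {classic P}) (actw g x).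
have QE (x y : Q) : (val x : P) = val y -> x = y by move=> h; exact: val_inj.
have mkQ (x : P) (h : x <> w) : exists q : Q, (val q : P) = x.
  have h' : (x : {classic P}) != w by apply/negP => /eqP.
  by exists (Sub (x : {classic P}) h').
have mkW g (h : act g w = w) : exists q : sg_type W, val q = g.
  have h' : g \in sg_set W by rewrite inE.
  by exists (Sub g h').
have [qo qoE] := mkQ o ow; have [qe qeE] := mkQ e ew.
have NQ (x y : Q) : x <> y -> (val x : P) <> val y by move=> xy /QE.
have [||||||K [f [fbij fo fe f1 f2]]] :=
  @sharply_2_transitive_field (sg_type W) Q actQ _ _ _ _ _ qo qe.
- split=> [x|g h x]; apply: QE; rewrite /actQ /=; first exact: act1.
  exact: actM.
- move=> a b c d abn cdn.
  have [g [gw ga gb]] := tr _ _ _ _ (@Qw a) (@Qw b) (@Qw c) (@Qw d) (NQ _ _ abn) (NQ _ _ cdn).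
  by have [g' g'E] := mkW g gw; exists g'; split; apply: QE; rewrite /= g'E.
- move=> g a b abn ga gb; apply: val_inj.
  apply: (sh (val g) (val a) (val b)) => //; first exact: NQ.
    by rewrite -[in RHS]ga.
  by rewrite -[in RHS]gb.
- move=> a g h ga ha; apply: val_inj.
  apply: (ab (val a) (val g) (val h)) => //; first by rewrite -[in RHS]ga.
  by rewrite -[in RHS]ha.
- move=> s; have [x nx] := inf (w :: map (fun q : Q => (val q : P)) s).
  have [|q qE] := mkQ x; first by move=> h; apply: nx; rewrite h; left.
  by exists q => qs; apply: nx; right; rewrite lset_map; exists q.
- by move=> h; apply: oe; rewrite -qoE -qeE h.
have [f' fK f'K] := fbij.
have f'E k x : f x = k -> f' k = x by move=> <-; rewrite fK.
exists K, (fun k => val (f' k) : P); split.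
- by move=> x y /QE h; rewrite -(f'K x) h f'K.
- move=> x; split=> [/mkQ[q <-]|[k <-]]; last exact: Qw.
  by exists (f q); rewrite fK.
- by rewrite (f'E _ _ fo) (f'E _ _ fe).
- move=> g /mkW[g' <-]; have [a [b [a0 gE]]] := f1 g'.
  exists a, b; split=> // k.
  have -> : f' (a * k + b)%R = actQ g' (f' k) by apply: f'E; rewrite gE f'K.
  by [].  
- move=> a b a0; have [g gE] := f2 a b a0; exists (val g) => // k.
  have -> : f' (a * k + b)%R = actQ g (f' k) by apply: f'E; rewrite gE f'K.
  by [].
Qed.

(** By faithfulness matching elements are unique, so arbitrary choices of them in both directions
    are mutually inverse homomorphisms. *)
Lemma isomorphic_by_bijection (G H : groupType) (P Q : Type)
    (actG : G -> P -> P) (actH : H -> Q -> Q) (f : P -> Q) :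
  is_action actG -> is_action actH ->
  (forall g, (forall x, actG g x = x) -> g = 1) ->
  (forall h, (forall y, actH h y = y) -> h = 1) ->
  bijective f ->
  (forall g, exists h, forall x, f (actG g x) = actH h (f x)) ->
  (forall h, exists g, forall x, f (actG g x) = actH h (f x)) ->
  isomorphic_actions actG actH.
Proof.
move=> [G1 GM] [H1 HM] fG fH fbij /choice[phi phiP] /choice[psi psiP].
have faithful (X : groupType) (Y : Type) (a : X -> Y -> Y) : is_action a ->
    (forall g, (forall x, a g x = x) -> g = 1) ->
    forall g h, (forall x, a g x = a h x) -> g = h.
  move=> [a1 aM] fa g h e; apply: (mulgI h^-1); rewrite mulVg; apply: fa => x.
  by rewrite aM e -aM mulVg a1.
have [f' fK f'K] := fbij.
exists phi, f; split=> //.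
- exists psi => [g|h].
    apply: (faithful _ _ actG) => // x; apply: (can_inj fK).
    by rewrite psiP phiP.
  by apply: (faithful _ _ actH) => // y; rewrite -(f'K y) -phiP psiP.
- move=> g h; apply: (faithful _ _ actH) => // y.
  by rewrite -(f'K y) HM -!phiP GM.
Qed.

(** Multiplication by a matched element brings any element into the stabilizer of [w]. *)
Lemma matching_from_stabilizer (G H : groupType) (P Q : Type)
    (actG : G -> P -> P) (actH : H -> Q -> Q) (f : P -> Q) (w : P) :
  is_action actG -> is_action actH -> injective f -> (forall y, exists x, f x = y) ->
  (forall g, actG g w = w -> exists h, forall x, f (actG g x) = actH h (f x)) ->
  (forall h, actH h (f w) = f w -> exists g, forall x, f (actG g x) = actH h (f x)) ->
  (forall y, y <> w -> exists g h, actG g y = w /\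
    forall x, f (actG g x) = actH h (f x)) ->
  (forall g, exists h, forall x, f (actG g x) = actH h (f x)) /\
  (forall h, exists g, forall x, f (actG g x) = actH h (f x)).
Proof.
move=> [G1 GM] [H1 HM] finj fsurj sG sH tr.
have HK h y : actH h^-1 (actH h y) = y by rewrite -HM mulVg H1.
have GK g x : actG g^-1 (actG g x) = x by rewrite -GM mulVg G1.
have tr' y : exists g h, actG g y = w /\ forall x, f (actG g x) = actH h (f x).
  have [->|/tr //] := pselect (y = w).
  by exists 1, 1; rewrite G1; split=> // x; rewrite G1 H1.
split=> [g|h].
  have [g1 [h1 [g1w m1]]] := tr' (actG g w).
  have [|h2 m2] := sG (g1 * g); first by rewrite GM.
  exists (h1^-1 * h2) => x.
  by rewrite HM -m2 GM m1 HK.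
have [y yE] := fsurj (actH h (f w)).
have [g1 [h1 [g1w m1]]] := tr' y.
have [|g2 m2] := sH (h1 * h); first by rewrite HM -yE -m1 g1w.
exists (g1^-1 * g2) => x; rewrite -[LHS](HK h1) -m1 GM.
by rewrite -{1}[g1]invgK GK m2 HM HK.
Qed.

Local Open Scope ring_scope.

(** An equality of field types, rather than an isomorphism, lets charts over [K] be reused by
    substitution. *)
Lemma closedFieldType_of_roots (K : fieldType) :
  (forall p : {poly K}, (1 < size p)%N -> exists x, root p x) ->
  exists C : closedFieldType, (C : fieldType) = K.
Proof.
move=> rt; have ax : GRing.closed_field_axiom K.
  move=> m c m0; pose q := \poly_(i < m) c i.
  have sq : (size q < size ('X^m : {poly K}))%N by rewrite size_polyXn ltnS size_poly.
  have [|x] := rt ('X^m - q).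
    by rewrite size_polyDl ?size_polyN // size_polyXn ltnS.
  rewrite /root hornerD hornerN hornerXn subr_eq0 => /eqP xE.
  by exists x; rewrite xE horner_poly.
case: K rt ax => T c rt ax.
pose K : fieldType := GRing.Field.Pack c.
pose C : closedFieldType := HB.pack (K : Type) K (Field_isAlgClosed.Build K ax).
by exists C.
Qed.

Lemma aff_act_faithful (K : fieldType) (g : affine_group K) :
  (forall x, aff_act g x = x) -> g = 1%g.
Proof.
case: g => b a h; have b0 : b = 0 by have := h 0; rewrite /aff_act /= mulr0 add0r.
have a1 := h 1; rewrite /aff_act /= b0 mulr1 addr0 in a1.
by rewrite b0; congr (_, _); apply: val_inj.
Qed.

Local Close Scope ring_scope.

(** * Transitivity and the rank bound for [n]-actions *)

Section Action.
Variables (n : nat) (G : groupType) (P : Type) (cl : set P -> set P).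
Variables (act : G -> P -> P) (Sigma : set (auto G P)).
Hypothesis pg : is_pregeometry cl.
Hypothesis inf : inf_dim cl.
Hypothesis nact : n_action act cl n.
Hypothesis autS : is_auto_group act cl Sigma.
Hypothesis hom : omega_homogeneous cl Sigma.
Implicit Types (Y : set P) (s t : seq P) (g h : G) (f : auto G P).

Lemma act1 x : act 1 x = x.
Proof. by case: nact => -[]. Qed.

Lemma actM g h x : act (g * h) x = act g (act h x).
Proof. by case: nact => -[]. Qed.

Lemma actK g x : act g^-1 (act g x) = x.
Proof. by rewrite -actM mulVg act1. Qed.

Lemma actKV g x : act g (act g^-1 x) = x.
Proof. by rewrite -actM mulgV act1. Qed.

Lemma act_inj g : injective (act g).
Proof. by move=> x y e; rewrite -(actK g x) e actK. Qed.

Lemma act_cl g : preserves_cl cl (act g).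
Proof. by case: nact. Qed.

Lemma act_indseq g s : indseq cl set0 (map (act g) s) <-> indseq cl set0 s.
Proof. by have := preserves_cl_indseq set0 s (act_cl g); rewrite image_set0. Qed.

Lemma map_actM g h s : map (act (g * h)) s = map (act g) (map (act h) s).
Proof. by rewrite -map_comp; apply: eq_map => x /=; exact: actM. Qed.

Lemma map_actK g s : map (act g^-1) (map (act g) s) = s.
Proof. by rewrite -map_comp map_id_lset => x _ /=; exact: actK. Qed.

Lemma map_act1 s : map (act 1) s = s.
Proof. by apply/map_id_lset => x _; exact: act1. Qed.

Lemma auto_act f g x : Sigma f -> f.2 (act g x) = act (f.1 g) (f.2 x).
Proof. by move=> Sf; have [h _ _ _] := autS; have [] := h _ Sf. Qed.

Lemma autoM f g h : Sigma f -> f.1 (g * h) = f.1 g * f.1 h.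
Proof. by move=> Sf; have [h' _ _ _] := autS; have [_ -> _ _ _] := h' _ Sf. Qed.

Lemma auto1 f : Sigma f -> f.1 1 = 1.
Proof. by move=> Sf; apply: (mulIg (f.1 1)); rewrite -autoM // !mul1g. Qed.

Lemma auto_cl f : Sigma f -> preserves_cl cl f.2.
Proof. by move=> Sf; have [h _ _ _] := autS; have [] := h _ Sf. Qed.

Lemma fixing_list Y s t : finite_set Y ->
  indseq cl Y s -> indseq cl Y t -> size s = size t ->
  exists2 f, fixing Sigma Y f & map f.2 s = t.
Proof.
move=> fY si ti e; have [_ S1 Scomp _] := autS.
have [||||h [f Sf <-] [fixY m]] := @homogeneous_list P cl [set f.2 | f in Sigma] pg
    _ _ _ _ Y s t fY si ti e.
- by exists (id, id).
- by move=> _ [f Sf <-]; exact: auto_cl.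
- move=> _ _ [f Sf <-] [h Sh <-]; exists (f.1 \o h.1, f.2 \o h.2) => //.
  exact: Scomp.
- move=> X x y fX Xx Xy; have [f [Sf fixX] e'] := hom fX Xx Xy.
  by exists f.2 => //; exists f.
- by exists f.
Qed.

Lemma fixing1 Y x y : finite_set Y -> ~ cl Y x -> ~ cl Y y ->
  exists2 f, fixing Sigma Y f & f.2 x = y.
Proof. exact: hom. Qed.

Lemma point0 : inhabited P.
Proof. by have [a _] := inf [::]. Qed.

Lemma generic_list Y k : finite_set Y -> exists2 s, indseq cl Y s & size s = k.
Proof. exact: inf_dimP. Qed.

Lemma generic_point s : exists b, ~ cl (lset s) b.
Proof. exact: inf. Qed.

Lemma rank_trans s t : size s = n -> size t = n -> indseq cl set0 (s ++ t) ->
  exists g, map (act g) s = t.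
Proof.
move=> ss st si; have [x0] := point0; have [_ _ [+ _] _] := nact.
move=> /(_ (fun i => nth x0 s i) (fun i => nth x0 t i)) [|g gP].
  rewrite !range_nth // -lset_cat mul2n -addnn -{1}ss -st -size_cat.
  exact: dim_over_lset.
exists g; apply: (@eq_from_nth _ x0); first by rewrite size_map ss st.
move=> i; rewrite size_map ss => lti.
by rewrite (nth_map x0) ?ss //; exact: (gP (Ordinal lti)).
Qed.

Lemma indseq_cat_generic s t : indseq cl set0 s -> indseq cl (lset s) t ->
  indseq cl set0 (s ++ t).
Proof. by move=> si ti; apply/indseq_cat; rewrite set0U. Qed.

(** Two independent [n]-lists may be jointly dependent; both are carried to a third list, generic
    over them. *)
Lemma act_trans s t : size s = n -> size t = n ->
  indseq cl set0 s -> indseq cl set0 t -> exists g, map (act g) s = t.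
Proof.
move=> ss st si ti; have [z zi sz] := generic_list n (finite_lset (s ++ t)).
have [|g gs] := rank_trans ss sz.
  by apply: indseq_cat_generic => //; apply: indseq_sub zi => //; sub.
have [|h ht] := rank_trans st sz.
  by apply: indseq_cat_generic => //; apply: indseq_sub zi => //; sub.
by exists (h^-1 * g); rewrite map_actM gs -ht map_actK.
Qed.

Lemma determined_list s g h : size s = n.+1 -> indseq cl set0 s ->
  map (act g) s = map (act h) s -> g = h.
Proof.
move=> ss si /map_eq_in_lset e; have [_ _ _ det] := nact.
by apply: (det g h (lset s)) => //; rewrite -ss; exact: dim_over_lset.
Qed.

Lemma fix_elt f s g : Sigma f -> size s = n.+1 -> indseq cl set0 s ->
  (forall x, lset s x -> f.2 x = x /\ f.2 (act g x) = act g x) -> f.1 g = g.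
Proof.
move=> Sf ss si fixs; apply: (determined_list ss si); apply/map_eq_in_lset => x sx.
by have [e <-] := fixs _ sx; rewrite auto_act // e.
Qed.

Lemma rank_fails : exists s t, [/\ size s = n.+1, size t = n.+1,
  indseq cl set0 (s ++ t) & ~ exists g, map (act g) s = t].
Proof.
have [_ _ [_ [x [y [d ng]]]] _] := nact.
exists (map x (enum 'I_n.+1)), (map y (enum 'I_n.+1)).
have sz (z : 'I_n.+1 -> P) : size (map z (enum 'I_n.+1)) = n.+1.
  by rewrite size_map size_enum_ord.
split; rewrite ?sz //.
  apply: dim_lset_indseq => //; rewrite lset_cat !lset_enum.
  by rewrite size_cat !sz addnn -mul2n mulnS addnC.
move=> [g]; rewrite -map_comp => /map_eq_in_lset e; apply: ng; exists g => i.
by apply: e; apply/lsetP; rewrite mem_enum.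
Qed.

(* Otherwise moving [act g w] freely produces elements fixing an independent
   [n]-tuple and moving a further point arbitrarily, which raises the rank. *)
Lemma rank_closure s g w : size s = n -> indseq cl set0 s ->
  cl (lset (s ++ map (act g) s ++ [:: w])) (act g w).
Proof.
move=> ss si; apply: contrapT => nw.
set z := s ++ _ in nw.
have sw : ~ cl (lset s) w.
  move=> /(act_cl g) h; apply: nw; apply: (cl_mono pg) h.
  by rewrite -lset_map /z; sub.
have [v nv] := generic_point (z ++ [:: act g w]).
have nv' : ~ cl (lset z) v by move=> h; apply: nv; apply: (cl_mono pg) h; sub.
have [f [Sf fixz] fw] := fixing1 (finite_lset z) nw nv'.
have zs x : lset s x -> lset z x by rewrite /z lset_cat; left.
have zgs x : lset s x -> lset z (act g x).
  by move=> sx; rewrite /z !lset_cat lset_map; right; left; exists x.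
have zw : lset z w by rewrite /z !lset_cat; right; right; left.
pose k := f.1 g * g^-1.
have kz x : lset s x -> act k (act g x) = act g x.
  move=> sx; rewrite /k actM actK -[in LHS](fixz x (zs _ sx)) -auto_act //.
  by rewrite fixz //; exact: zgs.
have kw : act k (act g w) = v.
  by rewrite /k actM actK -[in LHS](fixz w zw) -auto_act.
pose c := map (act g) s.
have ci : indseq cl set0 (c ++ [:: act g w; v]).
  apply/indseq_cat; rewrite set0U act_indseq /=; split=> //; split.
    by rewrite /c lset_map -(act_cl g).
  split=> //; move=> h; apply: nv; apply: (cl_mono pg) h; rewrite /c /z; sub.
have sc : size c = n by rewrite size_map.
(* Automorphisms transport the behaviour of [k] to every independent list of [n + 2] points. *)
have one p u z' : indseq cl set0 (p ++ [:: u; z']) -> size p = n ->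
    exists g', map (act g') p = p /\ act g' u = z'.
  move=> pi sp; have [|f' [Sf' _] ef] := fixing_list (finite_set0 _) ci pi.
    by rewrite !size_cat sp sc.
  move: ef; rewrite map_cat => /cat_inj []; first by rewrite size_map sc sp.
  move=> ep [eu ez]; exists (f'.1 k); split.
    rewrite -ep -map_comp; apply/map_eq_in_lset => x cx /=.
    move: cx; rewrite /c lset_map => -[y sy <-].
    by rewrite -auto_act // kz.
  by rewrite -eu -ez -kw -auto_act.
(* Passing through a generic point removes the joint independence of [u] and [u']; the group then
   becomes transitive on independent lists of [n + 1] points, against [rank_fails]. *)
have two p u u' : indseq cl set0 (rcons p u) -> indseq cl set0 (rcons p u') ->
    size p = n -> exists g', map (act g') p = p /\ act g' u = u'.
  move=> /indseq_rcons [pi]; rewrite set0U => pu /indseq_rcons [_].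
  rewrite set0U => pu' sp.
  have [b nb] := generic_point (p ++ [:: u; u']).
  have [|g1 [g1p g1u]] := one p u b _ sp.
    apply/indseq_cat; rewrite set0U /=; split=> //; split=> //; split=> //.
    move=> h; apply: nb; apply: (cl_mono pg) h; sub.
  have [|g2 [g2p g2u]] := one p u' b _ sp.
    apply/indseq_cat; rewrite set0U /=; split=> //; split=> //; split=> //.
    move=> h; apply: nb; apply: (cl_mono pg) h; sub.
  exists (g2^-1 * g1); rewrite map_actM g1p -{1}g2p map_actK actM g1u -g2u actK.
  by [].
have [x [y [+ + xyi ng]]] := rank_fails.
case/lastP: x xyi ng => [//|x u] xyi ng; rewrite size_rcons => -[sx].
case/lastP: y xyi ng => [//|y u'] xyi ng; rewrite size_rcons => -[sy].
have /indseq_cat[xi +] := xyi; rewrite set0U => /(indseq_mono pg) yi.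
have {}yi : indseq cl set0 (rcons y u') by apply: yi => // z' [].
have [xi' _] := proj1 (indseq_rcons _ _ _ _) xi.
have [yi' _] := proj1 (indseq_rcons _ _ _ _) yi.
have [g1 g1x] := act_trans sx sy xi' yi'.
have [|h [hy hu]] := two y (act g1 u) u' _ yi sy.
  by rewrite -g1x -map_rcons act_indseq.
apply: ng; exists (h * g1); rewrite map_actM map_rcons g1x map_rcons hy hu.
by [].
Qed.

Lemma inverse_auto f : Sigma f -> exists2 f', Sigma f' &
  forall x, f.2 (f'.2 x) = x /\ f'.2 (f.2 x) = x.
Proof.
move=> Sf; have [_ _ _ inv] := autS; have [f' Sf' [_ _ c1 c2]] := inv _ Sf.
by exists f' => // x; rewrite c1 c2.
Qed.

(** * Coordinate fields are algebraically closed *)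

Section Chart.
Local Open Scope ring_scope.
Variables (K : fieldType) (pt : K -> P) (Z : seq P) (H : set G).
Hypothesis pt_inj : injective pt.
Hypothesis Z0 : lset Z (pt 0).
Hypothesis Z1 : lset Z (pt 1).
Hypothesis pt_fixing : forall f k, fixing Sigma (lset Z) f ->
  exists k', pt k' = f.2 (pt k).
Hypothesis pt_generic : forall x, ~ cl (lset Z) x -> exists k, pt k = x.
Hypothesis H_affine : forall g, H g -> exists a b : K, a != 0 /\
  forall k, act g (pt k) = pt (a * k + b).
Hypothesis affine_H : forall a b : K, a != 0 -> exists2 g, H g &
  forall k, act g (pt k) = pt (a * k + b).
Hypothesis H_fixing : forall f g, fixing Sigma (lset Z) f -> H g -> H (f.1 g).

(** The induced maps fix 0 and 1 and conjugate affine maps to affine maps, which makes them field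
    morphisms. *)
Let ind : set (K -> K) :=
  [set phi | exists2 f, fixing Sigma (lset Z) f & forall k, pt (phi k) = f.2 (pt k)].

Let ind_affine phi (a b : K) : ind phi -> a != 0 -> exists a' b', a' != 0 /\
  forall k, phi (a * k + b) = a' * phi k + b'.
Proof.
move=> [f [Sf fZ] hf] a0; have [g Hg ga] := affine_H b a0.
have [a' [b' [a'0 ga']]] := H_affine (H_fixing (conj Sf fZ) Hg).
exists a', b'; split=> // k; apply: pt_inj.
by rewrite hf -ga auto_act // -hf ga'.
Qed.

Let ind_surj phi : ind phi -> forall k, exists k', phi k' = k.
Proof.
move=> [f [Sf fZ] hf] k; have [f' Sf' ff'] := inverse_auto Sf.
have [|k' k'E] := @pt_fixing f' k.
  by split=> // z Zz; rewrite -{1}(fZ _ Zz) (ff' z).2.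
by exists k'; apply: pt_inj; rewrite hf k'E (ff' _).1.
Qed.

Let ind_morphism phi : ind phi -> exists F : {rmorphism K -> K}, phi = F.
Proof.
move=> ih; have [f [Sf fZ] hf] := ih.
have h0 : phi 0 = 0 by apply: pt_inj; rewrite hf fZ.
have h1 : phi 1 = 1 by apply: pt_inj; rewrite hf fZ.
have hinj : injective phi.
  have [f' Sf' ff'] := inverse_auto Sf.
  by move=> x y e; apply: pt_inj; rewrite -(ff' (pt x)).2 -hf e hf (ff' _).2.
have hD x y : phi (x + y) = phi x + phi y.
  have [y0|y0] := eqVneq y 0; first by rewrite y0 h0 !addr0.
  have [a [b [a0 e]]] := ind_affine y ih (oner_neq0 K).
  have {}e k : phi (k + y) = a * phi k + b by rewrite -e mul1r.
  have bE : b = phi y by rewrite -[y]add0r e h0 mulr0 add0r.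
  (* Otherwise this affine map would have a fixed point, whereas it is conjugate to a nontrivial
     translation. *)
  suff a1 : a = 1 by rewrite e a1 mul1r bE.
  apply/eqP; apply: contraT => a1.
  have [k kE] := ind_surj ih (b / (1 - a)).
  have : phi (k + y) = phi k.
    have tb : (1 - a) * (phi k) = b by rewrite kE mulrC divfK // subr_eq0 eq_sym.
    by rewrite e -tb mulrBl mul1r addrC subrK.
  by move=> /hinj /eqP; rewrite -subr_eq0 addrC addKr (negPf y0).
have hM x y : phi (x * y) = phi x * phi y.
  have [x0|x0] := eqVneq x 0; first by rewrite x0 h0 !mul0r.
  have [a [b [a0 e]]] := ind_affine 0 ih x0.
  have {}e k : phi (x * k) = a * phi k + b by rewrite -e addr0.
  have b0 : b = 0 by have := e 0; rewrite h0 !mulr0 h0 add0r.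
  have aE : a = phi x by have := e 1; rewrite h1 !mulr1 b0 addr0.
  by rewrite e aE b0 addr0.
have hB : Algebra.zmod_morphism phi.
  move=> x y; apply: (addIr (phi y)); rewrite -hD !subrK //.
pose F : {rmorphism K -> K} := HB.pack phi (GRing.isZmodMorphism.Build K K phi hB)
  (GRing.isMonoidMorphism.Build K K phi (conj h1 hM)).
by exists F.
Qed.

Lemma chart_closed (p : {poly K}) : (1 < size p)%N -> exists x, root p x.
Proof.
apply: (@homogeneous_field_closed K (pullback_cl cl (lset Z) pt) ind).
- exact: pullback_pregeometry.
- move=> s; have [x nx] := generic_point (Z ++ map pt s).
  have [|k kx] := @pt_generic x; first by move=> h; apply: nx; apply: (cl_mono pg) h; sub.
  by exists k; rewrite /pullback_cl /= kx -lset_map -lset_cat.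
- by exists (id, id) => //; split=> //; have [_ ? _ _] := autS.
- move=> phi [f [Sf fZ] hf] X a; rewrite /pullback_cl /= hf (auto_cl Sf).
  rewrite image_setU image_fix // !image_comp.
  suff -> : f.2 \o pt = pt \o phi by [].
  by apply/funext => k /=; rewrite hf.
- move=> phi phi' [f [Sf fZ] hf] [f' [Sf' fZ'] hf'].
  exists (f.1 \o f'.1, f.2 \o f'.2); last by move=> k /=; rewrite hf hf'.
  have [_ _ Scomp _] := autS; split; first exact: Scomp.
  by move=> z Zz /=; rewrite fZ' // fZ.
- exact: ind_morphism.
move=> X x y /finite_lsetP [s <-] nx ny.
rewrite /pullback_cl /= -lset_map -lset_cat in nx ny.
have [f [Sf fZ] fx] := fixing1 (finite_lset _) nx ny.
have fixZ : fixing Sigma (lset Z) f.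
  by split=> // z Zz; apply: fZ; rewrite lset_cat; left.
have /choice[phi phiP] : forall k, exists k', pt k' = f.2 (pt k).
  by move=> k; exact: pt_fixing.
exists phi; first by exists f.
split=> [a sa|]; apply: pt_inj; rewrite phiP // fZ // lset_cat lset_map.
by right; exists a.
Qed.

End Chart.

(** * The pregeometry on a group acting with rank one *)

Section OneAction.
Variables (A : seq P) (N : subgroup G).
Hypothesis sA : (size A).+1 = n.
Hypothesis Ai : indseq cl set0 A.
Hypothesis NA : N `<=` pt_stab act (lset A).
Hypothesis Ninv : is_invariant Sigma (lset A) N.
Hypothesis Ntr : forall x y, ~ cl (lset A) x -> ~ cl (lset A) y ->
  exists2 g, sg_set N g & act g x = y.
Hypothesis Nug : forall (Z : seq P) g h,
  (forall z, lset Z z -> ~ cl (lset A) z) -> sg_set N g -> sg_set N h ->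
  (exists x, ~ cl (lset (A ++ Z)) x /\ ~ cl (lset (A ++ Z ++ [:: x])) (act g x)) ->
  (exists x, ~ cl (lset (A ++ Z)) x /\ ~ cl (lset (A ++ Z ++ [:: x])) (act h x)) ->
  exists2 f, fixing Sigma (lset (A ++ Z)) f & f.1 g = h.

Let M := sg_type N.

Let N_val (g : M) : sg_set N (val g).
Proof. by have := valP g; rewrite inE. Qed.

Let N_cl g x : sg_set N g -> ~ cl (lset A) x -> ~ cl (lset A) (act g x).
Proof. by move=> Ng; rewrite -(preserves_cl_fix (act_cl g) (NA Ng)). Qed.

(** Because [g] fixes [A], its value at one point outside [cl A] controls all its other values up to
    closure. *)
Let rank1 g x y : sg_set N g -> ~ cl (lset A) x ->
  cl (lset (A ++ [:: x; act g x; y])) (act g y).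
Proof.
move=> Ng Ax; have := @rank_closure (rcons A x) g y.
rewrite size_rcons map_rcons (proj2 (map_id_lset (act g) _)); last exact: NA.
move=> /(_ sA) h; have {}h := h (proj2 (indseq_rcons _ _ _ _) (conj Ai _)).
rewrite set0U in h; have := h Ax; apply: (cl_mono pg); sub.
Qed.

Variable x : P.
Hypothesis Ax : ~ cl (lset A) x.

(** The point [x] belongs to the base because automorphisms fixing it commute with evaluation at
    [x]. *)
Let W := lset (rcons A x).
Let ev (g : M) : P := act (val g) x.
Let clM : set M -> set M := pullback_cl cl W ev.

Let pgM : is_pregeometry clM.
Proof. exact: pullback_pregeometry. Qed.

Let evK p : ~ cl (lset A) p -> exists g : M, ev g = p.
Proof.
move=> Ap; have [g Ng gx] := Ntr Ax Ap.
have Ng' : g \in sg_set N by rewrite inE.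
by exists (Sub g Ng').
Qed.

Let L := @Language nat S unit (fun=> 2).

(* The relations say that the first coordinate is in the closure of the others,
   so that every automorphism preserves [clM]. *)
Let St : structure_on L M := @StructureOn L M
  (fun (r : nat) (v : 'I_r.+1 -> M) => clM (range (fun i : 'I_r => v (lift ord0 i))) (v ord0))
  (fun (_ : unit) (v : 'I_2 -> M) => v ord0 * v ord_max).

Let St_expands : expands_group St.
Proof.
exists tt => // v i j i0 j1 /=.
by congr (v _ * v _); apply: val_inj; rewrite ?i0 ?j1.
Qed.

Let St_cl (s : M -> M) : is_structure_auto St s -> forall X, s @` clM X = clM (s @` X).
Proof.
move=> [[s' sK s'K] srel _].
have list_cl (t : seq M) (g : M) : clM (lset t) g <-> clM (s @` lset t) (s g).
  pose v (i : 'I_(size t).+1) := nth g (g :: t) i.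
  have e : range (fun i : 'I_(size t) => v (lift ord0 i)) = lset t.
    by rewrite -(range_nth g erefl).
  have e' : range (fun i : 'I_(size t) => (s \o v) (lift ord0 i)) = s @` lset t.
    by rewrite -e image_comp.
  have h : clM (range (fun i : 'I_(size t) => v (lift ord0 i))) (v ord0) <->
    clM (range (fun i : 'I_(size t) => (s \o v) (lift ord0 i))) ((s \o v) ord0) :=
    srel (size t) v.
  by rewrite e e' in h.
move=> X; apply/seteqP; split=> [_ [g Xg <-]|h Xh].
  have [t tX tg] := cl_finl pgM Xg.
  have := proj1 (list_cl t g) tg; apply: (cl_mono pgM) => _ [u tu <-].
  by exists u => //; exact: tX.
have [t tX th] := cl_finl pgM Xh.
exists (s' h) => //.
have : clM (lset (map s' t)) (s' h).
  apply/list_cl; rewrite s'K -lset_map -map_comp (proj2 (map_id_lset _ _)) //.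
  by move=> u _ /=; exact: s'K.
apply: (cl_mono pgM) => u; rewrite lset_map => -[h' th' <-].
by have [g Xg <-] := tX _ th'; rewrite sK.
Qed.

Let St_auto f : fixing Sigma (lset A) f -> f.2 x = x -> exists s : M -> M,
  [/\ is_structure_auto St s, preserves_cl clM s & forall g : M, val (s g) = f.1 (val g)].
Proof.
move=> [Sf fA] fx.
have valE := (val_restr_auto (auto_cl Sf) fA (Ninv (conj Sf fA))).1.
set s := (restr_auto cl N (lset A) f).1 in valE.
have evs (g : M) : ev (s g) = f.2 (ev g) by rewrite /ev valE auto_act // fx.
have scl : preserves_cl clM s.
  move=> X g; rewrite /clM /pullback_cl /= evs (auto_cl Sf) image_setU image_fix.
    by rewrite !image_comp (_ : f.2 \o ev = ev \o s) //; apply/funext => u /=; rewrite evs.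
  by move=> u; rewrite /W lset_rcons => -[/fA|->].
exists s; split=> //; split.
- have [_ _ _ /(_ _ Sf) [f' Sf' [c1 c2 c3 c4]]] := autS.
  have f'A a : lset A a -> f'.2 a = a by move=> Aa; rewrite -{1}(fA _ Aa) c3.
  have valE' := (val_restr_auto (auto_cl Sf') f'A (Ninv (conj Sf' f'A))).1.
  exists (restr_auto cl N (lset A) f').1 => g; apply: val_inj.
    by rewrite valE' valE c1.
  by rewrite valE valE' c2.
- move=> r v /=; rewrite (scl _ (v ord0)) image_comp //.
- move=> t v; apply: val_inj; rewrite valE.
  apply: etrans (autoM (val (v ord0)) (val (v ord_max)) Sf) _.
  by rewrite -!valE.
Qed.

(** The automorphism comes from unique generics over [A] and [Z]. The auxiliary point [y] is there
    to fix the elements of [t]: it makes [n + 1] points with [A] and [x], and [Z] contains the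
    values of [t] at [x] and [y], so [fix_elt] applies. By [rank1] the values at [y] already lie in
    the closure of [E] and [y], so [a] and [b] remain generic over [A] and [Z]. *)
Let St_homogeneous (t : seq M) a b : ~ clM (lset t) a -> ~ clM (lset t) b ->
  exists s : M -> M, [/\ is_structure_auto St s, preserves_cl clM s,
    forall g : M, lset t g -> s g = g & s a = b].
Proof.
move=> na nb.
pose E := rcons A x ++ map ev t.
have clE (u : M) : clM (lset t) u <-> cl (lset E) (ev u).
  by rewrite /clM /pullback_cl /= /W -lset_map -lset_cat.
have {}na : ~ cl (lset E) (ev a) by rewrite -clE.
have {}nb : ~ cl (lset E) (ev b) by rewrite -clE.
have [y ny] := generic_point (E ++ [:: ev a; ev b]).
pose Z := x :: y :: map ev t ++ map (fun g : M => act (val g) y) t.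
have Ey : ~ cl (lset (rcons A x)) y.
  by move=> h; apply: ny; apply: (cl_mono pg) h; rewrite /E; sub.
have Ay : ~ cl (lset A) y.
  by move=> h; apply: Ey; apply: (cl_mono pg) h; sub.
have ZA z : lset Z z -> ~ cl (lset A) z.
  rewrite /Z /= lset_cat !lset_map => -[->//|[->//|]].
  by case=> -[g _ <-]; apply: N_cl => //; exact: N_val.
have ZE : cl (lset (A ++ Z)) `<=` cl (lset (E ++ [:: y])).
  apply: (cl_sub pg) => z; rewrite lset_cat /Z /= lset_cat !lset_map.
  case=> [Az|[->|[->|[[g tg <-]|[g tg <-]]]]].
  - by apply: (cl_ext pg); rewrite /E; inl.
  - by apply: (cl_ext pg); rewrite /E; inl.
  - by apply: (cl_ext pg); rewrite /E; inl.
  - apply: (cl_ext pg); rewrite /E !lset_cat lset_map; left; right; by exists g.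
  - have := rank1 y (N_val g) Ax; apply: (cl_mono pg) => u.
    rewrite /E !lset_cat lset_rcons lset_map /= => -[Au|[->|[->|[->|//]]]].
    + by left; left; left.
    + by left; left; right.
    + by left; right; exists g.
    + by right; left.
have gen (u : M) : ~ cl (lset E) (ev u) -> lset [:: ev a; ev b] (ev u) ->
    exists z, ~ cl (lset (A ++ Z)) z /\ ~ cl (lset (A ++ Z ++ [:: z])) (act (val u) z).
  move=> nu uab.
  have nuZ : ~ cl (lset (A ++ Z)) (ev u).
    move=> /ZE; rewrite lset_cat /= setU0 => cu; apply: ny.
    have := cl_exch pg cu nu; apply: (cl_mono pg) => z [?|->]; rewrite lset_cat; by [left|right].
  have [z nz] := generic_point (A ++ Z ++ [:: ev u]).
  exists z; split; first by move=> h; apply: nz; apply: (cl_mono pg) h; sub.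
  (* From [cz], [rank1] puts [u x] in the closure of [A], [Z], [z]; exchange then puts [z] in that
     of [A], [Z], [u x], which its choice forbids. *)
  move=> cz; apply: (nz).
  have Az : ~ cl (lset A) z.
    by move=> h; apply: (nz); apply: (cl_mono pg) h; sub.
  have cu : cl (lset (A ++ Z) `|` [set z]) (ev u).
    have := rank1 x (N_val u) Az; apply: (cl_sub pg) => v.
    rewrite lset_cat /= => -[Av|[->|[->|[->|//]]]].
    - by apply: (cl_ext pg); left; rewrite lset_cat; left.
    - by apply: (cl_ext pg); right.
    - by apply: (cl_mono pg) cz; rewrite !lset_cat /= setU0 setUA.
    - by apply: (cl_ext pg); left; rewrite lset_cat; right; left.
  apply: (cl_mono pg) (cl_exch pg cu nuZ).
  by rewrite catA (lset_cat (A ++ Z)) /= setU0.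
have [f [Sf fZ] fab] := Nug ZA (N_val a) (N_val b) (gen a na (or_introl erefl))
  (gen b nb (or_intror (or_introl erefl))).
have fA u : lset A u -> f.2 u = u by move=> Au; apply: fZ; rewrite lset_cat; left.
have fx : f.2 x = x by apply: fZ; rewrite lset_cat; right; left.
have fy : f.2 y = y by apply: fZ; rewrite lset_cat; right; right; left.
have [s [sauto scl sE]] := St_auto (conj Sf fA) fx.
exists s; split=> //; last by apply: val_inj; rewrite sE.
move=> g tg; apply: val_inj; rewrite sE.
apply: (@fix_elt f (rcons (rcons A x) y)) => //.
- by rewrite !size_rcons sA.
- by apply/indseq_rcons; rewrite set0U; split=> //; apply/indseq_rcons; rewrite set0U.
- move=> u; rewrite !lset_rcons => -[[Au|->]|->].
  + by rewrite (NA (N_val g)) // fA.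
  + split=> //; apply: fZ; rewrite lset_cat /Z /= lset_cat lset_map.
    by right; right; right; left; exists g.
  + split=> //; apply: fZ; rewrite lset_cat /Z /= lset_cat !lset_map.
    by right; right; right; right; exists g.
Qed.

Hypothesis dimP : dim_eq_card cl.

Let infP : infinite_set [set: P].
Proof.
move=> /finite_lsetP [s sE]; have [z nz] := generic_point s.
by apply: nz; rewrite sE; apply: (cl_ext pg).
Qed.

(** A basis of [P] over [A] and [x] lifts along [ev], and localizing at finitely many points does
    not lower its cardinality. *)
Let basisM : exists2 BM : set M, basis_over clM set0 [set: M] BM & [set: P] #<= BM.
Proof.
have [B bB BP] := dimP.
have [B' [F [B'B BF [_ B'i B'sp]]]] := basis_over_lset pg (rcons A x) bB.
have PB : [set: P] #<= B.
  by have := BP; rewrite card_eq_sym card_eq_le => /andP[].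
have infB : infinite_set B by move=> fB; apply: infP; exact: card_le_finite PB fB.
have infB' : infinite_set B'.
  move=> fB'; apply: infB; apply: sub_finite_set BF _.
  by rewrite finite_setU; split=> //; exact: finite_lset.
have B'W b : B' b -> ~ cl W b.
  move=> Bb h; apply: (B'i b Bb); apply: (cl_mono pg) h; exact: subsetUl.
have /choice[l lP] : forall b, exists g : M, B' b -> ev g = b.
  move=> b; have [Bb|] := pselect (B' b); last by exists 1.
  have [|g gb] := @evK b; last by exists g.
  by move=> h; apply: (B'W b Bb); apply: (cl_mono pg) h; rewrite /W; sub.
exists (l @` B'); last first.
  apply: card_le_trans PB _; apply: card_le_trans (card_le_cofinite infB' BF) _.
  apply: (@card_le_of_inj _ _ _ _ l) => [b Bb|b c Bb Bc e]; first by exists b.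
  by rewrite -(lP _ Bb) e lP.
split=> //.
- move=> _ [b Bb <-]; rewrite /clM /pullback_cl /= set0U lP // => h.
  apply: (B'i b Bb); apply: (cl_mono pg) h => u [Wu|[g [[c Bc <-] ncb] <-]].
    by left.
  rewrite lP //; right; split=> // cb; apply: ncb; by rewrite /= cb.
- move=> g _; rewrite /clM /pullback_cl /= set0U.
  have := B'sp (ev g) I; apply: (cl_mono pg) => u [Wu|Bu]; first by left.
  by right; exists (l u); [exists u|exact: lP].
Qed.

Lemma one_action_unbounded : ~ bounded P N.
Proof.
have [BM _ PB] := basisM; move=> [_]; apply.
apply: card_le_trans PB _.
by apply: (@card_le_of_inj _ _ _ _ (fun g : M => val g)) => [g _|g h _ _ /val_inj].
Qed.

Lemma one_action_nonclassical : ~ abelian_group (sg_type N) -> nonclassical (sg_type N).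
Proof.
move=> nab; split=> //; exists L, St; split; first exact: St_expands.
have [BM bBM PB] := basisM.
have PM : [set: P] #<= [set: M] by apply: card_le_trans PB _; exact: card_leT.
split; first by move=> fM; apply: infP; exact: card_le_finite PM fM.
exists clM; split; [exact: pgM|exact: St_cl| |].
- exists BM => //; rewrite card_eq_le card_leT /=.
  have [y ny] := generic_point (rcons A x).
  (* Values at [x] and [y] determine an element of the group, so it is no larger than the square of
     [P]. *)
  apply: card_le_trans (card_le_trans (card_prod_infinite infP) PB).
  apply: (@card_le_of_inj _ _ _ _ (fun g : M => (act (val g) x, act (val g) y))) => //.
  move=> g h _ _ [ex ey]; apply: val_inj.
  apply: (@determined_list (rcons (rcons A x) y)).
  + by rewrite !size_rcons sA.
  + by apply/indseq_rcons; rewrite set0U; split=> //; apply/indseq_rcons; rewrite set0U.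
  + rewrite !map_rcons ex ey; congr (rcons (rcons _ _) _).
    by apply/map_eq_in_lset => u Au; rewrite !(NA (N_val _)).
- move=> X a b /finite_lsetP [t <-] na nb.
  exact: St_homogeneous.
Qed.

End OneAction.

(** * The hereditary hypothesis in terms of lists *)

Section Unpacking.
Variable A : seq P.
Hypothesis sA : (size A).+1 = n.
Hypothesis Ai : indseq cl set0 A.
Hypothesis hug : hereditarily_unique_generics act cl Sigma n.

Let Q : Type := loc_carrier cl (lset A).
Let clQ : set Q -> set Q := loc_cl cl (lset A).
Let valQ (q : Q) : P := val q.

Let pgQ : is_pregeometry clQ.
Proof. exact: pullback_pregeometry. Qed.

Let mkQ x : ~ cl (lset A) x -> exists q : Q, valQ q = x.
Proof. by move=> nx; exists (SigSub (mem_set nx : x \in loc_carrier cl (lset A))). Qed.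

Let indQ (X s : seq Q) : indseq cl (lset (A ++ map valQ X)) (map valQ s) ->
  indseq clQ (lset X) s.
Proof. by rewrite lset_cat lset_map => h; apply/pullback_indseq. Qed.

Let range1 (q : Q) : range (fun _ : 'I_1 => q) = [set q].
Proof. by apply/seteqP; split=> [_ [i _ <-]//|_ ->]; exists ord0. Qed.

Lemma hereditary_one_action : exists N : subgroup G,
  [/\ N `<=` pt_stab act (lset A), is_invariant Sigma (lset A) N,
    forall x y, ~ cl (lset A) x -> ~ cl (lset A) y -> exists2 g, sg_set N g & act g x = y &
    forall (Z : seq P) g h,
      (forall z, lset Z z -> ~ cl (lset A) z) -> sg_set N g -> sg_set N h ->
      (exists x, ~ cl (lset (A ++ Z)) x /\ ~ cl (lset (A ++ Z ++ [:: x])) (act g x)) ->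
      (exists x, ~ cl (lset (A ++ Z)) x /\ ~ cl (lset (A ++ Z ++ [:: x])) (act h x)) ->
      exists2 f, fixing Sigma (lset (A ++ Z)) f & f.1 g = h].
Proof.
(* The hypothesis is taken at [k = n - 1], where the subgroup has a 1-action. *)
have [_ /(_ (size A) (lset A))] := hug; rewrite -sA leqnn subSnn => /(_ isT).
have iA : independent cl (lset A) := indseq_indep_over pg Ai.
have cA : lset A #= `I_(size A) := lset_card (indseq_uniq pg Ai).
move=> /(_ iA cA) [N [[NA _] Ninv Nact _ Nug]]; exists N.
have actE := val_restr_act act_cl NA.
have mkN g : sg_set N g -> exists g' : sg_type N, val g' = g.
  move=> Ng; have Ng' : g \in sg_set N by rewrite inE.
  by exists (Sub g Ng').
have [NinvN NM] : (forall g, sg_set N g -> sg_set N g^-1) /\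
    (forall g h, sg_set N g -> sg_set N h -> sg_set N (g * h)).
  have [N1 ND] := sg_closed N.
  have inv g : sg_set N g -> sg_set N g^-1.
    by move=> Ng; rewrite -[g^-1]mul1g; exact: ND.
  by split=> // g h Ng Nh; rewrite -[h]invgK; apply: ND => //; exact: inv.
have one x z : ~ cl (lset A) x -> ~ cl (lset (A ++ [:: x])) z ->
    exists2 g, sg_set N g & act g x = z.
  move=> nx nz; have nz' : ~ cl (lset A) z.
    by move=> h; apply: nz; apply: (cl_mono pg) h; sub.
  have [qx qxE] := mkQ nx; have [qz qzE] := mkQ nz'.
  have [_ _ [tr _] _] := Nact.
  have [|g gE] := tr (fun=> qx) (fun=> qz).
    rewrite !range1 (_ : _ `|` _ = lset [:: qx; qz]); last by rewrite /= setU0.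
    apply: (@dim_over_lset _ _ pgQ _ [:: qx; qz]); apply: (@indQ [::]) => /=.
    rewrite cats0 qxE qzE; split=> //; split=> //.
    by move: nz; rewrite lset_cat /= setU0.
  exists (val g); first by have := valP g; rewrite inE.
  by rewrite -qxE -qzE -(gE ord0) /valQ actE.
split=> // [x y nx ny|Z g h ZA Ng Nh gg gh].
  (* Rank one gives transitivity on independent pairs only, so [x] and [y] are linked through a
     generic point. *)
  have [z nz] := generic_point (A ++ [:: x; y]).
  have [|g Ng gx] := one x z nx.
    by move=> h; apply: nz; apply: (cl_mono pg) h; sub.
  have [|h Nh hy] := one y z ny.
    by move=> h; apply: nz; apply: (cl_mono pg) h; sub.
  by exists (h^-1 * g); [apply: NM => //; exact: NinvN|rewrite actM gx -hy actK].
have [Zq ZqE] : exists Zq : seq Q, map valQ Zq = Z.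
  elim: Z ZA {gg gh} => [|a Z IH] ZA; first by exists [::].
  have [|Zq <-] := IH; first by move=> z Zz; apply: ZA; right.
  by have [|q <-] := @mkQ a; [apply: ZA; left|exists (q :: Zq)].
have gen (k : G) (k' : sg_type N) : val k' = k ->
    (exists x, ~ cl (lset (A ++ Z)) x /\ ~ cl (lset (A ++ Z ++ [:: x])) (act k x)) ->
    generic (restr_act act cl N (lset A)) clQ 1 (lset Zq) k'.
  move=> kE [x [nx nkx]].
  have nAx : ~ cl (lset A) x by move=> h'; apply: nx; apply: (cl_mono pg) h'; sub.
  have [q qE] := mkQ nAx; exists (fun=> q).
    split; first by move=> i j _; rewrite !ord1.
    rewrite range1 (_ : [set q] = lset [:: q]); last by rewrite /= setU0.
    apply: (indseq_indep_over pgQ); apply: (@indQ [::]) => /=.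
    by rewrite cats0 qE.
  have -> : range (restr_act act cl N (lset A) k' \o (fun _ : 'I_1 => q)) =
      [set restr_act act cl N (lset A) k' q] by exact: range1.
  rewrite range1 (_ : _ `|` _ = lset [:: q; restr_act act cl N (lset A) k' q]); last first.
    by rewrite /= setU0.
  apply: (@dim_over_lset _ _ pgQ _ [:: q; _]); apply: indQ => /=.
  rewrite ZqE /valQ actE -/(valQ q) qE kE; split=> //; split=> //.
  by move: nkx; rewrite catA [in lset (_ ++ [:: x])]lset_cat /= setU0.
have [g' g'E] := mkN g Ng; have [h' h'E] := mkN h Nh.
have e := Nug _ _ _ (finite_lset Zq) (gen g g' g'E gg) (gen h h' h'E gh).
have : tp (induced cl Sigma N (lset A)) h' (lset Zq) h'.
  have [_ S1 _ _] := autS.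
  have fix1 : fixing Sigma (lset A) (id, id) by split.
  have [v1 v2] := val_restr_auto (auto_cl S1) fix1.2 (Ninv _ fix1).
  exists (restr_auto cl N (lset A) (id, id)); last by apply: val_inj; rewrite v1.
  by split; [exists (id, id)|move=> q _; apply: val_inj; rewrite v2].
rewrite -e => -[_ [[f fA <-] ffix] fgh].
have [Sf fAA] := fA.
have [v1 v2] := val_restr_auto (auto_cl Sf) fAA (Ninv _ fA).
exists f; last by rewrite -g'E -h'E -fgh v1.
split=> // z; rewrite lset_cat -ZqE lset_map => -[Az|[q qZ <-]]; first exact: fAA.
by rewrite -[in RHS](ffix q qZ) /valQ v2.
Qed.

End Unpacking.

(** * Sharpness when the rank-one groups are abelian *)

Hypothesis n_gt0 : (0 < n)%N.
Hypothesis abN : forall A, size A = n.-1 -> indseq cl set0 A ->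
  exists N : subgroup G, [/\ N `<=` pt_stab act (lset A),
    is_invariant Sigma (lset A) N, forall g h, sg_set N g -> sg_set N h -> g * h = h * g &
    forall x y, ~ cl (lset A) x -> ~ cl (lset A) y ->
      exists2 g, sg_set N g & act g x = y].
Hypothesis ug : unique_generics act cl Sigma n.

(** In an abelian group transitive off [cl A], an element fixing one such point fixes all of them;
    together with [A] these supply the [n + 1] points that determine it. *)
Lemma abelian_transitive_regular A (N : set G) : size A = n.-1 ->
  indseq cl set0 A -> N `<=` pt_stab act (lset A) ->
  (forall g h, N g -> N h -> g * h = h * g) ->
  (forall x y, ~ cl (lset A) x -> ~ cl (lset A) y -> exists2 g, N g & act g x = y) ->
  forall g x, N g -> ~ cl (lset A) x -> act g x = x -> g = 1.
Proof.
move=> sA Ai NA Nab Ntr g x Ng Ax gx.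
have [y ny] := generic_point (A ++ [:: x]).
have Ay : ~ cl (lset A) y by move=> h; apply: ny; apply: (cl_mono pg) h; sub.
apply: (@determined_list (A ++ [:: x; y])).
- by rewrite size_cat sA addn2 prednK.
- apply/indseq_cat; rewrite set0U; split=> //=; split=> //; split=> //.
  by move=> h; apply: ny; apply: (cl_mono pg) h; sub.
rewrite map_act1; apply/map_id_lset => u; rewrite lset_cat /= => -[/(NA g Ng) //|].
case=> [->//|[->|//]]; have [h Nh <-] := Ntr _ _ Ax Ay.
by rewrite -actM Nab // actM gx.
Qed.

Lemma regularV A (N : set G) : is_subgroup N -> size A = n.-1 ->
  indseq cl set0 A -> N `<=` pt_stab act (lset A) ->
  (forall g h, N g -> N h -> g * h = h * g) ->
  (forall x y, ~ cl (lset A) x -> ~ cl (lset A) y -> exists2 g, N g & act g x = y) ->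
  forall g h x, N g -> N h -> ~ cl (lset A) x -> act g x = act h x -> g = h.
Proof.
move=> [N1 NV] sA Ai NA Nab Ntr g h x Ng Nh Ax e.
have NVh : N h^-1 by rewrite -[h^-1]mul1g; exact: NV.
have Nhg : N (h^-1 * g).
  by rewrite -[g]invgK; apply: (NV) => //; rewrite -[g^-1]mul1g; exact: NV.
apply: (mulgI h^-1); rewrite mulVg.
by apply: (abelian_transitive_regular sA Ai NA Nab Ntr Nhg Ax); rewrite actM e actK.
Qed.

(* [T] is a product of the groups [N] of [abN], one for each point of [x]. *)
Lemma transversal x A : indseq cl set0 (A ++ x) -> size (A ++ x) = n ->
  exists (F : seq P) (T : set G),
  [/\ forall f (t : G), fixing Sigma (lset F) f -> T t -> T (f.1 t),
      forall (t : G) a, T t -> lset A a -> act t a = a,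
      forall (t t' : G), T t -> T t' -> map (act t) x = map (act t') x -> t = t' &
      forall y, size y = size x -> indseq cl (lset F) y ->
        exists2 t : G, T t & map (act t) x = y].
Proof.
elim: x A => [|x1 x IH] A Axi Axs.
  exists [::], [set 1]; split=> /=.
  - by move=> f t [Sf _] ->; rewrite auto1.
  - by move=> t a -> _; rewrite act1.
  - by move=> t t' -> ->.
  - by case=> // _ _; exists 1.
have [||F' [T' [Tinv TA Tuniq Tex]]] := IH (rcons A x1).
- by rewrite cat_rcons.
- by rewrite cat_rcons.
have /indseq_cat[Ai /= [Ax1 xi]] := Axi.
have Axs' : (size A + (size x).+1 = n)%N by rewrite -Axs size_cat.
(* [U] pads [A] to [n - 1] points, the size at which [abN] provides a group, and keeps [x1] outside
   the closure. *)
have [U Ui sU] := generic_list (size x) (finite_lset (rcons A x1)).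
have AUi : indseq cl set0 (rcons (A ++ U) x1).
  apply: (@indseq_perm _ _ pg _ (rcons A x1 ++ U)).
  - by move=> u; rewrite ?(lset_cat,lset_rcons) /= /setU; tauto.
  - by rewrite size_rcons !size_cat size_rcons addSn.
  - apply: indseq_cat_generic => //; apply/indseq_rcons; by split.
have AUs : size (rcons (A ++ U) x1) = n.
  by rewrite size_rcons size_cat sU -addnS.
have [AUi' nx1] := proj1 (indseq_rcons _ _ _ _) AUi; rewrite set0U in nx1.
have AUs' : size (A ++ U) = n.-1 by rewrite -AUs size_rcons.
have [N [NA Ninv Nab Ntr]] := abN AUs' AUi'.
have Nreg := regularV (sg_closed N) AUs' AUi' NA Nab Ntr.
(* The factor [t] fixes [x1] and places the tail, then [u] places [x1]. So the image of [x1]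
   determines [u], and the rest determines [t]. *)
exists (F' ++ rcons (A ++ U) x1),
  [set g | exists (u t : G), [/\ sg_set N u, T' t & g = u * t]].
split.
- move=> f t [Sf ff] [u [t' [Nu Tt' ->]]]; exists (f.1 u), (f.1 t'); split.
  + rewrite -(Ninv f); first by exists u.
    split=> // a Aa; apply: ff; by rewrite lset_cat lset_rcons; right; left.
  + by apply: Tinv => //; split=> // a Fa; apply: ff; rewrite lset_cat; left.
  + exact: autoM.
- move=> _ a [u [t [Nu Tt ->]]] Aa; rewrite actM (TA t) //; last first.
    by rewrite lset_rcons; left.
  by apply: NA => //; rewrite lset_cat; left.
- move=> _ _ [u [t [Nu Tt ->]]] [u' [t' [Nu' Tt' ->]]] /= [].
  have Ax1' : lset (rcons A x1) x1 by rewrite lset_rcons; right.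
  rewrite !actM (TA t) // (TA t') // => /(Nreg _ _ _ Nu Nu' nx1) -> e; congr (_ * _).
  apply: Tuniq => //; have := congr1 (map (act u'^-1)) e.
  by rewrite !map_actM !map_actK.
- case=> [//|y1 y] /= [sy] [ny1 yi].
  have AUy1 : ~ cl (lset (A ++ U)) y1.
    by move=> h; apply: ny1; apply: (cl_mono pg) h; sub.
  have [u Nu uy] := Ntr _ _ nx1 AUy1.
  have [||t Tt ty] := Tex (map (act u^-1) y).
  + by rewrite size_map.
  + apply/(preserves_cl_indseq _ _ (act_cl u)).
    rewrite -map_comp (_ : map _ y = y); last first.
      by apply/map_id_lset => z _ /=; rewrite actKV.
    (* By [rank_closure], [u] carries [F'] into the closure of [F'], the padded list and [y1], over
       which [y] is independent. *)
    apply: indseq_mono yi => // _ [z Fz <-].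
    have := rank_closure u z AUs AUi; apply: (cl_mono pg).
    rewrite map_rcons (proj2 (map_id_lset (act u) _)); last by move=> a; exact: NA.
    rewrite uy; sub.
  exists (u * t); first by exists u, t.
  rewrite /= !actM (TA t) //; last by rewrite lset_rcons; right.
  rewrite uy map_actM ty; congr (_ :: _).
  by rewrite -map_comp map_id_lset => z _ /=; rewrite actKV.
Qed.

(** For [z] generic over everything in sight, [rank_closure] puts [t] in the closure of [s], [z] and
    [g z]. As [t] is independent over [F], [s], [z], counting makes [g z] independent over them
    too. *)
Lemma rank_generic F s t g : size s = n -> indseq cl set0 s ->
  map (act g) s = t -> indseq cl (lset (F ++ s)) t -> generic act cl n (lset F) g.
Proof.
move=> ss si gs ti; have [z zi sz] := generic_list n (finite_lset (F ++ s ++ t)).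
have [x0] := point0; have st : size t = n by rewrite -gs size_map.
exists (fun i => nth x0 z i).
  have zi0 : indseq cl set0 z by apply: indseq_sub zi.
  split; last by rewrite range_nth //; exact: indseq_indep_over zi0.
  move=> i j e; apply/val_inj/eqP.
  rewrite -(@nth_uniq {classic P} x0 z) ?sz ?(indseq_uniq pg zi0) //;
    [exact/eqP|exact: ltn_ord|exact: ltn_ord].
have -> : range (act g \o (fun i : 'I_n => nth x0 z i)) = lset (map (act g) z).
  by rewrite lset_map -(range_nth x0 sz) image_comp.
rewrite range_nth // -lset_cat mul2n -addnn.
have -> : (n + n)%N = size (z ++ map (act g) z) by rewrite size_cat size_map sz.
apply: dim_over_lset => //.
suff h : indseq cl (lset F `|` lset s `|` lset z) (map (act g) z).
  apply/indseq_cat; split; first by apply: indseq_sub zi => //; sub.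
  by apply: indseq_sub h => //; sub.
apply: (@indseq_span _ _ pg _ t); last by rewrite size_map sz st.
  have : indseq cl (lset (F ++ s)) (t ++ z).
    by apply/indseq_cat; split=> //; apply: indseq_sub zi => //; sub.
  by move=> /(indseq_swap pg) /indseq_cat[_]; rewrite lset_cat.
have zi0 : indseq cl set0 z by apply: indseq_sub zi.
move=> y; rewrite -gs lset_map => -[x sx <-].
have := rank_closure g x sz zi0; apply: (cl_mono pg); sub.
Qed.

(* If [g] fixes [s] then [t] and [t * g] are both generic; the invariant set [T]
   contains one of them, hence both. *)
Theorem sharp s g : size s = n -> indseq cl set0 s -> map (act g) s = s -> g = 1.
Proof.
move=> ss si gs.
have [F [T [Tinv _ Tuniq Tex]]] := @transversal s [::] si ss.
have [y yi sy] := generic_list n (finite_lset (F ++ s)).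
have [||t Tt ty] := Tex y; first by rewrite sy ss.
  by apply: indseq_sub yi => //; sub.
have tg : map (act (t * g)) s = y by rewrite map_actM gs.
have := ug (finite_lset F) (rank_generic ss si tg yi) (rank_generic ss si ty yi).
move=> e; have : tp Sigma t (lset F) (t * g).
  rewrite -e; exists (id, id) => //; split=> //.
  by have [_ ? _ _] := autS.
move=> [f ff etg]; have Ttg : T (t * g) by rewrite -etg; exact: Tinv.
apply: (mulgI t); rewrite mulg1; apply: Tuniq => //.
by rewrite tg ty.
Qed.

Lemma sharp_eq s g h : size s = n -> indseq cl set0 s ->
  map (act g) s = map (act h) s -> g = h.
Proof.
move=> ss si e; apply: (mulgI h^-1); rewrite mulVg; apply: (sharp ss si).
by rewrite map_actM e map_actK.
Qed.

(** Sharpness makes the whole stabilizer act freely off [cl A], where its abelian subgroup from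
    [abN] is already transitive; so the two coincide. *)
Lemma stab_abelian A : size A = n.-1 -> indseq cl set0 A ->
  [/\ forall g h, pt_stab act (lset A) g -> pt_stab act (lset A) h -> g * h = h * g,
    forall x y, ~ cl (lset A) x -> ~ cl (lset A) y ->
      exists2 g, pt_stab act (lset A) g & act g x = y &
    forall g x, pt_stab act (lset A) g -> ~ cl (lset A) x -> act g x = x -> g = 1].
Proof.
move=> sA Ai; have [N [NA Ninv Nab Ntr]] := abN sA Ai.
have reg g x : pt_stab act (lset A) g -> ~ cl (lset A) x -> act g x = x -> g = 1.
  move=> gA Ax gx; apply: (@sharp (rcons A x)).
  - by rewrite size_rcons sA prednK.
  - by apply/indseq_rcons; rewrite set0U.
  - by rewrite map_rcons gx; congr rcons; apply/map_id_lset.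
have AN : pt_stab act (lset A) `<=` N.
  move=> g gA; have [x Ax] := generic_point A.
  have Agx : ~ cl (lset A) (act g x).
    move=> h; apply: Ax; apply/(act_cl g); rewrite image_fix //.
  have [h Nh hx] := Ntr _ _ Ax Agx.
  suff -> : g = h by [].
  apply: (mulgI h^-1); rewrite mulVg; apply: (reg _ x) => //.
    by move=> a Aa; rewrite actM gA // -{1}(NA _ Nh a Aa) actK.
  by rewrite actM -hx actK.
split=> //; first by move=> g h /AN Ng /AN Nh; exact: Nab.
by move=> x y Ax Ay; have [g Ng e] := Ntr _ _ Ax Ay; exists g => //; exact: NA.
Qed.

Lemma auto_fix f s g : Sigma f -> size s = n -> indseq cl set0 s ->
  (forall x, lset s x -> f.2 x = x /\ f.2 (act g x) = act g x) -> f.1 g = g.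
Proof.
move=> Sf ss si fixs; apply: (sharp_eq ss si); apply/map_eq_in_lset => x sx.
by have [e <-] := fixs _ sx; rewrite auto_act // e.
Qed.

Hypothesis cl0 : cl set0 = set0.

Lemma transitive1 : n = 1%N ->
  abelian_group G /\ regular_action act.
Proof.
move=> n1; have [|//|Gab Gtr Greg] := @stab_abelian [::]; first by rewrite n1.
have S0 g : pt_stab act (lset [::]) g by [].
have cl0P x : ~ cl (lset [::]) x by rewrite /= cl0.
split=> [g h|x y]; first exact: Gab.
have [g _ gx] := Gtr x y (cl0P x) (cl0P y); exists g; split=> // h hx.
apply: (mulgI h^-1); rewrite mulVg; apply: (Greg _ x) => //.
by rewrite actM gx -hx actK.
Qed.

(** * Closure is trivial on fewer than [n] points *)

Section GreaterRank.
Hypothesis n_gt1 : (1 < n)%N.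

(* Take [d] fixing [B] and a generic [x] with [d y = y']. As [pt_stab] of [B, x] is
   abelian, [d] preserves every [cl (B, w)]; so [d] is determined by values in
   [cl (B, w1, w2)] and fixes every conjugate of [x] over them. *)
Lemma closure_rcons B y y' : size B = n.-2 -> indseq cl set0 (rcons B y) ->
  cl (lset (rcons B y)) y' -> ~ cl (lset B) y' -> y' = y.
Proof.
move=> sB Byi cy' ny'; have /indseq_rcons[Bi] := Byi; rewrite set0U => ny.
have nE : n = (size B).+2 by rewrite sB; case: n n_gt1 => [|[|]].
have [x nx] := generic_point (rcons B y).
have By : lset B `<=` lset (rcons B y) by sub.
have nBx : ~ cl (lset B) x by move=> h; apply: nx; apply: (cl_mono pg) h.
pose A := rcons B x.
have Ai : indseq cl set0 A by apply/indseq_rcons; rewrite set0U.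
have sA : size A = n.-1 by rewrite size_rcons nE.
have AE : lset A = lset B `|` [set x] by exact: lset_rcons.
have ByE : lset (rcons B y) = lset B `|` [set y].
  exact: lset_rcons.
have nAy z : cl (lset (rcons B y)) z -> ~ cl (lset B) z -> ~ cl (lset A) z.
  rewrite AE => h1 h2 h3; have := cl_exch pg h3 h2; move=> h4; apply: nx.
  apply: (clU_sub pg) h4; first by move=> b /By /(cl_ext pg).
  by move=> _ ->.
have [Aab Atr Areg] := stab_abelian sA Ai.
have Ay : ~ cl (lset A) y.
  by apply: nAy => //; apply: (cl_ext pg); rewrite ByE; right.
have [d Ad dy] := Atr _ _ Ay (nAy _ cy' ny').
(* An [h] in the abelian stabilizer taking [y] to [w] commutes with [d], so it carries the relation
   between [y] and [d y] to [w] and [d w]. *)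
have dline w : ~ cl (lset A) w -> cl (lset B `|` [set w]) (act d w).
  move=> Aw; have [h Ah hy] := Atr _ _ Ay Aw.
  rewrite -hy -actM Aab // actM dy -(@image_fix _ (act h) (lset B)); last first.
    by move=> b Bb; apply: Ah; rewrite AE; left.
  by rewrite -image_set1 -image_setU -ByE -(act_cl h).
have [w1 nw1] := generic_point A.
have [w2 nw2] := generic_point (rcons A w1).
have nw2' : ~ cl (lset A) w2.
  by move=> h; apply: nw2; apply: (cl_mono pg) h; sub.
pose W := B ++ [:: w1; w2].
have Wi : indseq cl set0 (rcons W x).
  apply: (@indseq_perm _ _ pg _ (rcons (rcons A w1) w2)).
  - by move=> u; rewrite /A /W ?(lset_cat, lset_rcons) /= /setU; tauto.
  - by rewrite /A /W !size_rcons size_cat /= addn2.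
  - by apply/indseq_rcons; rewrite set0U; split=> //; apply/indseq_rcons; rewrite set0U.
have /indseq_rcons[Wi' ] := Wi; rewrite set0U => nWx.
have sW : size W = n by rewrite size_cat /= nE addn2.
pose Z := W ++ [:: act d w1; act d w2].
(* By [dline] the images of [w1] and [w2] add nothing, so [x] stays generic over [Z]. *)
have ZW : cl (lset Z) `<=` cl (lset W).
  rewrite /Z lset_cat; apply: (clU_sub pg); first exact: (cl_ext pg).
  have h w : ~ cl (lset A) w -> lset W w -> cl (lset W) (act d w).
    move=> /dline + Ww; apply: (cl_mono pg) => u [Bu|->//].
    by rewrite /W lset_cat; left.
  by move=> u /= [->|[->|//]]; apply: h => //; rewrite /W; inl.
have [x' nx'] := generic_point (rcons W x).
have nWx' : ~ cl (lset W) x'.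
  by move=> h; apply: nx'; apply: (cl_mono pg) h; sub.
have [f [Sf fZ] fx] := fixing1 (finite_lset Z) (fun c => nWx (ZW _ c))
  (fun c => nWx' (ZW _ c)).
have fd : f.1 d = d.
  apply: (auto_fix Sf sW Wi') => u; rewrite /W lset_cat => -[Bu|].
    rewrite Ad; last by rewrite AE; left.
    by split; apply: fZ; rewrite /Z /W !lset_cat; left; left.
  by case=> [->|[->|//]]; split; apply: fZ; rewrite /Z /W; inl.
(* As [f] fixes [d] and takes [x] to [x'], the point [x'] is fixed as well; with [B] and [x] this
   makes [n] independent fixed points. *)
have dx' : act d x' = x'.
  by rewrite -fx -fd -auto_act // Ad // AE; right.
have d1 : d = 1.
  apply: (@sharp (rcons A x')).
  - by rewrite size_rcons sA nE.
  - apply/indseq_rcons; rewrite set0U; split=> // h; apply: nx'.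
    apply: (cl_mono pg) h; rewrite /A /W; sub.
  - by rewrite map_rcons dx'; congr rcons; apply/map_id_lset.
by rewrite -dy d1 act1.
Qed.

(** The points of [A] are discarded one by one from a closure containing [u]: a point that cannot be
    discarded is interchangeable with [u] over the others, so it equals [u] by [closure_rcons]. At
    the end [u] would lie in [cl set0]. *)
Lemma closure_small A : size A = n.-1 -> indseq cl set0 A -> cl (lset A) `<=` lset A.
Proof.
move=> sA Ai u cu; apply: contrapT => nu.
suff h s t : A = s ++ t -> cl (lset t) u.
  by have := h A [::]; rewrite cats0 /= cl0; apply.
elim/last_ind: s t => [|s y IH] t; first by rewrite /= => <-.
rewrite cat_rcons => eA; have cytu := IH _ eA; apply: contrapT => ntu.
have sti : indseq cl set0 (rcons (s ++ t) y).
  apply: (indseq_perm pg _ _ Ai); first by rewrite eA; sub.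
  by rewrite eA size_rcons !size_cat /= addnS.
have nst : ~ cl (lset (s ++ t)) u.
  move=> cst; have /indseq_rcons[_] := sti; rewrite set0U; apply.
  have h := cl_exch pg (a := u) (b := y) (X := lset t).
  have {}h : cl (lset t `|` [set u]) y.
    apply: h => //; apply: (cl_mono pg) cytu; sub.
  apply: (clU_sub pg) h; last by move=> _ ->.
  by move=> x tx; apply: (cl_ext pg); inl.
apply: nu; rewrite eA; suff -> : u = y by inl.
apply: (closure_rcons _ sti) => //.
  by move: sA; rewrite eA !size_cat /= addnS; case: n n_gt1 => [|[|k]] //= _ [].
by apply: (cl_mono pg) cu; rewrite eA; sub.
Qed.

(** Padding with generic points to length [n - 1] makes [closure_small] applicable to a point
    dependent on [s]. *)
Lemma uniq_indseq s : uniq (s : seq {classic P}) -> (size s <= n)%N ->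
  indseq cl set0 s.
Proof.
elim/last_ind: s => [//|s a IH]; rewrite rcons_uniq => /andP[/negP nas us].
rewrite size_rcons => lt; have si := IH us (ltnW lt).
apply/indseq_rcons; rewrite set0U; split=> // ca.
have [z zi sz] := generic_list (n.-1 - size s) (finite_lset (rcons s a)).
have Ai : indseq cl set0 (s ++ z).
  by apply: indseq_cat_generic => //; apply: indseq_sub zi => //; sub.
have sA : size (s ++ z) = n.-1.
  by rewrite size_cat sz subnKC // -ltnS prednK.
have := @closure_small _ sA Ai a; rewrite lset_cat; case.
- by apply: (cl_mono pg) ca; sub.
- by move=> /(@lsetP {classic P}).
- by move: zi; rewrite lset_rcons; exact: indseq_notin.
Qed.

Lemma sharply_transitive s t : uniq (s : seq {classic P}) ->
  uniq (t : seq {classic P}) -> size s = n -> size t = n ->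
  exists g, map (act g) s = t.
Proof.
move=> us ut ss st; apply: act_trans => //; apply: uniq_indseq => //.
  by rewrite ss.
by rewrite st.
Qed.

Lemma sharply s g : uniq (s : seq {classic P}) -> size s = n ->
  map (act g) s = s -> g = 1.
Proof. by move=> us ss; apply: sharp => //; apply: uniq_indseq; rewrite ?ss. Qed.

Lemma finite_fix g : g <> 1 -> exists L, forall x, act g x = x -> lset L x.
Proof.
move=> ng; apply: contrapT => /forallNP h; apply: ng.
suff [s [us ss fs]] : exists s, [/\ uniq (s : seq {classic P}), size s = n &
    map (act g) s = s] by exact: (@sharply s).
elim: {1}n => [|k [s [us ss fs]]]; first by exists [::].
have /existsNP[x /not_implyP[gx nx]] := h s.
exists (x :: s); split=> /=; last by rewrite gx fs.
  by rewrite us andbT; apply/negP => /(@lsetP {classic P}).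
by rewrite ss.
Qed.

(** * Rank at least four is impossible *)

Section RankFour.
Hypothesis n_gt3 : (3 < n)%N.

Lemma rank_four : False.
Proof.
have [q qi sq] := generic_list n (finite_lset (Nil P)).
have {qi sq} [A [a [b [c [d [qi sA]]]]]] : exists A a b c d,
    indseq cl set0 (A ++ [:: a; b; c; d]) /\ size A = (n - 4)%N.
  have e : size (drop (n - 4) q) = 4 by rewrite size_drop sq subKn.
  have e' : size (take (n - 4) q) = (n - 4)%N by rewrite size_takel // sq leq_subr.
  exists (take (n - 4) q).
  case eq : (drop (n - 4) q) e => [|a [|b [|c [|d [|//]]]]] // _.
  by exists a, b, c, d; rewrite -eq cat_take_drop.
have nE : n = (size A + 4)%N by rewrite sA subnK.
pose C := A ++ [:: a; b; c].
have CE : A ++ [:: a; b; c; d] = rcons C d by rewrite /C rcons_cat.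
have /indseq_rcons[Ci] : indseq cl set0 (rcons C d) by rewrite -CE.
rewrite set0U => nCd.
have sC : size C = n.-1 by rewrite /C size_cat nE /= !addnS.
have sCd : size (rcons C d) = n by rewrite -CE size_cat nE.
have Cdi : indseq cl set0 (rcons C d) by rewrite -CE.
have [Nab Ntr Nreg] := stab_abelian sC Ci.
pose N := pt_stab act (lset C).
have NM g h : N g -> N h -> N (g * h).
  by move=> Ng Nh x Cx; rewrite actM Nh // Ng.
have NV g : N g -> N g^-1.
  by move=> Ng x Cx; rewrite -[in LHS](Ng x Cx) actK.
have Nuniq g h : N g -> N h -> act g d = act h d -> g = h.
  move=> Ng Nh e; apply: (mulgI h^-1); rewrite mulVg; apply: (Nreg _ d) => //.
    by apply: NM => //; exact: NV.
  by rewrite actM e actK.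
have /choice[m mP] : forall x, exists g, ~ cl (lset C) x -> N g /\ act g d = x.
  move=> x; have [Cx|Cx] := pselect (cl (lset C) x); first by exists 1.
  by have [g Ng gd] := Ntr _ _ nCd Cx; exists g.
(* The elements [m x * m (f x)] are fixed by the involution [f], hence lie in
   a finite set, hence do not depend on the generic point [x]. *)
have conjM (f g h : G) : f * (g * h) * f^-1 = f * g * f^-1 * (f * h * f^-1).
  by rewrite !mulgA mulgVK.
have conjV (f g : G) : f * g^-1 * f^-1 = (f * g * f^-1)^-1.
  by rewrite !invgM invgK mulgA.
have inverts (f : G) : f <> 1 -> act f d = d -> act f @` lset C = lset C ->
    (forall x, lset C x -> act f (act f x) = x) ->
    exists L, forall x y, ~ cl (lset (rcons C d ++ L)) x ->
      ~ cl (lset (rcons C d ++ L)) y ->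
      f * ((m x)^-1 * m y) * f^-1 = ((m x)^-1 * m y)^-1.
  move=> nf fd fC ffC.
  have ff : f * f = 1.
    apply: (sharp sCd Cdi); rewrite map_rcons actM !fd; congr rcons.
    by apply/map_id_lset => x Cx; rewrite actM ffC.
  have fV : f^-1 = f by apply: (mulgI f); rewrite mulgV ff.
  have ffx x : act f (act f x) = x by rewrite -actM ff act1.
  have NJ g : N g -> N (f * g * f^-1).
    move=> Ng x Cx; rewrite fV !actM Ng ?ffx //.
    by rewrite -fC; exists x.
  have Cf x : ~ cl (lset C) x -> ~ cl (lset C) (act f x).
    by move=> nx; rewrite -fC -(act_cl f).
  have mf x : ~ cl (lset C) x -> f * m x * f^-1 = m (act f x).
    move=> Cx; have [Nx xd] := mP x Cx; have [Nfx fxd] := mP _ (Cf _ Cx).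
    apply: Nuniq => //; first exact: NJ.
    by rewrite fxd fV !actM fd xd.
  have [L fixL] := finite_fix nf; exists L.
  have LC x : ~ cl (lset (rcons C d ++ L)) x -> ~ cl (lset C) x.
    by move=> nx c'; apply: nx; apply: (cl_mono pg) c'; sub.
  have wfix x : ~ cl (lset C) x -> f * (m x * m (act f x)) * f^-1 = m x * m (act f x).
    move=> Cx; rewrite conjM !mf //; last exact: Cf.
    rewrite ffx; apply: Nab; [exact: (mP _ (Cf _ Cx)).1|exact: (mP x Cx).1].
  have wL x : ~ cl (lset C) x -> lset L (act (m x * m (act f x)) d).
    by move=> Cx; apply: fixL; rewrite -[in RHS]wfix // fV !actM fd.
  move=> x y nx ny.
  have Cx := LC _ nx; have Cy := LC _ ny.
  have [Nx xd] := mP x Cx; have [Nfx fxd] := mP _ (Cf _ Cx).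
  have [Ny yd] := mP y Cy; have [Nfy fyd] := mP _ (Cf _ Cy).
  have [s [Ss sL] sx] := fixing1 (finite_lset _) nx ny.
  have sC' u : lset C u -> s.2 u = u.
    by move=> Cu; apply: sL; rewrite lset_cat lset_rcons; left; left.
  have sd : s.2 d = d by apply: sL; rewrite lset_cat lset_rcons; left; right.
  have sf : s.1 f = f.
    apply: (auto_fix Ss sCd Cdi) => u; rewrite lset_rcons => -[Cu|->].
      by split; apply: sC' => //; rewrite -fC; exists u.
    by rewrite fd sd.
  have sN g : N g -> N (s.1 g).
    by move=> Ng u Cu; rewrite -{1}(sC' _ Cu) -auto_act // Ng // sC'.
  have sm u : ~ cl (lset C) u -> ~ cl (lset C) (s.2 u) -> s.1 (m u) = m (s.2 u).
    move=> Cu Csu; have [Nu ud] := mP u Cu; have [Nsu sud] := mP _ Csu.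
    by apply: Nuniq => //; [exact: sN|rewrite sud -{1}sd -auto_act // ud].
  have sfx : s.2 (act f x) = act f y by rewrite auto_act // sf sx.
  (* The automorphism takes the first product to the second, but it fixes the value of the first at
     [d], which lies in [L]; so both are equal. *)
  have ws : m x * m (act f x) = m y * m (act f y).
    have : s.1 (m x * m (act f x)) = m y * m (act f y).
      rewrite autoM // sm // ?sx // sm // ?sfx //; exact: Cf.
    move=> <-; apply: Nuniq; [exact: NM|by apply: sN; exact: NM|].
    by rewrite -{2}sd -auto_act // sL // lset_cat; right; exact: wL.
  have com g h : N g -> N h -> g * h = h * g := Nab g h.
  have e : m (act f y) = (m y)^-1 * m x * m (act f x).
    by rewrite -mulgA ws mulKg.
  rewrite conjM conjV !mf // e [_ * m (act f x)]com ?mulKg ?invgM ?invgK //.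
  by apply: NM => //; exact: NV.
have ai s : lset (A ++ [:: a; b; c; d]) `<=` lset s ->
    size s = size (A ++ [:: a; b; c; d]) -> indseq cl set0 s.
  by move=> h e; apply: (indseq_perm pg h) => //; rewrite e.
have sA4 (u v w x : P) : size (A ++ [:: u; v; w; x]) = n by rewrite size_cat nE.
have [|f fE] := act_trans (sA4 a b c d) (sA4 b a c d) qi.
  by apply: ai; [sub|rewrite !sA4].
have [|h hE] := act_trans (sA4 a b c d) (sA4 a c b d) qi.
  by apply: ai; [sub|rewrite !sA4].
move: fE hE; rewrite !map_cat => /cat_inj[|/map_id_lset fA [fa fb fc fd]].
  by rewrite size_map.
move=> /cat_inj[|/map_id_lset hA [ha hb hc hd]]; first by rewrite size_map.
have := indseq_uniq pg Cdi.
rewrite rcons_uniq /C cat_uniq /= !inE => /and5P[_ _ _ + /andP[/eqP bc _]].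
rewrite negb_or => /andP[/eqP ab /eqP ac].
have fC x : lset C x -> lset C (act f x) /\ act f (act f x) = x.
  rewrite /C !lset_cat => -[Ax|/= [->|[->|[->|//]]]].
  - by rewrite !fA //; split=> //; left.
  - by rewrite fa fb; split=> //; inl.
  - by rewrite fb fa; split=> //; inl.
  - by rewrite fc fc; split=> //; inl.
have [|||L1 L1P] := inverts f _ fd.
- by move=> e; apply: ab; rewrite -fa e act1.
- apply/seteqP; split=> [_ [x Cx <-]|x Cx]; first exact: (fC x Cx).1.
  by exists (act f x); [exact: (fC x Cx).1|exact: (fC x Cx).2].
- by move=> x Cx; exact: (fC x Cx).2.
have hC x : lset C x -> lset C (act h x) /\ act h (act h x) = x.
  rewrite /C !lset_cat => -[Ax|/= [->|[->|[->|//]]]].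
  - by rewrite !hA //; split=> //; left.
  - by rewrite ha ha; split=> //; inl.
  - by rewrite hb hc; split=> //; inl.
  - by rewrite hc hb; split=> //; inl.
have [|||L2 L2P] := inverts h _ hd.
- by move=> e; apply: bc; rewrite -hb e act1.
- apply/seteqP; split=> [_ [x Cx <-]|x Cx]; first exact: (hC x Cx).1.
  by exists (act h x); [exact: (hC x Cx).1|exact: (hC x Cx).2].
- by move=> x Cx; exact: (hC x Cx).2.
(* One point is the reference [p0]; the other four complete [A], of size [n - 4], to [n] fixed
   points of [k]. *)
have [r ri] := generic_list 5 (finite_lset (rcons C d ++ L1 ++ L2)).
case: r ri => [|p0 r] //= [np0 ri] [sr].
(* A 3-cycle on [a], [b], [c]. Inverting twice, it centralizes the elements [(m p0)^-1 * m x], and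
   so fixes their values at [d]. *)
pose k := h * f.
have kA x : lset A x -> act k x = x by move=> Ax; rewrite actM fA // hA.
suff k1 : k = 1.
  by apply: ac; rewrite -hb -fa -actM -/k k1 act1.
have nC0 x : ~ cl (lset (rcons C d ++ L1 ++ L2)) x ->
    [/\ ~ cl (lset (rcons C d ++ L1)) x, ~ cl (lset (rcons C d ++ L2)) x &
        ~ cl (lset C) x].
  by move=> nx; split=> c'; apply: nx; apply: (cl_mono pg) c' => u;
    rewrite !(lset_cat (rcons C d)) !lset_rcons ?(lset_cat L1) /setU /mkset; tauto.
have rP x : lset r x -> ~ cl (lset (rcons C d ++ L1 ++ L2)) x.
  move=> rx; have : indseq cl (lset (rcons C d ++ L1 ++ L2)) r.
    by apply: indseq_sub ri => //; sub.
  by move=> /(indseq_mem pg) /(_ _ rx).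
have [np1 np2 npC] := nC0 _ np0.
have [N0 p0d] := mP _ npC.
pose g x := act (m p0)^-1 x.
have kg x : lset r x -> act k (g x) = g x.
  move=> rx; have [nx1 nx2 nxC] := nC0 _ (rP _ rx).
  have [Nx xd] := mP _ nxC.
  have [np01 np02 _] := nC0 _ np0.
  have e1 := L1P _ _ np01 nx1; have e2 := L2P _ _ np02 nx2.
  pose q' := (m p0)^-1 * m x; rewrite -/q' in e1 e2.
  have kr : k * q' = q' * k.
    apply: (mulIg k^-1); rewrite mulgK invgM.
    have -> : k * q' * (f^-1 * h^-1) = h * (f * q' * f^-1) * h^-1 by rewrite !mulgA.
    by rewrite e1 conjV e2 invgK.
  have -> : g x = act q' d by rewrite actM xd.
  by rewrite -actM kr !actM fd hd.
apply: (@sharply (A ++ map g r)).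
- rewrite cat_uniq; apply/and3P; split.
  + have := indseq_uniq pg qi; by rewrite cat_uniq => /and3P[].
  + apply/hasPn => x /(@lsetP {classic P}); rewrite lset_map => -[y ry <-].
    apply/negP => /(@lsetP {classic P}) Agy.
    have [_ _ nyC] := nC0 _ (rP _ ry); apply: nyC; apply: (cl_ext pg).
    have : lset C (g y) by rewrite /C lset_cat; left.
    by move=> Cgy; rewrite -(actKV (m p0) y) N0.
  + rewrite (@map_inj_uniq {classic P} {classic P}); last exact: act_inj.
    exact: (indseq_uniq pg ri).
- by rewrite size_cat size_map sr.
- rewrite map_cat; congr (_ ++ _); first by apply/map_id_lset.
  by rewrite -map_comp; apply/map_eq_in_lset => x /kg.
Qed.
End RankFour.
End GreaterRank.

(** * Rank two: the affine group *)

Lemma uniq2 (a b : P) : a <> b -> uniq ([:: a; b] : seq {classic P}).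
Proof. by move=> h; rewrite /= inE andbT; apply/negP => /eqP. Qed.

Lemma infinite_points s : exists x, ~ lset s x.
Proof.
by have [x nx] := generic_point s; exists x => sx; apply: nx; exact: (cl_ext pg).
Qed.

Lemma act_faithful g : (forall x, act g x = x) -> g = 1.
Proof.
move=> h; have [s si ss] := generic_list n (finite_set0 P).
by apply: (sharp ss si); apply/map_id_lset => x _; exact: h.
Qed.

Lemma rank_two : n = 2 -> exists K : closedFieldType,
  isomorphic_actions act (@aff_act K).
Proof.
move=> n2; have n1 : (1 < n)%N by rewrite n2.
have [s si ss] := generic_list 2 (finite_set0 P).
case: s si ss => [|o [|e [|//]]] //= [_ [noe _]] _.
have oe : o <> e by move=> h; apply: noe; rewrite h; apply: (cl_ext pg); right.
have [||||K [f [fbij f0 f1 gaff affg]]] :=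
  @sharply_2_transitive_field G P act _ _ _ _ infinite_points o e oe.
- by case: nact.
- move=> a b c d ab cd.
  have [||g [ga gb]] := sharply_transitive n1 (uniq2 ab) (uniq2 cd); rewrite ?n2 //.
  by exists g.
- move=> g a b ab ga gb; apply: (sharply n1 (uniq2 ab)); rewrite ?n2 //=.
  by rewrite ga gb.
- move=> a g h ga ha; have [||Gab _ _] := @stab_abelian [:: a].
  + by rewrite n2.
  + by apply: (uniq_indseq n1) => //; rewrite n2.
  + by apply: Gab => x /= [->|//].
have [f' fK f'K] := fbij.
have [p|C CE] := @closedFieldType_of_roots K.
  (* The chart covers all of [P], and its affine maps come from the whole group. *)
  apply: (@chart_closed K f' [:: o; e] setT) => //.
  - exact: can_inj f'K.
  - by left; rewrite -f0 fK.
  - by right; left; rewrite -f1 fK.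
  - by move=> s k _; exists (f (s.2 (f' k))); rewrite fK.
  - by move=> x _; exists (f x); rewrite fK.
  - move=> g _; have [a [b [a0 gE]]] := gaff g; exists a, b; split=> // k.
    by apply: (can_inj fK); rewrite gE !f'K.
  - move=> a b a0; have [g gE] := affg a b a0; exists g => // k.
    by apply: (can_inj fK); rewrite gE !f'K.
subst K; exists C; apply: (isomorphic_by_bijection (f := f)) => //.
- by case: nact.
- exact: aff_actP.
- exact: act_faithful.
- exact: aff_act_faithful.
- move=> g; have [a [b [a0 gE]]] := gaff g.
  have ua : (a : C) \is a GRing.unit by rewrite unitfE.
  by exists (b, Sub a ua) => x; rewrite gE.
- move=> [b a]; have a0 : val a != 0%R by rewrite -unitfE; exact: (valP a).
  by have [g gE] := affg (val a) b a0; exists g => x; rewrite gE.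
Qed.

Lemma uniq3 (a b c : P) : a <> b -> a <> c -> b <> c ->
  uniq ([:: a; b; c] : seq {classic P}).
Proof.
move=> ab ac bc; rewrite /= !inE andbT negb_or; apply/andP; split; last first.
  by apply/negP => /eqP.
by apply/andP; split; apply/negP => /eqP.
Qed.

(** * Rank three: the projective group *)

Section RankThree.
Hypothesis n3 : n = 3.
Let n_gt1 : (1 < n)%N. Proof. by rewrite n3. Qed.

Let trans3 (a b c a' b' c' : P) : a <> b -> a <> c -> b <> c ->
  a' <> b' -> a' <> c' -> b' <> c' ->
  exists g, [/\ act g a = a', act g b = b' & act g c = c'].
Proof.
move=> ab ac bc ab' ac' bc'.
have [||g [ga gb gc]] := sharply_transitive n_gt1 (uniq3 ab ac bc) (uniq3 ab' ac' bc').
- by rewrite n3.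
- by rewrite n3.
by exists g.
Qed.

Let sharp3 g (a b c : P) : a <> b -> a <> c -> b <> c ->
  act g a = a -> act g b = b -> act g c = c -> g = 1.
Proof.
move=> ab ac bc ga gb gc; apply: (sharply n_gt1 (uniq3 ab ac bc)).
  by rewrite n3.
by rewrite /= ga gb gc.
Qed.

Local Open Scope ring_scope.

(* [al] is a multiplicative involution of the field with at most one fixed
   point besides 1, hence trivial on the norms [c * al c], hence the inverse on
   squares. *)
Lemma inversion_chart (K : fieldType) (pt : K -> P) (w : P) (s : G) :
  injective pt -> (forall x, x <> w <-> exists k, pt k = x) ->
  (forall g, act g w = w -> exists a b : K, a != 0 /\
      forall k, act g (pt k) = pt (a * k + b)) ->
  (forall a b : K, a != 0 -> exists2 g, act g w = w &
      forall k, act g (pt k) = pt (a * k + b)) ->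
  (forall a : K, exists b, b * b = a) ->
  act s w = pt 0 -> act s (pt 0) = w -> act s (pt 1) = pt 1 ->
  forall k, k != 0 -> act s (pt k) = pt k^-1.
Proof.
move=> ptinj ptw gaff affg sqr sw so se.
have nw k : pt k <> w by apply/ptw; exists k.
have npt k l : k != l -> pt k <> pt l by move=> /eqP kl /ptinj.
have n01 : (0 : K) != 1 by rewrite eq_sym oner_neq0.
have ss : (s * s = 1)%g.
  apply: (sharp3 (a := w) (b := pt 0) (c := pt 1)); rewrite ?actM ?sw ?so ?se //.
  - exact: nesym.
  - exact: nesym.
  - exact: npt.
have ssx x : act s (act s x) = x by rewrite -actM ss act1.
have sV : s^-1%g = s by apply: (mulgI s); rewrite mulgV ss.
have /choice[al alP] : forall k, exists k', k != 0 -> k' != 0 /\ act s (pt k) = pt k'.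
  move=> k; have [->|k0] := eqVneq k 0; first by exists 0.
  have /ptw[k' k'E] : act s (pt k) <> w.
    by rewrite -so => /(@act_inj s) /ptinj /eqP; rewrite (negPf k0).
  exists k' => _; split=> //; apply/eqP => k'0; apply: (nw k).
  by rewrite -(ssx (pt k)) -k'E k'0 so.
have alE k : k != 0 -> act s (pt k) = pt (al k) by move=> /alP[].
have al0 k : k != 0 -> al k != 0 by move=> /alP[].
(* Conjugation by [s] takes multiplication by [k] to an affine map fixing 0, namely multiplication
   by [al k]. *)
have alM k l : k != 0 -> l != 0 -> al (k * l) = al k * al l.
  move=> k0 l0; have [g gw gE] := affg k 0 k0.
  have {}gE j : act g (pt j) = pt (k * j) by rewrite gE addr0.
  have go : act g (pt 0) = pt 0 by rewrite gE mulr0.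
  have [|a [b [a0 hE]]] := gaff (s * g * s^-1)%g.
    by rewrite sV !actM sw go so.
  have b0 : b = 0.
    apply: ptinj; have := hE 0; rewrite mulr0 add0r => <-.
    by rewrite sV !actM so gw sw.
  have aE : a = al k.
    apply: ptinj; have := hE 1; rewrite mulr1 b0 addr0 => <-.
    by rewrite sV !actM se gE mulr1 alE.
  apply: ptinj; have := hE (al l); rewrite b0 addr0 aE => <-.
  rewrite sV !actM -alE //; last by rewrite mulf_neq0.
  by rewrite -[in RHS]alE // ssx gE.
have alK k : k != 0 -> al (al k) = k.
  by move=> k0; apply: ptinj; rewrite -!alE ?al0 // ssx.
have fix2 k l : k != 0 -> l != 0 -> al k = k -> al l = l -> k != 1 -> l != 1 -> k = l.
  move=> k0 l0 ak akl k1 l1; apply/eqP; apply: contraT => kl.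
  have s1 : s = 1%g.
    have sk : act s (pt k) = pt k by rewrite alE // ak.
    have sl : act s (pt l) = pt l by rewrite alE // akl.
    by apply: (sharp3 _ _ _ se sk sl); apply: npt; rewrite // eq_sym.
  by case: (nw 0); rewrite -sw s1 act1.
move=> k k0; rewrite alE //; congr pt.
have [c cc] := sqr k.
have c0 : c != 0 by apply: contraNneq k0 => c0; rewrite -cc c0 mulr0.
pose v := c * al c.
have v0 : v != 0 by rewrite mulf_neq0 // al0.
have av : al v = v by rewrite alM ?al0 // alK // mulrC.
(* Both [v] and its square are fixed by [al]; if neither were 1, [fix2] would equate them. *)
have vv : v * v = 1.
  have [->|v1] := eqVneq v 1; first by rewrite mulr1.
  apply/eqP; apply: contraT => vv1; exfalso.
  have /(fix2 _ _ v0) : v * v != 0 by rewrite mulf_neq0.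
  move=> /(_ av); rewrite alM // av => /(_ erefl v1 vv1) /eqP.
  by rewrite -{1}[v]mulr1 (inj_eq (mulfI v0)) eq_sym (negPf v1).
apply: (mulfI k0); rewrite mulfV // -cc alM // mulrACA.
exact: vv.
Qed.

Lemma rank_three : exists K : closedFieldType, isomorphic_actions act (@PGL_act K).
Proof.
have [q qi sq] := generic_list 3 (finite_set0 P).
have uq := indseq_uniq pg qi.
case: q qi sq uq => [|w [|o [|e [|//]]]] //= qi _ uq.
have wo : w <> o by move=> h; move: uq; rewrite h !inE eqxx.
have we : w <> e by move=> h; move: uq; rewrite h !inE eqxx orbT.
have oe : o <> e by move=> h; move: uq; rewrite h !inE eqxx /= andbF.
have [||||||||K [pt [ptinj ptw [pt0 pt1] gaff affg]]] := @stabilizer_chart G P act w o e.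
- by case: nact.
- move=> a b c d aw bw cw dw ab cd.
  have [g [gw ga gb]] := trans3 (nesym aw) (nesym bw) ab (nesym cw) (nesym dw) cd.
  by exists g.
- move=> g a b aw bw ab gw ga gb.
  exact: (sharp3 (nesym aw) (nesym bw) ab gw ga gb).
- move=> a g h aw gw hw ga ha.
  have uwa := uniq2 (nesym aw).
  have [||Gab _ _] := @stab_abelian [:: w; a].
  + by rewrite n3.
  + by apply: (uniq_indseq n_gt1 uwa); rewrite n3.
  + by apply: Gab => x /= [->|[->|//]].
- exact: infinite_points.
- exact: nesym.
- exact: nesym.
- by [].
have nw k : pt k <> w by apply/ptw; exists k.
have [p|C CE] := @closedFieldType_of_roots K.
  have wZ : lset [:: w; o; e] w by left.
  (* With [w] in [Z], automorphisms fixing [Z] preserve the range of [pt], which omits only [w]. *)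
  apply: (@chart_closed K pt [:: w; o; e] [set g | act g w = w]) => //.
  - by rewrite pt0; right; left.
  - by rewrite pt1; right; right; left.
  - move=> s k [Ss sZ]; apply/ptw => h; apply: (nw k).
    have [s' _ ss'] := inverse_auto Ss.
    by rewrite -(ss' (pt k)).2 h -{1}(sZ _ wZ) (ss' w).2.
  - move=> x nx; apply/ptw => h; apply: nx; rewrite h; exact: (cl_ext pg).
  - by move=> s g [Ss sZ] /= gw; rewrite -{1}(sZ _ wZ) -auto_act // gw sZ.
subst K.
have sqr (a : C) : exists b, b * b = a.
  have [b bE] := solve_monicpoly (fun i => if i == 0%N then a else 0) (isT : (0 < 2)%N).
  exists b; rewrite -expr2 bE big_ord_recl big_ord1 /= mulr1 mul0r addr0 //.
have [s [sw so se]] := trans3 wo we oe (nesym wo) oe we.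
have sinv := inversion_chart ptinj ptw gaff affg sqr.
have {}sinv := sinv s; rewrite pt0 pt1 in sinv; have {}sinv := sinv sw so se.
have /choice[f fP] : forall x, exists l, (x = w -> l = pl_infty C) /\
    forall k, pt k = x -> l = pl_fin k.
  move=> x; have [->|/ptw[k <-]] := pselect (x = w).
    by exists (pl_infty C); split=> // k /nw.
  by exists (pl_fin k); split=> [/nw//|k' /ptinj ->].
have fw : f w = pl_infty C by exact: (fP w).1.
have fpt k : f (pt k) = pl_fin k by exact: (fP (pt k)).2.
have xP x : x = w \/ exists k, x = pt k.
  have [->|/ptw[k <-]] := pselect (x = w); [by left|by right; exists k].
have finj : injective f.
  move=> x y; have [->|[k ->]] := xP x; have [->|[l ->]] := xP y; rewrite ?fw ?fpt //.
  - by move=> /esym/pl_fin_neq.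
  - by move=> /pl_fin_neq.
  - by move=> /pl_fin_inj ->.
have fsurj l : exists x, f x = l.
  by have [->|[k ->]] := pl_cases l; [exists w|exists (pt k)].
have fbij : bijective f.
  have /choice[g gP] := fsurj; exists g => [x|l] //.
  by apply: finj; rewrite gP.
have [p [pinf p0 pinv]] := swap_projective C.
have match_s x : f (act s x) = PGL_act p (f x).
  have [->|[k ->]] := xP x; first by rewrite sw fw pinf -pt0 fpt.
  have [->|k0] := eqVneq k 0; first by rewrite pt0 so fw -pt0 fpt p0.
  by rewrite sinv // !fpt pinv.
have match_aff (g : G) (h : PGL2 C) a b : act g w = w ->
    (forall k, act g (pt k) = pt (a * k + b)) -> PGL_act h (pl_infty C) = pl_infty C ->
    (forall k, PGL_act h (pl_fin k) = pl_fin (a * k + b)) ->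
    forall x, f (act g x) = PGL_act h (f x).
  move=> gw gE hw hE x; have [->|[k ->]] := xP x; first by rewrite gw fw hw.
  by rewrite gE !fpt hE.
have [PGL1 PGLM] := @PGL_actP C.
have aG : is_action act by case: nact.
have [|||m1 m2] := @matching_from_stabilizer G (PGL2 C) P (proj_line C) act
  (@PGL_act C) f w aG (@PGL_actP C) finj fsurj.
- move=> g gw; have [a [b [a0 gE]]] := gaff g gw.
  by have [h [hw hE]] := affine_projective b a0; exists h; exact: match_aff gE hw hE.
- move=> h; rewrite fw => hw; have [a [b [a0 hE]]] := projective_fixing_infty hw.
  by have [g gw gE] := affg a b a0; exists g; exact: match_aff gE hw hE.
(* Translating the point to 0 and then applying [s] brings it to [w]; both moves have matches. *)
- move=> y /ptw[k <-].
  have [t tw tE] := affg 1 (- k) (oner_neq0 C).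
  have [h [hw hE]] := affine_projective (- k) (oner_neq0 C).
  exists (s * t)%g, (p * h)%g; split=> [|x].
    by rewrite actM tE mul1r subrr pt0.
  by rewrite actM match_s (match_aff t h _ _ tw tE hw hE) PGLM.
exists C; apply: (isomorphic_by_bijection (f := f)) => //.
- exact: act_faithful.
- exact: PGL_act_faithful.
Qed.
End RankThree.

End Action.

(* The dichotomy *)
Local Close Scope group_scope.
Local Close Scope card_scope.

Theorem theorem1p2 (n : nat) (G : groupType) (P : Type) (cl : set P -> set P)
    (act : G -> P -> P) (Sigma : set (auto G P)) :
  (1 <= n)%N ->
  is_geometry cl -> cl set0 = set0 ->
  infinite_dimensional cl -> dim_eq_card cl ->
  n_action act cl n ->
  is_auto_group act cl Sigma ->
  omega_homogeneous cl Sigma ->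
  hereditarily_unique_generics act cl Sigma n ->
  (exists A : set P, finite_set A /\
     exists H : subgroup G,
       [/\ is_invariant Sigma A H, nonclassical (sg_type H) & ~ bounded P H]) \/
  [/\ (n = 1 \/ n = 2 \/ n = 3)%N,
      (n = 1%N -> abelian_group G /\ regular_action act),
      (n = 2%N -> exists K : closedFieldType,
         isomorphic_actions act (@aff_act K)) &
      (n = 3%N -> exists K : closedFieldType,
         isomorphic_actions act (@PGL_act K))].
Proof.
move=> n_gt0 [pg _] cl0 infd dimP nact autS hom hug.
have inf := infinite_dimensional_inf_dim pg infd.
(* The alternative asks for some abelian [N], so its failure at [A] shows that the group given there
   by [hereditary_one_action] is not abelian. *)
have [abN|] := pselect (forall A, size A = n.-1 -> indseq cl set0 A ->
  exists N : subgroup G, [/\ N `<=` pt_stab act (lset A),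
    is_invariant Sigma (lset A) N,
    forall g h, sg_set N g -> sg_set N h -> (g * h = h * g)%g &
    forall x y, ~ cl (lset A) x -> ~ cl (lset A) y ->
      exists2 g, sg_set N g & act g x = y]).
  have ug := hug.1; right; split.
  - have n_lt4 : (n < 4)%N.
      rewrite ltnNge; apply/negP => n_gt3.
      apply: (rank_four pg inf nact autS hom n_gt0 abN ug cl0) => //.
      by apply: leq_trans n_gt3.
    by case: n n_gt0 n_lt4 {nact hug abN ug} => [|[|[|[|]]]] //; tauto.
  - exact: (transitive1 pg inf nact autS hom n_gt0 abN ug cl0).
  - exact: (rank_two pg inf nact autS hom n_gt0 abN ug cl0).
  - exact: (rank_three pg inf nact autS hom n_gt0 abN ug cl0).
move=> /existsNP[A /not_implyP[sA /not_implyP[Ai nN]]]; left.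
exists (lset A); split; first exact: finite_lset.
have sA' : (size A).+1 = n by rewrite sA prednK.
have [N [NA Ninv Ntr Nug]] := hereditary_one_action pg inf nact autS sA' Ai hug.
exists N; have [x nx] := inf A; split=> //.
  apply: (one_action_nonclassical pg inf nact autS hom sA' Ai NA Ninv Ntr Nug nx dimP).
  move=> ab; apply: nN; exists N; split=> // g h Ng Nh.
  have Ng' : g \in sg_set N by rewrite inE.
  have Nh' : h \in sg_set N by rewrite inE.
  exact: (congr1 val (ab (Sub g Ng') (Sub h Nh'))).
exact: (one_action_unbounded pg inf Ntr nx dimP).
Qed.
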